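(* Let $\tau$ be an arbitrary operator mean. Then $$(0,1]=\bigl\{r>0:\ \|A\tau_{[r]}B\|_\infty^{r-1}(A\tau_{[r]}B)\le A^r\tau B^r\ \text{ for all } A,B\in\mathbb{P}\bigr\},$$ $$(0,1]=\bigl\{r>0:\ A^r\tau B^r\le\lambda_{\min}(A\tau_{[r]}B)^{r-1}(A\tau_{[r]}B)\ \text{ for all } A,B\in\mathbb{P}\bigr\}.$$
   Context: $\mathcal{H}$ is an infinite-dimensional Hilbert space, $B(\mathcal{H})$ the bounded linear operators on $\mathcal{H}$, $B(\mathcal{H})^+$ the positive (semidefinite) operators, $\mathbb{P}=\mathbb{P}(\mathcal{H})$ the positive invertible operators; $\le$ is the usual order on self-adjoint operators. $A_k\searrow A$ means that the sequence is decreasing and $A_k\to A$ in the strong operator topology. For $X\in\mathbb{P}$, $\|X\|_\infty$ is the operator norm and $\lambda_{\min}(X)$ is the minimum of the spectrum of $X$. Operator mean (Kubo–Ando): a map $\tau:B(\mathcal{H})^+\times B(\mathcal{H})^+\to B(\mathcal{H})^+$ such that (i) $A\le C$, $B\le D$ imply $A\tau B\le C\tau D$; (ii) $C(A\tau B)C\le(CAC)\tau(CBC)$ for all $C\in B(\mathcal{H})^+$; (iii) $A_k\searrow A$, $B_k\searrow B$ imply $A_k\tau B_k\searrow A\tau B$; (iv) $I\tau I=I$. By Kubo–Ando, operator means correspond bijectively to nonnegative operator monotone functions $f_\tau$ on $(0,\infty)$ with $f_\tau(1)=1$ (the representing function), via $f_\tau(x)I=I\tau(xI)$ and $A\tau B=A^{1/2}f_\tau(A^{-1/2}BA^{-1/2})A^{1/2}$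 for $A,B\in\mathbb{P}$. For arbitrary $r>0$ put $(f_\tau)_{[r]}(x):=f_\tau(x^r)^{1/r}$, $x>0$, and $$A\tau_{[r]}B:=A^{1/2}(f_\tau)_{[r]}(A^{-1/2}BA^{-1/2})A^{1/2},\qquad A,B\in\mathbb{P}$$ (for $r>1$, $\tau_{[r]}$ need not be an operator mean). *)

(* Defs.v *)
From mathcomp Require Export all_boot all_order all_algebra.
From mathcomp Require Export all_classical all_reals all_analysis.
From mathcomp.real_closed Require Export complex.
Export Order.TTheory GRing.Theory Num.Theory.
Export numFieldNormedType.Exports.

Set Implicit Arguments.
Unset Strict Implicit.
Unset Printing Implicit Defensive.

Local Open Scope classical_set_scope.
Local Open Scope ring_scope.
Local Open Scope complex_scope.

(* A complex Hilbert space is a complete normed space over R[i] together with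
   a positive definite Hermitian form inducing the norm.  Forms are linear in
   their first argument and conjugate-linear in the second one.  *)
Definition induces_norm (R : realType) (H : completeNormedModType R[i])
    (dot : {dot H for Num.conj}) : Prop :=
  forall x : H, `|x| ^+ 2 = dot x x.

Definition infinite_dimensional (R : realType) (H : lmodType R[i]) : Prop :=
  forall (n : nat) (e : 'I_n -> H),
    ~ (forall x : H, exists c : 'I_n -> R[i], x = \sum_(i < n) c i *: e i).

(* Operators are plain functions H -> H, and B(H) is a predicate on them.  *)
Section Operators.
Variables (R : realType) (H : completeNormedModType R[i]).
Implicit Types (A B T : H -> H) (f : R -> R) (p : {poly R}).

Definition bounded_op A : Prop :=
  linear A /\ exists M : R, forall x : H, `|A x| <= M%:C * `|x|.

Definition opnorm A : R :=
  sup [set complex.Re `|A x| | x in [set x : H | `|x| <= 1]].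

Definition invertible_op A : Prop :=
  exists B, [/\ bounded_op B, A \o B = idfun & B \o A = idfun].

Definition spectrum A : set R[i] :=
  [set z | ~ invertible_op (A \- z \*: idfun)].

Definition real_spectrum A : set R := [set t | spectrum A t%:C].

Definition lambda_min A : R := inf (real_spectrum A).

Definition op_horner p A : H -> H :=
  fun x => \sum_(i < size p) (p`_i)%:C *: iter i A x.

(* Continuous functional calculus of a self-adjoint operator (whose spectrum
   is real): T = f(A) is the norm limit of p_n(A) for any real polynomials p_n
   converging to f uniformly on the spectrum of A.  *)
Definition is_fcalc f A T : Prop :=
  bounded_op T /\
  exists p : nat -> {poly R},
    {uniform real_spectrum A, (fun n t => (p n).[t]) @ \oo --> f} /\
    (fun n => opnorm (op_horner (p n) A \- T)) @ \oo --> (0 : R).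

Definition fcalc f A : H -> H := xget (fun=> 0) [set T | is_fcalc f A T].

Definition oppow A (r : R) : H -> H := fcalc (fun t => t `^ r) A.

End Operators.

Section OperatorMeans.
Variables (R : realType) (H : completeNormedModType R[i]).
Variable dot : {dot H for Num.conj}.
Implicit Types (A B C D : H -> H) (tau : (H -> H) -> (H -> H) -> H -> H).

(* On R[i], 0 <= z means that z is real and nonnegative; the space being
   complex, positive operators are self-adjoint.  *)
Definition posop A : Prop := bounded_op A /\ forall x : H, 0 <= dot (A x) x.

Definition posinvop A : Prop := posop A /\ invertible_op A.

Definition leop A B : Prop := posop (B \- A).

Definition op_decreases_to (Ak : nat -> H -> H) A : Prop :=
  (forall k, leop (Ak k.+1) (Ak k)) /\
  (forall x : H, (fun k => Ak k x) @ \oo --> A x).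

(* The values of tau outside of B(H)^+ x B(H)^+ are irrelevant.  *)
Record operator_mean tau : Prop := OperatorMean {
  om_pos : forall A B, posop A -> posop B -> posop (tau A B);
  om_mono : forall A B C D, posop A -> posop B -> posop C -> posop D ->
    leop A C -> leop B D -> leop (tau A B) (tau C D);
  om_transformer : forall A B C, posop A -> posop B -> posop C ->
    leop (C \o tau A B \o C) (tau (C \o A \o C) (C \o B \o C));
  om_cont : forall (Ak Bk : nat -> H -> H) A B,
    (forall k, posop (Ak k)) -> (forall k, posop (Bk k)) ->
    posop A -> posop B ->
    op_decreases_to Ak A -> op_decreases_to Bk B ->
    op_decreases_to (fun k => tau (Ak k) (Bk k)) (tau A B);
  om_id : tau idfun idfun = idfun }.

(* Representing function, characterized on x > 0 by f(x) I = I tau (x I).  *)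
Definition repfun tau (x : R) : R :=
  xget 0 [set y : R | tau idfun (x%:C \*: idfun) = y%:C \*: idfun].

Definition fbracket (f : R -> R) (r : R) (x : R) : R := f (x `^ r) `^ r^-1.

Definition taubracket tau (r : R) A B : H -> H :=
  let Ah := oppow A 2^-1 in
  let Amh := oppow A (- 2^-1) in
  Ah \o fcalc (fbracket (repfun tau) r) (Amh \o B \o Amh) \o Ah.

End OperatorMeans.

(* Main.v *)
(** For r <= 1, put D = A^-1, C = A^(-1/2) B A^(-1/2), q = (f_tau)_[r] and
    X = A tau_[r] B.  If X <= c then W := q(C)/c <= D.  By congruence,
    A^(-1/2) (A^r tau B^r) A^(-1/2) = D^(1-r) tau G(D), where
    G(D) = A^(-1/2) B^r A^(-1/2) is the weighted geometric mean of D and C, which also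
    equals C^(1/2) (C^(-1/2) D C^(-1/2))^(1-r) C^(1/2).  By the Loewner-Heinz inequality
    both arguments are monotone in D, so replacing D by W gives the lower bound
    W^(1-r) tau (W^(1-r) C^r) = W^(1-r) f_tau(C^r) = c^(r-1) q(C).  With c = |X| this is the
    first inequality; reversing all of them, c = lambda_min(X) gives the second one.
    For r > 1 both inequalities fail for A = B with two distinct eigenvalues.

    The identity I tau T = f_tau(T) is proved without spectral projections: I tau T
    commutes with T, and the bounds f(a) / (1 + |a/t - 1|) <= f(t) <= f(a) (1 + |t/a - 1|)
    have operator analogues which trap I tau T, up to e + k (T - a)^2, near f_tau(T); these
    bounds for varying a are glued by the Bernstein polynomials of T. *)

Require Import Defs.
From mathcomp Require Import ring lra.
Local Open Scope classical_set_scope.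
Local Open Scope ring_scope.
Local Open Scope complex_scope.

(** The exponent 1 - r of the overview lies in [0, 1] exactly when 0 <= r <= 1, which is where the
    bound on r enters. Replacing D by W pays off because W is a function of C: the two arguments of
    tau then commute, W^((1-r)/2) can be pulled out on both sides, and what remains is I tau C^r =
    f_tau(C^r). The constant arises as (q/c)^(1-r) q^r = c^(r-1) q.

    The axioms of tau supply order relations and congruences only, and f_tau is defined by values at
    scalar operators. So the commutation of I tau T with T has to be extracted from inequalities
    before any calculus can be applied to it.

    Loewner-Heinz is reached by bisection of exponents: square roots are compared directly,
    geometric means carry the exponents s and t to (s + t) / 2, and continuity in the exponent
    covers the rest of [0, 1].

    For A = B one has A tau_[r] A = A and A^r tau A^r = A^r, so the two claims read |A|^(r-1) A <=
    A^r and A^r <= lambda_min(A)^(r-1) A; eigenvalues 1 and 2 refute both when r > 1. *)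

Section Hilbert.
Set Implicit Arguments.
Unset Strict Implicit.
Unset Printing Implicit Defensive.
Variables (R : realType) (H : completeNormedModType R[i]).
Variable dot : {dot H for Num.conj}.
Implicit Types (x y z : H) (a : R) (A B : H -> H).

(** * Real inner product, bounded and self-adjoint operators *)

(** Working with the real part keeps every estimate in the ordered field [R], within reach of [lra]
    and [nra]; [dotE] recovers the complex form. *)
Definition ip x y : R := complex.Re (dot x y).

Lemma ReM_real a (z : R[i]) : complex.Re (a%:C * z) = a * complex.Re z.
Proof. by case: z => u v; simpc. Qed.

Lemma dotC x y : dot x y = (dot y x)^*%C.
Proof. by rewrite hermC /= expr0 mul1r. Qed.

Lemma ipC x y : ip x y = ip y x.
Proof. by rewrite /ip dotC; case: (dot y x). Qed.

Lemma ipDl x y z : ip (x + y) z = ip x z + ip y z.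
Proof. by rewrite /ip linearDl raddfD. Qed.

Lemma ipNl x z : ip (- x) z = - ip x z.
Proof. by rewrite /ip linearNl raddfN. Qed.

Lemma ipZl a x z : ip (a%:C *: x) z = a * ip x z.
Proof. by rewrite /ip linearZl_LR /= ReM_real. Qed.

Lemma ipDr x y z : ip z (x + y) = ip z x + ip z y.
Proof. by rewrite ipC ipDl ![ip _ z]ipC. Qed.

Lemma ipNr x z : ip z (- x) = - ip z x.
Proof. by rewrite ipC ipNl ipC. Qed.

Lemma ipZr a x z : ip z (a%:C *: x) = a * ip z x.
Proof. by rewrite ipC ipZl ipC. Qed.

Lemma ip0l x : ip 0 x = 0.
Proof. by rewrite /ip linear0l raddf0. Qed.

Lemma ip0r x : ip x 0 = 0.
Proof. by rewrite ipC ip0l. Qed.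

Definition ipE := (ipDl, ipDr, ipNl, ipNr, ipZl, ipZr, ip0l, ip0r).

Lemma dot_self x : dot x x = (ip x x)%:C.
Proof.
have := dnorm_ge0 dot x; rewrite /ip; case: (dot x x) => u v /=.
by rewrite lecE /= => /andP[/eqP -> _].
Qed.

Lemma ip_ge0 x : 0 <= ip x x.
Proof. by rewrite -ler0c -dot_self dnorm_ge0. Qed.

Lemma ip_eq0 x : ip x x = 0 -> x = 0.
Proof. by move=> x0; apply/eqP; rewrite -(dnorm_eq0 dot) dot_self x0. Qed.

Lemma eq_ip x y : (forall z, ip x z = ip y z) -> x = y.
Proof.
by move=> xy; apply/eqP; rewrite -subr_eq0; apply/eqP/ip_eq0; rewrite ipDl ipNl xy subrr.
Qed.

Lemma n2D_le x y : ip (x + y) (x + y) <= 2 * ip x x + 2 * ip y y.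
Proof.
have := ip_ge0 (x - y); rewrite !ipE (ipC y x); lra.
Qed.

Hypothesis dot_norm : induces_norm dot.

Lemma norm_sqr x : (complex.Re `|x|) ^+ 2 = ip x x.
Proof.
have := dot_norm x; rewrite dot_self.
have /ger0_Im := normr_ge0 x; case: `|x| => u v /= ->.
by rewrite expr2; simpc => -[].
Qed.

Lemma normE x : `|x| = (complex.Re `|x|)%:C.
Proof. by have /ger0_Im := normr_ge0 x; case: `|x| => u v /= ->. Qed.

Lemma Re_norm_ge0 x : 0 <= complex.Re `|x|.
Proof. by rewrite -ler0c -normE. Qed.

Lemma norm_le a x : 0 <= a -> (`|x| <= a%:C) = (ip x x <= a ^+ 2).
Proof.
by move=> a0; rewrite normE lecR -norm_sqr ler_pXn2r // nnegrE Re_norm_ge0.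
Qed.

Lemma norm_lt a x : 0 <= a -> (`|x| < a%:C) = (ip x x < a ^+ 2).
Proof.
by move=> a0; rewrite normE ltcR -norm_sqr ltr_pXn2r // nnegrE Re_norm_ge0.
Qed.

Lemma bounded_opP A :
  bounded_op A <->
  linear A /\ exists2 M : R, 0 <= M & forall x, ip (A x) (A x) <= M ^+ 2 * ip x x.
Proof.
split=> -[linA].
- move=> [M hM]; split=> //; exists `|M| => // x.
  rewrite -!norm_sqr -exprMn ler_pXn2r ?nnegrE ?mulr_ge0 ?Re_norm_ge0 //.
  have := hM x; rewrite (normE (A x)) (normE x) -[_ * _]rmorphM /= lecR => /le_trans; apply.
  by rewrite ler_wpM2r ?Re_norm_ge0 // ler_norm.
- move=> [M M0 hM]; split=> //; exists M => x.
  rewrite (normE x) -[M%:C * _]rmorphM /= norm_le ?mulr_ge0 ?Re_norm_ge0 //.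
  by rewrite exprMn norm_sqr.
Qed.

Lemma opD A x y : bounded_op A -> A (x + y) = A x + A y.
Proof. by move=> [lA _]; have := lA 1 x y; rewrite !scale1r. Qed.

Lemma op0 A : bounded_op A -> A 0 = 0.
Proof. by move=> hA; have := opD 0 0 hA; rewrite addr0 => /eqP; rewrite -subr_eq0 opprD addNKr oppr_eq0 => /eqP. Qed.

Lemma opZ A (c : R[i]) x : bounded_op A -> A (c *: x) = c *: A x.
Proof. by move=> hA; have := hA.1 c x 0; rewrite !addr0 (op0 hA) addr0. Qed.

Lemma opN A x : bounded_op A -> A (- x) = - A x.
Proof. by move=> hA; rewrite -scaleN1r (opZ _ _ hA) scaleN1r. Qed.

Lemma opB A x y : bounded_op A -> A (x - y) = A x - A y.
Proof. by move=> hA; rewrite (opD _ _ hA) (opN _ hA). Qed.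

Lemma bounded_id : bounded_op (idfun : H -> H).
Proof. by apply/bounded_opP; split=> //; exists 1 => // x; rewrite expr1n mul1r. Qed.

Lemma bounded_comp A B : bounded_op A -> bounded_op B -> bounded_op (A \o B).
Proof.
move=> hA hB; have [_ [M M0 hM]] := (bounded_opP A).1 hA.
have [_ [N N0 hN]] := (bounded_opP B).1 hB; apply/bounded_opP; split.
  by move=> c x y; rewrite /= (opD _ _ hB) (opZ _ _ hB) (opD _ _ hA) (opZ _ _ hA).
exists (M * N) => [|x /=]; first exact: mulr_ge0.
apply: (le_trans (hM _)); rewrite exprMn -(mulrA (M ^+ 2)); apply: ler_wpM2l; [exact: sqr_ge0 | exact: hN].
Qed.

Lemma ip_scale (c : R[i]) x :
  ip (c *: x) (c *: x) = complex.Re `|c| ^+ 2 * ip x x.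
Proof.
rewrite -!norm_sqr -exprMn normrZ {1}(normE x) normc_def.
by rewrite -[_ * _]rmorphM.
Qed.

Lemma bounded_scale (c : R[i]) A : bounded_op A -> bounded_op (c \*: A).
Proof.
move=> hA; have [_ [M M0 hM]] := (bounded_opP A).1 hA; apply/bounded_opP; split.
  by move=> d x y; rewrite /= (opD _ _ hA) (opZ _ _ hA) scalerDr !scalerA mulrC.
exists (complex.Re `|c| * M) => [|x /=].
  by rewrite mulr_ge0 // normc_def /= sqrtr_ge0.
by rewrite ip_scale exprMn -(mulrA (_ ^+ 2)); apply: ler_wpM2l; [exact: sqr_ge0 | exact: hM].
Qed.

Lemma bounded_add A B : bounded_op A -> bounded_op B -> bounded_op (A \+ B).
Proof.
move=> hA hB; have [_ [M M0 hM]] := (bounded_opP A).1 hA.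
have [_ [N N0 hN]] := (bounded_opP B).1 hB; apply/bounded_opP; split.
  move=> c x y; rewrite /= (opD _ _ hB) (opZ _ _ hB) (opD _ _ hA) (opZ _ _ hA).
  by rewrite scalerDr addrACA.
exists (2 * (M + N)) => [|x /=]; first by rewrite mulr_ge0 ?addr_ge0.
have := n2D_le (A x) (B x); have := hM x; have := hN x.
have := mulr_ge0 (mulr_ge0 M0 N0) (ip_ge0 x).
have := mulr_ge0 (sqr_ge0 M) (ip_ge0 x); have := mulr_ge0 (sqr_ge0 N) (ip_ge0 x).
rewrite !exprMn sqrrD; lra.
Qed.

Lemma bounded_opp A : bounded_op A -> bounded_op (\- A).
Proof.
move=> hA; have := bounded_scale (-1) hA.
by have -> : (-1 \*: A) = \- A by apply/funext => x /=; rewrite scaleN1r.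
Qed.

Lemma bounded_sub A B : bounded_op A -> bounded_op B -> bounded_op (A \- B).
Proof. by move=> hA hB; apply: (bounded_add hA (bounded_opp hB)). Qed.

(** The form is conjugate-linear on the right, so pairing with 'i *: y multiplies it by -i and moves
    the imaginary part into the real one. *)
Lemma dotE x y : dot x y = ip x y +i* ip x ('i *: y).
Proof.
rewrite /ip linearZr_LR /=; case: (dot x y) => u v.
by apply/eqP; rewrite eq_complex /= !eqxx /= !mul0r sub0r mulN1r opprK eqxx.
Qed.

(** Symmetry of the real part suffices: A is complex linear, so replacing y by 'i *: y gives
    symmetry of the imaginary part as well. *)
Definition selfadj A := bounded_op A /\ forall x y, ip (A x) y = ip x (A y).

Lemma selfadj_form_real A x : selfadj A -> dot (A x) x = (ip (A x) x)%:C.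
Proof.
move=> [bA sA]; rewrite dotE; congr Complex.
have : ip (A x) ('i *: x) = - ip (A x) ('i *: x); last by lra.
rewrite {1}sA (opZ _ _ bA) ipC.
have := dotE (A x) ('i *: x); rewrite linearZr_LR /= dotE.
move=> [_ _]; rewrite /ip linearZl_LR linearZr_LR /=.
by case: (dot (A x) x) => u v /=; rewrite !mul0r !sub0r !mul1r mulN1r opprK.
Qed.

(** A quadratic form with real values is symmetric by polarization: the imaginary part of the form
    at x + i y is ip (A y) x - ip (A x) y. *)
Lemma posopP A : posop dot A <-> selfadj A /\ forall x, 0 <= ip (A x) x.
Proof.
split; last first.
  move=> [sA pA]; split; first exact: sA.1.
  by move=> x; rewrite selfadj_form_real // ler0c.
move=> [bA pA].
have real x : dot (A x) x = (ip (A x) x)%:C.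
  by have /ger0_Im := pA x; rewrite /ip; case: (dot _ _) => u v /= ->.
split; last by move=> x; rewrite -ler0c -real.
split=> // x y; have e1 := real (x + 'i *: y).
move: e1; rewrite (opD _ _ bA) (opZ _ _ bA) !linearDl !linearDr /=.
rewrite !linearZl_LR !linearZr_LR /= !real.
rewrite (ipC x) /ip; case: (dot (A x) y) => u v; case: (dot (A y) x) => u' v'.
case; simpc => /= _; lra.
Qed.

Lemma cauchy_schwarz x y : ip x y ^+ 2 <= ip x x * ip y y.
Proof.
have [y0|yN] := eqVneq (ip y y) 0.
  by rewrite (ip_eq0 y0) !ip0r mulr0 expr0n.
have y_gt0 : 0 < ip y y by rewrite lt_def yN ip_ge0.
have := ip_ge0 ((ip y y)%:C *: x - (ip x y)%:C *: y).
rewrite !ipE (ipC y x) => h.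
rewrite -subr_ge0 -(pmulr_rge0 _ y_gt0); lra.
Qed.

Lemma selfadj_id : selfadj (idfun : H -> H).
Proof. by split=> //; exact: bounded_id. Qed.

Lemma selfadj_add A B : selfadj A -> selfadj B -> selfadj (A \+ B).
Proof.
move=> [bA sA] [bB sB]; split; first exact: bounded_add.
by move=> x y; rewrite /= !ipE sA sB.
Qed.

Lemma selfadj_opp A : selfadj A -> selfadj (\- A).
Proof.
by move=> [bA sA]; split=> [|x y]; [exact: bounded_opp | rewrite /= !ipE sA].
Qed.

Lemma selfadj_sub A B : selfadj A -> selfadj B -> selfadj (A \- B).
Proof. by move=> sA sB; exact: (selfadj_add sA (selfadj_opp sB)). Qed.

Lemma selfadj_scale a A : selfadj A -> selfadj (a%:C \*: A).
Proof.
by move=> [bA sA]; split=> [|x y]; [exact: bounded_scale | rewrite /= !ipE sA].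
Qed.

Lemma selfadj_comp A B : selfadj A -> selfadj B ->
  (forall x, A (B x) = B (A x)) -> selfadj (A \o B).
Proof.
move=> [bA sA] [bB sB] AB; split=> [|x y]; first exact: bounded_comp.
by rewrite /= sA sB AB.
Qed.

Lemma selfadj_conj A B : selfadj A -> selfadj B -> selfadj (B \o A \o B).
Proof.
move=> [bA sA] [bB sB]; split=> [|x y]; last by rewrite /= sB sA sB.
by do 2![apply: bounded_comp => //].
Qed.

Lemma leopP A B : selfadj A -> selfadj B ->
  leop dot A B <-> forall x, ip (A x) x <= ip (B x) x.
Proof.
move=> sA sB; rewrite /leop posopP; split=> [[_ h] x|h].
  by have := h x; rewrite /= !ipE subr_ge0.
split=> [|x]; first exact: selfadj_sub.
by rewrite /= !ipE subr_ge0.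
Qed.

Lemma selfadj_eq A B : selfadj A -> selfadj B ->
  (forall x, ip (A x) x = ip (B x) x) -> A = B.
Proof.
move=> [bA sA] [bB sB] AB; apply/funext => x; apply: (@eq_ip) => y.
have := AB (x + y); rewrite !opD // !ipE !AB (sA y x) (sB y x) (ipC y (A x)) (ipC y (B x)).
lra.
Qed.

Lemma bounded_form A : bounded_op A ->
  exists2 M : R, 0 < M & forall x, - (M * ip x x) <= ip (A x) x <= M * ip x x.
Proof.
move=> bA; have [_ [M M0 hM]] := (bounded_opP A).1 bA.
have M1 : 0 < M + 1 by lra.
exists (M + 1) => // x.
have h := hM x; have x0 := ip_ge0 x.
have h1 : ip (A x) (A x) <= (M + 1) ^+ 2 * ip x x by nra.
have := ip_ge0 (A x - (M + 1)%:C *: x); have := ip_ge0 (A x + (M + 1)%:C *: x).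
rewrite !ipE (ipC x (A x)) => h2 h3.
apply/andP; split; rewrite -(ler_pM2l M1); nra.
Qed.

(** This is A^2 <= M A: positivity at M x - A x is combined with the upper bound at A x. *)
Lemma pos_norm_le A (M : R) : selfadj A -> 0 < M ->
  (forall x, 0 <= ip (A x) x <= M * ip x x) ->
  forall x, ip (A x) (A x) <= M * ip (A x) x.
Proof.
move=> [bA sA] M0 hA x.
have /andP[_ h] := hA (A x).
have /andP[+ _] := hA (M%:C *: x - A x).
rewrite opB // opZ // !ipE (sA (A x) x) => h1.
rewrite -(ler_pM2l M0); nra.
Qed.

(** Subtract the lower bound of the form at e x - A x from the upper bound at e x + A x; symmetry
    leaves 4 e |A x|^2 on the left. For e = 0 these vectors carry no scale, and polarization along A
    x is used instead. *)
Lemma selfadj_norm_le A (e : R) : selfadj A -> 0 <= e ->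
  (forall x, - (e * ip x x) <= ip (A x) x <= e * ip x x) ->
  forall x, ip (A x) (A x) <= e ^+ 2 * ip x x.
Proof.
move=> [bA sA]; rewrite le_eqVlt => /orP[/eqP <-|e0] hA x.
  have h0 y : ip (A y) y = 0 by have := hA y; rewrite mul0r oppr0 -eq_le => /eqP.
  have := h0 (x + A x); rewrite opD // !ipE !h0 (sA (A x)) expr0n mul0r; lra.
have /andP[_ h1] := hA (e%:C *: x + A x).
have /andP[h2 _] := hA (e%:C *: x - A x).
move: h1 h2; rewrite opB // opD // opZ // !ipE (sA (A x) x) (ipC x (A x)) => h1 h2.
rewrite -(ler_pM2l e0); nra.
Qed.

(** * Completeness and inversion of coercive operators *)

Lemma hilbert_complete (u : nat -> H) :
  (forall e : R, 0 < e -> exists N, forall m n, (N <= m)%N -> (N <= n)%N ->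
     ip (u m - u n) (u m - u n) < e) ->
  exists l, forall e : R, 0 < e -> exists N, forall n, (N <= n)%N ->
     ip (u n - l) (u n - l) < e.
Proof.
move=> uC.
have : cvg (u @ \oo).
  apply/cauchy_cvgP/cauchy_ballP => e e0.
  have eE : e = (complex.Re e)%:C.
    by move: e0; case: e => a b; rewrite ltcE /= => /andP[/eqP -> _].
  rewrite eE ltcR in e0; rewrite eE.
  have [N hN] := uC _ (exprn_gt0 2 e0).
  near_simpl; exists ([set n | (N <= n)%N], [set n | (N <= n)%N]).
    by split; exists N.
  move=> [m n] [/= Nm Nn]; rewrite -ball_normE /= norm_lt ?ltW //.
  exact: hN.
move=> /cvg_ex[l ul]; exists l => e e0.
have : 0 < (Num.sqrt e)%:C :> R[i] by rewrite ltcR sqrtr_gt0.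
move/cvgrPdist_lt: ul => /[apply] -[N _ hN].
exists N => n Nn; have := hN n Nn.
by rewrite /= distrC norm_lt ?sqrtr_ge0 // sqr_sqrtr ?ltW.
Qed.

Lemma geometric_small (t K e : R) : 0 <= t < 1 -> 0 < e ->
  exists N, forall n, (N <= n)%N -> t ^+ n * K < e.
Proof.
move=> /andP[t0 t1] e0.
have : (fun n => t ^+ n) @ \oo --> (0 : R) by apply: cvg_expr; rewrite ger0_norm.
have d0 : 0 < e / (`|K| + 1) by rewrite divr_gt0 // ltr_wpDl.
move/cvgrPdist_lt => /(_ _ d0)[N _ hN]; exists N => n Nn.
have := hN n Nn; rewrite /= sub0r normrN ger0_norm ?exprn_ge0 // => h.
rewrite (@le_lt_trans _ _ (t ^+ n * (`|K| + 1))) //.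
  by rewrite ler_wpM2l ?exprn_ge0 //; have := ler_norm K; lra.
by rewrite -ltr_pdivlMr // ltr_wpDl.
Qed.

Lemma coercive_norm A (c : R) : 0 <= c ->
  (forall x, c * ip x x <= ip (A x) x) ->
  forall x, c ^+ 2 * ip x x <= ip (A x) (A x).
Proof.
move=> c0 hA x; have [x0|xN] := eqVneq (ip x x) 0.
  by rewrite x0 mulr0 ip_ge0.
have x_gt0 : 0 < ip x x by rewrite lt_def xN ip_ge0.
have h := cauchy_schwarz (A x) x; have h1 := hA x.
rewrite -(ler_pM2r x_gt0); apply: le_trans h.
rewrite -mulrA -expr2 -exprMn ler_pXn2r // nnegrE ?mulr_ge0 ?ip_ge0 //.
by apply: le_trans h1; rewrite mulr_ge0 ?ip_ge0.
Qed.

(** A x = y is solved by the iteration u + (y - A u) / (M + c). Each step applies Q = I - A / (M +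
    c) to the residual, and the form of Q lies between 0 and t = M / (M + c) < 1. *)
Lemma coercive_surj A (c : R) : selfadj A -> 0 < c ->
  (forall x, c * ip x x <= ip (A x) x) -> forall y, exists x, A x = y.
Proof.
move=> sA c0 hA y; have [bA _] := sA.
have [M M0 hM] := bounded_form bA.
have Mc : 0 < M + c by lra.
pose Q := (idfun : H -> H) \- (M + c)^-1%:C \*: A.
have sQ : selfadj Q by exact: (selfadj_sub selfadj_id (selfadj_scale _ sA)).
pose t := M / (M + c).
have t0 : 0 <= t by rewrite divr_ge0 // ltW.
have t1 : t < 1 by rewrite ltr_pdivrMr // mul1r; lra.
have tE : t * (M + c) = M by rewrite divfK // gt_eqF.
have hQ x : ip (Q x) (Q x) <= t ^+ 2 * ip x x.
  apply: selfadj_norm_le => // z; rewrite /Q /= !ipE.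
  have := hA z; have /andP[_] := hM z; have := ip_ge0 z => z0 h1 h2.
  have e1 : (M + c) * ((M + c)^-1 * ip (A z) z) = ip (A z) z.
    by rewrite mulVKf // gt_eqF.
  by apply/andP; split; rewrite -(ler_pM2l Mc); nra.
pose u := fix u n := if n is n'.+1 then u n' + (M + c)^-1%:C *: (y - A (u n')) else 0.
have uS n : u n.+1 = u n + (M + c)^-1%:C *: (y - A (u n)) by [].
have res n : ip (y - A (u n)) (y - A (u n)) <= (t ^+ 2) ^+ n * ip y y.
  elim: n => [|n IH]; first by rewrite /= (op0 bA) subr0 expr0 mul1r.
  have -> : y - A (u n.+1) = Q (y - A (u n)).
    by rewrite uS (opD _ _ bA) (opZ _ _ bA) /Q /= opprD addrA.
  by apply: (le_trans (hQ _)); rewrite [_ ^+ n.+1]exprS -(mulrA (t ^+ 2)) ler_wpM2l ?sqr_ge0.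
have t2 : 0 <= t ^+ 2 < 1 by rewrite sqr_ge0 expr_lt1.
have c2 : 0 < c ^+ 2 by rewrite exprn_gt0.
have [l hl] : exists l, forall e : R, 0 < e -> exists N, forall n, (N <= n)%N ->
     ip (u n - l) (u n - l) < e.
  apply: hilbert_complete => e e0.
  have e1 : 0 < c ^+ 2 * e / 4 by rewrite divr_gt0 // mulr_gt0.
  have [N hN] := geometric_small (ip y y) t2 e1.
  exists N => m n Nm Nn; rewrite -(ltr_pM2l c2).
  (* Coercivity bounds the distance of two iterates by the distance of their images, that is, by
     their residuals. *)
  have h := coercive_norm (ltW c0) hA (u m - u n); apply: le_lt_trans h _.
  have -> : A (u m - u n) = (y - A (u n)) + - (y - A (u m)).
    by rewrite (opB _ _ bA) opprB [RHS]addrC addrA subrK.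
  apply: le_lt_trans (n2D_le _ _) _; rewrite [ip (- _) _]ipNl ipNr opprK.
  have := hN m Nm; have := hN n Nn; have := res n; have := res m; lra.
exists l; apply/eqP; rewrite -subr_eq0; apply/eqP/ip_eq0/eqP.
rewrite eq_le ip_ge0 andbT; apply/ler_addgt0Pr => e e0; rewrite add0r.
have [_ [K K0 hK]] := (bounded_opP A).1 bA.
have e1 : 0 < e / (4 * (K ^+ 2 + 1)).
  by rewrite divr_gt0 // mulr_gt0 // ltr_wpDl ?sqr_ge0.
have [N1 hN1] := hl _ e1.
have e2 : 0 < e / 4 by rewrite divr_gt0.
have [N2 hN2] := geometric_small (ip y y) t2 e2.
pose n := maxn N1 N2.
have h1 := hN1 n (leq_maxl _ _); have h2 := hN2 n (leq_maxr _ _).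
have -> : A l - y = - (A (u n - l) + (y - A (u n))).
  by rewrite (opB _ _ bA) -addrA [- A l + _]addrC addrA [A (u n) + _]addrC subrK opprB.
rewrite ipNl ipNr opprK; apply: le_trans (n2D_le _ _) _.
have h3 := hK (u n - l); have h4 := res n.
rewrite ltr_pdivlMr in h1; last by rewrite mulr_gt0 // ltr_wpDl ?sqr_ge0.
have := ip_ge0 (u n - l); lra.
Qed.

Lemma coercive_inverse A (c : R) : selfadj A -> 0 < c ->
  (forall x, c * ip x x <= ip (A x) x) ->
  exists2 B, selfadj B & (forall x, A (B x) = x) /\ (forall x, B (A x) = x).
Proof.
move=> sA c0 hA; have [bA sA'] := sA.
have [B AB] := choice (coercive_surj sA c0 hA).
have n2A := coercive_norm (ltW c0) hA.
have c2 : 0 < c ^+ 2 by rewrite exprn_gt0.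
have injA x y : A x = A y -> x = y.
  move=> Axy; apply/eqP; rewrite -subr_eq0; apply/eqP/ip_eq0/eqP.
  rewrite eq_le ip_ge0 andbT -(ler_pM2l c2).
  by apply: (le_trans (n2A _)); rewrite (opB _ _ bA) Axy subrr ip0l mulr0.
have BA x : B (A x) = x by apply: injA; rewrite AB.
exists B; last by split.
split; last by move=> x y; rewrite -{1}(AB y) -sA' AB.
apply/bounded_opP; split.
  by move=> a x y; apply: injA; rewrite AB (opD _ _ bA) (opZ _ _ bA) !AB.
exists c^-1 => [|x]; first by rewrite invr_ge0 ltW.
by rewrite exprVn ler_pdivlMl // -{3 4}(AB x).
Qed.

Lemma invertible_opP A : bounded_op A ->
  invertible_op A <->
  exists2 B, bounded_op B & (forall x, A (B x) = x) /\ (forall x, B (A x) = x).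
Proof.
move=> bA; split=> [[B [bB AB BA]]|[B bB [AB BA]]]; exists B => //.
  by split=> x; [have := congr1 (@^~ x) AB | have := congr1 (@^~ x) BA].
by split=> //; apply/funext.
Qed.

Lemma coercive_invertible A (c : R) : selfadj A -> 0 < c ->
  (forall x, c * ip x x <= ip (A x) x) -> invertible_op A.
Proof.
move=> sA c0 hA; apply/invertible_opP; first exact: sA.1.
by have [B [bB _] hB] := coercive_inverse sA c0 hA; exists B.
Qed.

(** If K bounds the inverse, then |x|^2 <= K^2 |A x|^2 <= K^2 M <A x, x>. Writing K^2 + 1 keeps the
    constant invertible when K = 0. *)
Lemma pos_invertible_coercive A : selfadj A -> (forall x, 0 <= ip (A x) x) ->
  invertible_op A -> exists2 c : R, 0 < c & forall x, c * ip x x <= ip (A x) x.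
Proof.
move=> sA pA /(invertible_opP sA.1)[B bB [AB BA]].
have [M M0 hM] := bounded_form sA.1.
have [_ [K K0 hK]] := (bounded_opP B).1 bB.
have hA : forall x, ip (A x) (A x) <= M * ip (A x) x.
  by apply: pos_norm_le => // x; rewrite pA; case/andP: (hM x).
have K1 : 0 < K ^+ 2 + 1 by rewrite ltr_wpDl ?sqr_ge0.
exists (M * (K ^+ 2 + 1))^-1 => [|x]; first by rewrite invr_gt0 mulr_gt0.
rewrite ler_pdivrMl ?mulr_gt0 //.
have h1 := hK (A x); rewrite BA in h1; have h2 := hA x; have h3 := pA x.
apply: (le_trans h1); apply: (le_trans (ler_wpM2l (sqr_ge0 K) h2)).
by have := mulr_ge0 (ltW M0) h3; lra.
Qed.

(** * Polynomial calculus and spectrum *)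

(** The complex counterpart of [op_horner]: over [R[i]] every polynomial splits into linear
    factors. *)
Definition chorner (q : {poly R[i]}) A : H -> H :=
  fun x => \sum_(i < size q) q`_i *: iter i A x.

Lemma chorner_widen n (q : {poly R[i]}) A x : (size q <= n)%N ->
  chorner q A x = \sum_(i < n) q`_i *: iter i A x.
Proof.
move=> qn; rewrite /chorner (big_ord_widen n (fun i => q`_i *: iter i A x) qn).
rewrite big_mkcond /=; apply: eq_bigr => i _; case: ltnP => // qi.
by rewrite nth_default // scale0r.
Qed.

Lemma chornerD (p q : {poly R[i]}) A x :
  chorner (p + q) A x = chorner p A x + chorner q A x.
Proof.
rewrite (chorner_widen _ _ (size_polyD _ _)).
rewrite (@chorner_widen (maxn (size p) (size q)) p) ?leq_maxl //.
rewrite (@chorner_widen (maxn (size p) (size q)) q) ?leq_maxr //.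
by rewrite -big_split; apply: eq_bigr => i _; rewrite coefD scalerDl.
Qed.

Lemma chornerZ c (q : {poly R[i]}) A x : chorner (c *: q) A x = c *: chorner q A x.
Proof.
rewrite (chorner_widen _ _ (size_scale_leq _ _)) scaler_sumr.
by apply: eq_bigr => i _; rewrite coefZ scalerA.
Qed.

Lemma chornerC c A x : chorner c%:P A x = c *: x.
Proof.
by rewrite (chorner_widen _ _ (size_polyC_leq1 c)) big_ord1 coefC eqxx.
Qed.

Lemma chornerMX (q : {poly R[i]}) A x : chorner (q * 'X) A x = chorner q A (A x).
Proof.
have /chorner_widen -> : (size (q * 'X)%R <= (size q).+1)%N.
  have [->|q0] := eqVneq q 0; first by rewrite mul0r size_poly0.
  by rewrite size_mulX.
rewrite big_ord_recl coefMX /= scale0r add0r.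
by apply: eq_bigr => i _; rewrite coefMX /= -iterS iterSr.
Qed.

Lemma chornerMXaddC (q : {poly R[i]}) c A x :
  chorner (q * 'X + c%:P) A x = chorner q A (A x) + c *: x.
Proof. by rewrite chornerD chornerMX chornerC. Qed.

Lemma chorner0 A x : chorner 0 A x = 0.
Proof. by rewrite -(polyC0 R[i]) chornerC scale0r. Qed.

Lemma chorner_bounded (q : {poly R[i]}) A : bounded_op A -> bounded_op (chorner q A).
Proof.
move=> bA; elim/poly_ind: q => [|q c IH].
  have -> : chorner 0 A = 0 \*: (idfun : H -> H).
    by apply/funext => x; rewrite chorner0 /= scale0r.
  exact: bounded_scale bounded_id.
have -> : chorner (q * 'X + c%:P) A = (chorner q A \o A) \+ c \*: (idfun : H -> H).
  by apply/funext => x; rewrite chornerMXaddC.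
by apply: bounded_add; [exact: bounded_comp | exact: bounded_scale bounded_id].
Qed.

Lemma chorner_comm (q : {poly R[i]}) A B x : bounded_op A -> bounded_op B ->
  (forall y, A (B y) = B (A y)) -> chorner q A (B x) = B (chorner q A x).
Proof.
move=> bA bB AB; elim/poly_ind: q x => [|q c IH] x.
  by rewrite !chorner0 (op0 bB).
by rewrite !chornerMXaddC (opD _ _ bB) (opZ _ _ bB) AB IH.
Qed.

Lemma chornerM (p q : {poly R[i]}) A x : bounded_op A ->
  chorner (p * q) A x = chorner p A (chorner q A x).
Proof.
move=> bA; elim/poly_ind: p q x => [|p c IH] q x; first by rewrite mul0r !chorner0.
rewrite mulrDl mul_polyC -mulrA [_ * q]mulrC chornerD chornerZ IH chornerMX.
by rewrite chornerMXaddC (@chorner_comm q A A).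
Qed.

Lemma chorner_prod_invertible (zs : seq R[i]) A : bounded_op A ->
  (forall z : R[i], z \in zs -> invertible_op (A \- z \*: idfun)) ->
  invertible_op (chorner (\prod_(z <- zs) ('X - z%:P)) A).
Proof.
move=> bA; elim: zs => [|z zs IH] hz.
  rewrite big_nil; exists idfun; split; first exact: bounded_id.
    by apply/funext => x /=; rewrite -(polyC1 R[i]) chornerC scale1r.
  by apply/funext => x /=; rewrite -(polyC1 R[i]) chornerC scale1r.
have bC q := chorner_bounded q bA.
have bz : bounded_op (A \- z \*: idfun).
  by apply: bounded_sub => //; exact: bounded_scale bounded_id.
have /(invertible_opP bz)[B bB [AB BA]] : invertible_op (A \- z \*: idfun).
  by apply: hz; rewrite inE eqxx.
have /(invertible_opP (bC _))[B' bB' [AB' BA']] :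
    invertible_op (chorner (\prod_(z <- zs) ('X - z%:P)) A).
  by apply: IH => w wz; apply: hz; rewrite inE wz orbT.
have zE x : chorner ('X - z%:P) A x = (A \- z \*: idfun) x.
  rewrite -polyCN -['X]mul1r chornerMXaddC -(polyC1 R[i]) chornerC scale1r.
  by rewrite scaleNr.
rewrite big_cons; apply/invertible_opP; first exact: bC.
exists (B' \o B); first exact: bounded_comp.
split=> x; rewrite chornerM // zE /=; first by rewrite AB'; exact: AB.
by have := BA (chorner (\prod_(z <- zs) ('X - z%:P)) A x) => /= ->; exact: BA'.
Qed.

(** With S = A - a I, the product (S - ib)(S + ib) = S^2 + b^2 is coercive because b is nonzero, and
    (S + ib)(S^2 + b^2)^-1 inverts S - ib. *)
Lemma nonreal_invertible A (z : R[i]) : selfadj A -> complex.Im z != 0 ->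
  invertible_op (A \- z \*: idfun).
Proof.
case: z => a b sA /= bN; have [bA sA'] := sA.
have [S sS zE] : exists2 S, selfadj S &
    forall c x, A x - (a +i* c) *: x = S x - (0 +i* c) *: x.
  exists (A \- a%:C \*: (idfun : H -> H)).
    exact: (selfadj_sub sA (selfadj_scale _ selfadj_id)).
  move=> c x; rewrite /= -addrA -opprD -scalerDl.
  by congr (_ - _ *: _); simpc.
have [bS sS'] := sS.
pose P := (S \o S) \+ (b ^+ 2)%:C \*: (idfun : H -> H).
have sP : selfadj P.
  by apply: selfadj_add; [exact: selfadj_comp | exact: selfadj_scale selfadj_id].
have b2 : 0 < b ^+ 2 by rewrite exprn_even_gt0.
have [|B [bB _] [PB BP]] := @coercive_inverse P (b ^+ 2) sP b2.
  move=> x; have -> : ip (P x) x = ip (S (S x)) x + b ^+ 2 * ip x x.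
    by rewrite -ipZl -ipDl.
  by rewrite sS' lerDr ip_ge0.
have fac x c d : c + d = 0 -> c ^+ 2 = b ^+ 2 ->
    S (S x - (0 +i* d) *: x) - (0 +i* c) *: (S x - (0 +i* d) *: x) = P x.
  move=> /eqP; rewrite addr_eq0 => /eqP -> cb.
  have -> : (0 +i* - d : R[i]) = - (0 +i* d) by simpc.
  rewrite /P /= (opB _ _ bS) (opZ _ _ bS) scaleNr opprK scalerBr scalerA addrA subrK.
  rewrite -scaleNr; congr (_ + _ *: _); simpc.
  by rewrite -cb sqrrN expr2.
apply/invertible_opP.
  by apply: bounded_sub => //; exact: bounded_scale bounded_id.
have Sc x c : S (S x - (0 +i* c) *: x) = S (S x) - (0 +i* c) *: S x.
  by rewrite (opB _ _ bS) (opZ _ _ bS).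
have inv1 x : (A \- (a +i* b) \*: idfun) (S (B x) - (0 +i* - b) *: B x) = x.
  by rewrite /= zE fac ?subrr // PB.
have inv2 x : B (S (S x - (0 +i* b) *: x) - (0 +i* - b) *: (S x - (0 +i* b) *: x)) = x.
  by rewrite fac ?addNr ?sqrrN // BP.
pose T := (S \- (0 +i* - b) \*: (idfun : H -> H)) \o B.
have bT : bounded_op T.
  apply: bounded_comp => //; apply: bounded_sub => //.
  exact: bounded_scale bounded_id.
exists T => //; split=> x; first exact: inv1.
have inj u v : (A \- (a +i* b) \*: idfun) u = (A \- (a +i* b) \*: idfun) v -> u = v.
  by rewrite /= !zE => uv; rewrite -(inv2 u) -(inv2 v) uv.
by apply: inj; exact: inv1.
Qed.
Implicit Types p q : {poly R}.

Lemma op_hornerE p A x : op_horner p A x = chorner (map_poly (real_complex R) p) A x.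
Proof.
rewrite /op_horner /chorner size_map_poly.
by apply: eq_bigr => i _; rewrite coef_map.
Qed.

Lemma op_hornerD p q A x : op_horner (p + q) A x = op_horner p A x + op_horner q A x.
Proof. by rewrite !op_hornerE rmorphD chornerD. Qed.

Lemma op_hornerZ a p A x : op_horner (a *: p) A x = a%:C *: op_horner p A x.
Proof. by rewrite !op_hornerE /= map_polyZ /= chornerZ. Qed.

Lemma op_hornerN p A x : op_horner (- p) A x = - op_horner p A x.
Proof. by rewrite -scaleN1r op_hornerZ rmorphN1 scaleN1r. Qed.

Lemma op_hornerB p q A x : op_horner (p - q) A x = op_horner p A x - op_horner q A x.
Proof. by rewrite op_hornerD op_hornerN. Qed.

Lemma op_hornerC a A x : op_horner a%:P A x = a%:C *: x.
Proof. by rewrite op_hornerE map_polyC chornerC. Qed.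

Lemma op_horner1 A x : op_horner 1 A x = x.
Proof. by rewrite -(polyC1 R) op_hornerC rmorph1 scale1r. Qed.

Lemma op_horner0 A x : op_horner 0 A x = 0.
Proof. by rewrite -(polyC0 R) op_hornerC rmorph0 scale0r. Qed.

Lemma op_hornerX A x : op_horner 'X A x = A x.
Proof. by rewrite op_hornerE map_polyX -['X]mul1r chornerMX -(polyC1 R[i]) chornerC scale1r. Qed.

Lemma op_horner_sum I (r : seq I) (P : pred I) (F : I -> {poly R}) A x :
  op_horner (\sum_(i <- r | P i) F i) A x = \sum_(i <- r | P i) op_horner (F i) A x.
Proof.
elim/big_rec2: _ => [|i y p _ <-]; first exact: op_horner0.
by rewrite op_hornerD.
Qed.

Lemma op_hornerM p q A x : bounded_op A ->
  op_horner (p * q) A x = op_horner p A (op_horner q A x).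
Proof. by move=> bA; rewrite !op_hornerE rmorphM chornerM. Qed.

Lemma op_hornerMXaddC p a A x :
  op_horner (p * 'X + a%:P) A x = op_horner p A (A x) + a%:C *: x.
Proof. by rewrite op_hornerE rmorphD rmorphM /= map_polyX map_polyC chornerMXaddC -op_hornerE. Qed.

Lemma op_horner_comm p A B x : bounded_op A -> bounded_op B ->
  (forall y, A (B y) = B (A y)) -> op_horner p A (B x) = B (op_horner p A x).
Proof. by move=> bA bB AB; rewrite !op_hornerE (@chorner_comm _ A B). Qed.

Lemma op_horner_selfadj p A : selfadj A -> selfadj (op_horner p A).
Proof.
move=> sA; have [bA _] := sA; elim/poly_ind: p => [|p c IH].
  have -> : op_horner 0 A = 0%:C \*: (idfun : H -> H).
    by apply/funext => x; rewrite op_horner0 /= scale0r.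
  exact: selfadj_scale selfadj_id.
have -> : op_horner (p * 'X + c%:P) A =
    (op_horner p A \o A) \+ c%:C \*: (idfun : H -> H).
  by apply/funext => x; rewrite op_hornerMXaddC.
apply: selfadj_add; last exact: selfadj_scale selfadj_id.
by apply: selfadj_comp => // x; rewrite op_horner_comm.
Qed.

Hypothesis dimH : infinite_dimensional H.

Lemma exists_unit : exists e, ip e e = 1.
Proof.
have [e eN0] : exists e : H, e != 0.
  apply: contrapT => no; apply: (dimH (e := fun _ : 'I_0 => 0)) => x.
  exists (fun=> 0); rewrite big_ord0; apply/eqP/negPn/negP => x0.
  by apply: no; exists x.
have e0 : 0 < ip e e.
  by rewrite lt_def ip_ge0 andbT; apply: contra_neq eN0; exact: ip_eq0.
exists ((Num.sqrt (ip e e))^-1%:C *: e); rewrite ipZl ipZr mulrA -expr2 exprVn.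
by rewrite sqr_sqrtr ?ltW // mulVf // gt_eqF.
Qed.

Lemma form_inf A : selfadj A -> exists s : R,
  (forall x, s * ip x x <= ip (A x) x) /\
  (forall s', (forall x, s' * ip x x <= ip (A x) x) -> s' <= s).
Proof.
move=> [bA sA]; have [M M0 hM] := bounded_form bA.
have [e e1] := exists_unit.
pose S := [set ip (A x) x | x in [set x | ip x x = 1]].
have Sne : S !=set0 by exists (ip (A e) e), e.
have Slb : has_lbound S.
  exists (- M) => _ [x /= x1 <-]; have /andP[+ _] := hM x.
  by rewrite x1 mulr1.
exists (inf S); split=> [x|s' hs']; last first.
  by apply: lb_le_inf => // _ [x /= x1 <-]; have := hs' x; rewrite x1 mulr1.
have [x0|xN] := eqVneq (ip x x) 0.
  by rewrite x0 mulr0 (ip_eq0 x0) (op0 bA) ip0l.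
have x_gt0 : 0 < ip x x by rewrite lt_def xN ip_ge0.
pose r := (Num.sqrt (ip x x))^-1.
have r2 : r * r = (ip x x)^-1 by rewrite -expr2 exprVn sqr_sqrtr ?ltW.
have Sx : S (ip (A (r%:C *: x)) (r%:C *: x)).
  exists (r%:C *: x) => //=.
  by rewrite ipZl ipZr mulrA r2 mulVf.
have := ge_inf Slb Sx; rewrite (opZ _ _ bA) ipZl ipZr mulrA r2.
by rewrite ler_pdivlMl // mulrC.
Qed.

(** Were A - s invertible, it would be coercive with some c > 0, making s + c a larger lower bound
    of the form. *)
Lemma form_inf_spectrum A s : selfadj A ->
  (forall x, s * ip x x <= ip (A x) x) ->
  (forall s', (forall x, s' * ip x x <= ip (A x) x) -> s' <= s) ->
  real_spectrum A s.
Proof.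
move=> sA lb glb inv.
have sS : selfadj (A \- s%:C \*: idfun).
  exact: (selfadj_sub sA (selfadj_scale _ selfadj_id)).
have [|c c0 hc] := pos_invertible_coercive sS _ inv.
  by move=> x; rewrite /= !ipE subr_ge0.
suff : s + c <= s by lra.
by apply: glb => x; have := hc x; rewrite /= !ipE; lra.
Qed.

(** The part of the spectral mapping theorem that the calculus rests on. The infimum s of the form
    of p(A) lies in the spectrum of p(A). Since p - s splits over [R[i]], one of its roots z lies in
    the spectrum of A; z is real, so s = p(z) >= 0. *)
Lemma op_horner_ge0 p A : selfadj A ->
  (forall t, real_spectrum A t -> 0 <= p.[t]) ->
  forall x, 0 <= ip (op_horner p A x) x.
Proof.
move=> sA hp; have [bA _] := sA.
have sP := op_horner_selfadj p sA.
have [s [lb glb]] := form_inf sP.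
suff s0 : 0 <= s by move=> x; apply: le_trans (lb x); rewrite mulr_ge0 ?ip_ge0.
have [t [tlb tglb]] := form_inf sA.
have t_sp := form_inf_spectrum sA tlb tglb.
have s_sp := form_inf_spectrum sP lb glb.
pose q := map_poly (real_complex R) (p - s%:P).
have qE x : chorner q A x = (op_horner p A \- s%:C \*: idfun) x.
  by rewrite -op_hornerE op_hornerB op_hornerC.
(* For constant p = s there is no root to choose; the bottom [t] of the form of A supplies a
   spectral point. *)
have [q0|qN0] := eqVneq q 0.
  have /eqP : p - s%:P = 0.
    by apply/eqP; rewrite -(map_poly_eq0 (real_complex R)); apply/eqP.
  by rewrite subr_eq0 => /eqP pE; have := hp _ t_sp; rewrite pE hornerC.
have [r qr] := closed_field_poly_normal q.
have [z zr zsp] : exists2 z, z \in r & spectrum A z.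
  apply: contrapT => no; apply: s_sp.
  have bq : bounded_op (chorner q A) by exact: chorner_bounded.
  have <- : chorner q A = op_horner p A \- s%:C \*: idfun by apply/funext.
  have := @chorner_prod_invertible r A bA.
  have bC u := chorner_bounded u bA.
  move=> /(_ _)/(invertible_opP (bC _))[z zr|B bB [AB BA]].
    by apply: contrapT => nz; apply: no; exists z.
  have lc0 : lead_coef q != 0 by rewrite lead_coef_eq0.
  apply/(invertible_opP bq); exists ((lead_coef q)^-1 \*: B).
    exact: bounded_scale.
  have qC x : chorner q A x =
      lead_coef q *: chorner (\prod_(z <- r) ('X - z%:P)) A x.
    by rewrite {1}qr chornerZ.
  split=> x; rewrite qC /=.
    by rewrite (opZ _ _ (bC _)) AB scalerA mulfV // scale1r.
  by rewrite (opZ _ _ bB) BA scalerA mulVf // scale1r.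
have zreal : complex.Im z = 0.
  apply/eqP; apply: contraPT zsp => zN /(_ (nonreal_invertible sA zN)).
  by [].
have zE : z = (complex.Re z)%:C by case: z zreal {zr zsp} => u v /= ->.
rewrite zE in zsp zr.
have : root q (complex.Re z)%:C.
  by rewrite qr rootZ ?lead_coef_eq0 // root_prod_XsubC.
rewrite /root /q horner_map fmorph_eq0 hornerD hornerN hornerC subr_eq0 => /eqP <-.
exact: hp.
Qed.

(** * Bernstein polynomials and uniform approximation *)

(** Absorption i C(n+1, i) = (n+1) C(n, i-1). Taking g = 1 gives the first moment of the binomial
    weights, g i = i the second. *)
Lemma bern_sum_shift (S : comNzRingType) (u v : S) n (g : nat -> S) :
  \sum_(i < n.+2) (i%:R * g i) * (u ^+ i * v ^+ (n.+1 - i) *+ 'C(n.+1, i)) =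
  n.+1%:R * u * \sum_(i < n.+1) g i.+1 * (u ^+ i * v ^+ (n - i) *+ 'C(n, i)).
Proof.
rewrite big_ord_recl /= mul0r mul0r add0r mulr_sumr; apply: eq_bigr => i _.
have -> : bump 0 i = i.+1 by [].
rewrite subSS exprS -[_ *+ 'C(n.+1, _)]mulr_natr -[_ *+ 'C(n, _)]mulr_natr.
have /(congr1 (fun k : nat => k%:R : S)) := mul_bin_diag n.+1 i.
rewrite /= !natrM => h.
transitivity (g i.+1 * (u * u ^+ i * v ^+ (n - i)) * (i.+1%:R * 'C(n.+1, i.+1)%:R)).
  ring.
rewrite -h; ring.
Qed.

Section Bernstein.
Variables (a b : R) (n : nat).
Hypothesis ab : a < b.

Definition bnode (i : nat) : R := a + (b - a) * i%:R / n.+1%:R.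

(** Degree n + 1 keeps the node denominators nonzero. These are polynomials and not functions, so
    that the identities below can be evaluated at operators. *)
Definition bern (i : nat) : {poly R} :=
  ((b - a)^-1 *: ('X - a%:P)) ^+ i * ((b - a)^-1 *: (b%:P - 'X)) ^+ (n.+1 - i)
    *+ 'C(n.+1, i).
Lemma bern_uv : (b - a)^-1 *: ('X - a%:P) + (b - a)^-1 *: (b%:P - 'X) = 1 :> {poly R}.
Proof.
rewrite -scalerDr ['X - _ + _]addrC addrA subrK -polyCB -mul_polyC -polyCM mulVf ?polyC1 //.
by rewrite subr_eq0 gt_eqF.
Qed.

Lemma bern_sum1 m : \sum_(i < m.+1)
   (((b - a)^-1 *: ('X - a%:P)) ^+ i * ((b - a)^-1 *: (b%:P - 'X)) ^+ (m - i) *+ 'C(m, i))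
   = 1 :> {poly R}.
Proof.
rewrite -(expr1n _ m) -bern_uv [in RHS]addrC exprDn.
by apply: eq_bigr => i _; rewrite mulrC.
Qed.

Lemma bern_sumid m : \sum_(i < m.+1) i%:R *
   (((b - a)^-1 *: ('X - a%:P)) ^+ i * ((b - a)^-1 *: (b%:P - 'X)) ^+ (m - i) *+ 'C(m, i))
   = m%:R * ((b - a)^-1 *: ('X - a%:P)) :> {poly R}.
Proof.
case: m => [|m]; first by rewrite big_ord1 !mul0r.
have h := bern_sum_shift ((b - a)^-1 *: ('X - a%:P)) ((b - a)^-1 *: (b%:P - 'X)) m (fun=> 1).
transitivity (m.+1%:R * ((b - a)^-1 *: ('X - a%:P)) * \sum_(i < m.+1) 1 *
   (((b - a)^-1 *: ('X - a%:P)) ^+ i * ((b - a)^-1 *: (b%:P - 'X)) ^+ (m - i) *+ 'C(m, i))).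
  by rewrite -h; apply: eq_bigr => i _; rewrite mulr1.
rewrite -[RHS]mulr1; congr (_ * _); rewrite -[RHS](bern_sum1 m).
by apply: eq_bigr => i _; rewrite mul1r.
Qed.

Lemma bern_total : \sum_(i < n.+2) bern i = 1.
Proof. exact: bern_sum1. Qed.

Lemma bern_moment1 :
  \sum_(i < n.+2) i%:R * bern i = n.+1%:R * ((b - a)^-1 *: ('X - a%:P)).
Proof. exact: bern_sumid. Qed.

Lemma bern_moment2 :
  \sum_(i < n.+2) (i%:R * i%:R) * bern i =
  n.+1%:R * ((b - a)^-1 *: ('X - a%:P)) * (n%:R * ((b - a)^-1 *: ('X - a%:P)) + 1).
Proof.
have -> := bern_sum_shift ((b - a)^-1 *: ('X - a%:P)) ((b - a)^-1 *: (b%:P - 'X)) n (fun i => i%:R).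
congr (_ * _).
under eq_bigr do rewrite -natr1 mulrDl mul1r.
rewrite big_split /= bern_sum1; congr (_ + _).
exact: bern_sumid.
Qed.

Lemma bern_mean : \sum_(i < n.+2) bnode i *: bern i = 'X.
Proof.
have E i : bnode i *: bern i =
    a *: bern i + ((b - a) / n.+1%:R) *: (i%:R * bern i).
  by rewrite mulr_natl -[bern i *+ i]scaler_nat scalerA -scalerDl /bnode mulrAC.
under eq_bigr do rewrite E.
rewrite big_split /= -!scaler_sumr bern_total bern_moment1 mulr_natl -[_ *: _ *+ _]scaler_nat !scalerA.
rewrite mulrA divfK ?pnatr_eq0 // mulfV ?subr_eq0 ?gt_eqF // scale1r.
by rewrite alg_polyC addrC subrK.
Qed.

(** The variance of the binomial distribution. Its factor 1 / (n + 1) is the source of every limit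
    taken with Bernstein polynomials below. *)
Lemma bern_variance :
  \sum_(i < n.+2) bern i * ('X - (bnode i)%:P) ^+ 2 =
  n.+1%:R^-1 *: (('X - a%:P) * (b%:P - 'X)).
Proof.
have ba : b - a != 0 by rewrite subr_eq0 gt_eqF.
have n0 : n.+1%:R != 0 :> R by rewrite pnatr_eq0.
pose w : {poly R} := ((b - a) / n.+1%:R)%:P.
pose x : {poly R} := 'X - a%:P.
have E i : bern i * ('X - (bnode i)%:P) ^+ 2 =
    x ^+ 2 * bern i - 2 * w * x * (i%:R * bern i) + w ^+ 2 * (i%:R * i%:R * bern i).
  have -> : (bnode i)%:P = a%:P + w * i%:R.
    by rewrite /bnode -polyC_natr -polyCM -polyCD mulrAC.
  rewrite /x; ring.
under eq_bigr do rewrite E.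
rewrite big_split /= big_split /= sumrN -!mulr_sumr bern_total bern_moment1 bern_moment2.
have uv := bern_uv; set u := (b - a)^-1 *: ('X - a%:P) in uv *.
have wu : w * (n.+1%:R * u) = x.
  rewrite mulr_natl -[_ *+ _]scaler_nat scalerA mul_polyC scalerA mulrA divfK // mulfV //.
  exact: scale1r.
transitivity (x ^+ 2 - 2 * x * (w * (n.+1%:R * u)) + (w * (n.+1%:R * u)) ^+ 2 +
    (w * (n.+1%:R * u)) * (w * (1 - u))).
  rewrite -natr1; ring.
rewrite wu -mul_polyC.
have -> : w * (1 - u) = (n.+1%:R^-1)%:P * (b%:P - 'X).
  rewrite -uv addrC addKr -[_ *: _]mul_polyC mulrA -polyCM; congr (_%:P * _).
  by rewrite mulrAC mulfV // mul1r.
rewrite -/x; ring.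
Qed.

Lemma bern_ge0 i t : a <= t <= b -> 0 <= (bern i).[t].
Proof.
move=> /andP[at_ tb]; rewrite /bern hornerMn hornerM !horner_exp !hornerZ !hornerD.
rewrite !hornerN !hornerX !hornerC mulrn_wge0 // mulr_ge0 // exprn_ge0 //.
  by rewrite mulr_ge0 ?invr_ge0 ?subr_ge0 // ltW.
by rewrite mulr_ge0 ?invr_ge0 ?subr_ge0 // ltW.
Qed.

Lemma bnode_itv (i : 'I_n.+2) : a <= bnode i <= b.
Proof.
have ba : 0 < b - a by rewrite subr_gt0.
rewrite /bnode -mulrA lerDl mulr_ge0 ?divr_ge0 ?(ltW ba) //=.
rewrite -lerBrDl ger_pMr // ler_pdivrMr ?ltr0n // mul1r ler_nat.
by rewrite -ltnS.
Qed.

End Bernstein.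
Definition contin_on (f : R -> R) (a b : R) :=
  forall t, a <= t <= b -> {for t, continuous f}.
(** Otherwise pairs at distance below 1 / (n + 1) with far values accumulate at some l in [a, b],
    against continuity at l. *)
Lemma uniform_continuity_segment f (a b : R) : contin_on f a b ->
  forall e : R, 0 < e -> exists2 d : R, 0 < d &
    forall s t, a <= s <= b -> a <= t <= b -> `|s - t| < d -> `|f s - f t| < e.
Proof.
move=> cf e e0; apply: contrapT => no.
have bad (n : nat) : exists st : R * R, [/\ a <= st.1 <= b, a <= st.2 <= b,
    `|st.1 - st.2| < n.+1%:R^-1 & e <= `|f st.1 - f st.2|].
  apply: contrapT => ok; apply: no; exists n.+1%:R^-1.
    by rewrite invr_gt0 ltr0n.
  move=> s t sab tab st; rewrite ltNge; apply/negP => est.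
  by apply: ok; exists (s, t).
have [u hu] := choice bad.
have bnd : bounded_fun (fun n => (u n).1).
  exists (`|a| + `|b|); split; first by rewrite num_real.
  move=> x hx n _ /=; have [/andP[ua ub] _ _ _] := hu n.
  rewrite (le_trans _ (ltW hx)) // ler_norml.
  have := ler_norm b; have := ler_norm (- a); rewrite normrN.
  have := normr_ge0 a; have := normr_ge0 b.
  by move=> *; apply/andP; split; lra.
have [phi phi_inc /cvg_ex[l hl]] := bolzano_weierstrass bnd.
have inv0 : (fun n => n.+1%:R^-1 : R) @ \oo --> (0 : R) by exact: cvg_harmonic.
have phin n : (n <= phi n)%N.
  elim: n => // n IH; apply: leq_ltn_trans IH _.
  by rewrite ltnNge; apply/negbT; have := phi_inc n.+1 n; rewrite ltnn.
have near_l (d : R) : 0 < d -> exists n, `|(u (phi n)).1 - l| < d /\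
    `|(u (phi n)).2 - l| < d.
  move=> d0; have d2 : 0 < d / 2 by rewrite divr_gt0.
  move/cvgrPdist_lt: hl => /(_ _ d2)[N1 _ hN1].
  move/cvgrPdist_lt: inv0 => /(_ _ d2)[N2 _ hN2].
  exists (maxn N1 N2); set n := maxn N1 N2.
  have /= h1 := hN1 n (leq_maxl _ _); rewrite distrC in h1.
  have /= h2 := hN2 (phi n) (leq_trans (leq_maxr N1 N2) (phin n)).
  rewrite sub0r normrN gtr0_norm ?invr_gt0 ?ltr0n // in h2.
  have [_ _ h3 _] := hu (phi n).
  split; first by lra.
  rewrite -(subrKA (u (phi n)).1); apply: le_lt_trans (ler_normD _ _) _.
  by rewrite [X in _ < X]splitr ltrD // distrC (lt_trans h3).
have lab : a <= l <= b.
  apply/andP; split; rewrite leNgt; apply/negP => hlt.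
    have [n [h _]] : exists n, `|(u (phi n)).1 - l| < a - l /\
      `|(u (phi n)).2 - l| < a - l by apply: near_l; rewrite subr_gt0.
    have [/andP[h1 _] _ _ _] := hu (phi n).
    by move: h; rewrite ltr_norml => /andP[_]; lra.
  have [n [h _]] : exists n, `|(u (phi n)).1 - l| < l - b /\
      `|(u (phi n)).2 - l| < l - b by apply: near_l; rewrite subr_gt0.
  have [/andP[_ h1] _ _ _] := hu (phi n).
  by move: h; rewrite ltr_norml => /andP[+ _]; lra.
have e2 : 0 < e / 2 by rewrite divr_gt0.
have /cvgrPdist_lt/(_ _ e2)/nbhs_ballP[d d0 hd] := cf l lab.
have [n [h1 h2]] := near_l d d0.
have [_ _ _] := hu (phi n).
have /= h3 : `|f l - f (u (phi n)).1| < e / 2.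
  by apply: hd; rewrite -ball_normE /= distrC.
have /= h4 : `|f l - f (u (phi n)).2| < e / 2.
  by apply: hd; rewrite -ball_normE /= distrC.
rewrite leNgt; apply/negP; rewrite negbK -(subrKA (f l)).
apply: le_lt_trans (ler_normD _ _) _.
have h5 := h3; rewrite distrC in h5; lra.
Qed.

(** Pairs closer than d are handled by uniform continuity, the others by the full oscillation M of
    f, at most (M / d^2)(s - t)^2. A quadratic error is what [bern_variance] can sum. *)
Lemma quadratic_modulus f (a b : R) : contin_on f a b ->
  forall e : R, 0 < e -> exists2 K : R, 0 <= K &
    forall s t, a <= s <= b -> a <= t <= b -> `|f s - f t| <= e + K * (s - t) ^+ 2.
Proof.
move=> cf e e0; have [ab|ba] := leP a b; last first.
  by exists 0 => // s t /andP[as_ sb] _; lra.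
have cw : {within `[a, b], continuous f}.
  by apply: continuous_in_subspaceT => x; rewrite inE /= in_itv /=; exact: cf.
have [c1 _ hmax] := EVT_max ab cw; have [c2 _ hmin] := EVT_min ab cw.
have [d d0 hd] := uniform_continuity_segment cf e0.
pose M : R := `|f c1 - f c2|.
have M0 : 0 <= M by exact: normr_ge0.
exists (M / d ^+ 2) => [|s t hs ht]; first by rewrite divr_ge0 ?sqr_ge0.
have [st|st] := ltP `|s - t| d.
  have := hd s t hs ht st; have : 0 <= M / d ^+ 2 * (s - t) ^+ 2.
    by rewrite mulr_ge0 ?divr_ge0 ?sqr_ge0.
  lra.
have h1 : `|f s - f t| <= M.
  have h2 := hmax s; have h3 := hmax t; have h4 := hmin s; have h5 := hmin t.
  rewrite !in_itv /= in h2 h3 h4 h5.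
  move: (h2 hs) (h3 ht) (h4 hs) (h5 ht) => {}h2 {}h3 {}h4 {}h5.
  have := ler_norm (f c1 - f c2); rewrite -/M => ?.
  by rewrite ler_norml; apply/andP; split; lra.
have h2 : d ^+ 2 <= (s - t) ^+ 2.
  by rewrite -[leRHS]real_normK ?num_real // ler_pXn2r // ?nnegrE ?(ltW d0).
have h3 : M <= M / d ^+ 2 * (s - t) ^+ 2.
  rewrite mulrAC ler_pdivlMr ?exprn_gt0 //; exact: ler_wpM2l.
lra.
Qed.

Lemma archi_small (c e : R) : 0 < e -> exists n, c / n.+1%:R <= e.
Proof.
move=> e0; exists (Num.truncn (c / e)).
rewrite ler_pdivrMr ?ltr0n // [leRHS]mulrC -ler_pdivrMr //.
exact: ltW (truncnS_gt _).
Qed.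

Lemma weierstrass f (a b : R) : a < b -> contin_on f a b ->
  forall e : R, 0 < e -> exists p : {poly R}, forall t, a <= t <= b -> `|p.[t] - f t| <= e.
Proof.
move=> ab cf e e0; have e2 : 0 < e / 2 by rewrite divr_gt0.
have [K K0 hK] := quadratic_modulus cf e2.
have ba2 : 0 <= (b - a) ^+ 2 := sqr_ge0 _.
have [n hn] := archi_small (K * (b - a) ^+ 2) e2.
exists (\sum_(i < n.+2) f (bnode a b n i) *: bern a b n i) => t tab.
have tot : \sum_(i < n.+2) (bern a b n i).[t] = 1.
  by rewrite -horner_sum bern_total // hornerC.
have b0 i : 0 <= (bern a b n i).[t] by exact: bern_ge0.
have -> : (\sum_(i < n.+2) f (bnode a b n i) *: bern a b n i).[t] - f t =
    \sum_(i < n.+2) (bern a b n i).[t] * (f (bnode a b n i) - f t).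
  under [RHS]eq_bigr do rewrite mulrBr.
  rewrite sumrB -mulr_suml tot mul1r horner_sum.
  by congr (_ - _); apply: eq_bigr => i _; rewrite hornerZ mulrC.
apply: le_trans (ler_norm_sum _ _ _) _.
have : \sum_(i < n.+2) `|(bern a b n i).[t] * (f (bnode a b n i) - f t)| <=
    \sum_(i < n.+2) (e / 2 * (bern a b n i).[t] +
       K * (bern a b n i * ('X - (bnode a b n i)%:P) ^+ 2).[t]).
  apply: ler_sum => i _; rewrite normrM (ger0_norm (b0 i)).
  have := ler_wpM2l (b0 i) (hK _ _ (bnode_itv ab i) tab).
  rewrite hornerM horner_exp hornerD hornerN hornerX hornerC; lra.
move/le_trans; apply.
rewrite big_split -!mulr_sumr tot -horner_sum bern_variance // hornerZ.
rewrite hornerM !hornerD !hornerN !hornerX !hornerC mulr1.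
have h1 : (t - a) * (b - t) <= (b - a) ^+ 2 by move/andP: tab => [? ?]; nra.
suff : K * (n.+1%:R^-1 * ((t - a) * (b - t))) <= e / 2.
  by move=> h2; rewrite [X in _ <= X]splitr lerD2l.
apply: le_trans hn; rewrite -mulrA ler_wpM2l // mulrC.
by rewrite ler_pM2r // invr_gt0 ltr0n.
Qed.

(** * Continuous functional calculus *)

Lemma uniform_cvgP (S : set R) (F : nat -> R -> R) (f : R -> R) :
  {uniform S, F @ \oo --> f} <->
  forall e : R, 0 < e -> exists N, forall n, (N <= n)%N ->
    forall t, S t -> `|F n t - f t| < e.
Proof.
split.
  move=> Ff e e0.
  have /Ff : nbhs (f : {uniform` S -> R}) [set g | forall t, S t -> `|f t - g t| < e].
    apply/uniform_nbhs; exists [set xy | ball xy.1 e xy.2]; split.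
      exact: entourage_ball (PosNum e0).
    by move=> g /= hg t St; have := hg t St; rewrite -ball_normE.
  move=> [N _ hN]; exists N => n Nn t St; rewrite distrC.
  exact: hN.
move=> hF P /uniform_nbhs[E [entE EP]].
move: entE; rewrite -entourage_ballE => -[e /= e0 he].
have [N hN] := hF e e0; exists N => // n Nn; apply: EP => t St; apply: he.
by rewrite /= -ball_normE /= distrC; exact: hN.
Qed.

Lemma ip_le1 x : (`|x| <= 1) = (ip x x <= 1).
Proof. by rewrite -(rmorph1 (real_complex R)) norm_le ?expr1n. Qed.

Lemma opnorm_le A (e : R) : 0 <= e ->
  (forall x, ip (A x) (A x) <= e ^+ 2 * ip x x) -> opnorm A <= e.
Proof.
move=> e0 hA; apply: ge_sup.
  by exists (complex.Re `|A 0|), 0 => //=; rewrite normr0.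
move=> _ [x /= x1 <-]; rewrite -lecR -normE norm_le //.
by apply: le_trans (hA x) _; rewrite ler_piMr ?sqr_ge0 // -ip_le1.
Qed.

Lemma opnorm_has_ub A : bounded_op A ->
  has_ubound [set complex.Re `|A x| | x in [set x : H | `|x| <= 1]].
Proof.
move=> /bounded_opP[_ [M M0 hM]]; exists M => _ [x /= x1 <-].
rewrite -lecR -normE norm_le //.
by apply: le_trans (hM x) _; rewrite ler_piMr ?sqr_ge0 // -ip_le1.
Qed.

Lemma opnorm_ge0 A : bounded_op A -> 0 <= opnorm A.
Proof.
move=> bA; apply: le_trans (Re_norm_ge0 (A 0)) _.
by apply: ub_le_sup; [exact: opnorm_has_ub | exists 0 => //=; rewrite normr0].
Qed.

Lemma opnorm_ub A x : bounded_op A -> ip (A x) (A x) <= opnorm A ^+ 2 * ip x x.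
Proof.
move=> bA; have [x0|xN] := eqVneq (ip x x) 0.
  by rewrite (ip_eq0 x0) (op0 bA) ip0l mulr0.
have x_gt0 : 0 < ip x x by rewrite lt_def xN ip_ge0.
have r2 : (Num.sqrt (ip x x))^-1 * (Num.sqrt (ip x x))^-1 = (ip x x)^-1.
  by rewrite -expr2 exprVn sqr_sqrtr ?ltW.
pose y := (Num.sqrt (ip x x))^-1%:C *: x.
have y1 : `|y| <= 1 by rewrite ip_le1 ipZl ipZr mulrA r2 mulVf.
have : complex.Re `|A y| <= opnorm A.
  by apply: ub_le_sup; [exact: opnorm_has_ub | exists y].
rewrite -lecR -normE norm_le ?opnorm_ge0 // (opZ _ _ bA) ipZl ipZr mulrA r2.
by rewrite ler_pdivrMl // mulrC.
Qed.

Definition opint (a b : R) A :=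
  selfadj A /\ forall x, a * ip x x <= ip (A x) x <= b * ip x x.

Lemma invertible_opp A : bounded_op A -> invertible_op A -> invertible_op (\- A).
Proof.
move=> bA /(invertible_opP bA)[B bB [AB BA]].
apply/(invertible_opP (bounded_opp bA)); exists (\- B); first exact: bounded_opp.
by split=> x /=; rewrite ?(opN _ bA) ?(opN _ bB) opprK.
Qed.

Lemma real_spectrum_opint (a b : R) A t : opint a b A -> real_spectrum A t ->
  a <= t <= b.
Proof.
move=> [sA hA] spt; have sid (c : R) := selfadj_scale c selfadj_id.
apply/andP; split; rewrite leNgt; apply/negP => lt.
  apply: spt; apply: (@coercive_invertible _ (a - t)).
  - exact: (selfadj_sub sA (sid _)).
  - by rewrite subr_gt0.
  - by move=> x /=; rewrite !ipE; have /andP[] := hA x; lra.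
apply: spt; have -> : A \- t%:C \*: idfun = \- (t%:C \*: (idfun : H -> H) \- A).
  by apply/funext => x /=; rewrite opprB.
apply: invertible_opp; first exact: (selfadj_sub (sid t) sA).1.
apply: (@coercive_invertible _ (t - b)).
- exact: (selfadj_sub (sid _) sA).
- by rewrite subr_gt0.
- by move=> x /=; rewrite !ipE; have /andP[] := hA x; lra.
Qed.

Lemma op_horner_norm_le p A (e : R) : selfadj A -> 0 <= e ->
  (forall t, real_spectrum A t -> `|p.[t]| <= e) ->
  forall x, ip (op_horner p A x) (op_horner p A x) <= e ^+ 2 * ip x x.
Proof.
move=> sA e0 hp; apply: selfadj_norm_le => //; first exact: op_horner_selfadj.
move=> x; have h1 : 0 <= ip (op_horner (e%:P - p) A x) x.
  apply: op_horner_ge0 => // t /hp; rewrite ler_norml hornerD hornerN hornerC.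
  by move=> /andP[]; lra.
have h2 : 0 <= ip (op_horner (e%:P + p) A x) x.
  apply: op_horner_ge0 => // t /hp; rewrite ler_norml hornerD hornerC.
  by move=> /andP[]; lra.
move: h1 h2; rewrite op_hornerB op_hornerD op_hornerC !ipE => h1 h2.
by apply/andP; split; lra.
Qed.

Lemma n2D_norm_le x y (u v : R) : 0 <= u -> 0 <= v ->
  ip x x <= u ^+ 2 -> ip y y <= v ^+ 2 -> ip (x + y) (x + y) <= (u + v) ^+ 2.
Proof.
move=> u0 v0; rewrite -!norm_le ?addr_ge0 // => hx hy.
by apply: le_trans (ler_normD _ _) _; rewrite rmorphD lerD.
Qed.

Lemma n2D_opnorm_le x y z (u v : R) : 0 <= u -> 0 <= v ->
  ip x x <= u ^+ 2 * ip z z -> ip y y <= v ^+ 2 * ip z z ->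
  ip (x + y) (x + y) <= (u + v) ^+ 2 * ip z z.
Proof.
move=> u0 v0; have := sqr_sqrtr (ip_ge0 z); set w := Num.sqrt _ => <-.
have w0 : 0 <= w by exact: sqrtr_ge0.
by rewrite -!exprMn mulrDl; apply: n2D_norm_le; rewrite mulr_ge0.
Qed.

Lemma le_epsilon_sqr (u e v : R) : 0 <= e -> 0 <= v ->
  (forall d, 0 < d -> u <= (e + d) ^+ 2 * v) -> u <= e ^+ 2 * v.
Proof.
move=> e0 v0 h; apply/ler_addgt0Pr => d d0.
(* For d' <= 1 the excess of (e + d')^2 v over e^2 v is at most d' (2 e v + v). *)
pose c := 2 * e * v + v + 1; have c0 : 0 < c by rewrite /c; nra.
pose d' := Num.min 1 (d / c).
have d'0 : 0 < d' by rewrite lt_min ltr01 divr_gt0.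
have d'1 : d' <= 1 by rewrite ge_min lexx.
have d'c : d' * c <= d by rewrite -ler_pdivlMr // ge_min lexx orbT.
apply: le_trans (h _ d'0) _; rewrite /c in d'c; nra.
Qed.

(** Any polynomial close to f on the spectrum may replace the sequence hidden in [is_fcalc]: p - q_n
    is within e + d / 2 of 0 on the spectrum, so [op_horner_norm_le] applies. Uniqueness and all
    algebraic rules follow from this. *)
Lemma is_fcalc_key f A T p (e : R) : selfadj A -> is_fcalc f A T -> 0 <= e ->
  (forall t, real_spectrum A t -> `|p.[t] - f t| <= e) ->
  forall x, ip (op_horner p A x - T x) (op_horner p A x - T x) <= e ^+ 2 * ip x x.
Proof.
move=> sA [bT [q [qf qT]]] e0 hp x; have [bA _] := sA.
apply: le_epsilon_sqr => // [|d d0]; first exact: ip_ge0.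
have d2 : 0 < d / 2 by rewrite divr_gt0.
move/uniform_cvgP: qf => /(_ _ d2)[N1 hN1].
move/cvgrPdist_lt: qT => /(_ _ d2)[N2 _ hN2].
pose n := maxn N1 N2.
have /= h2 := hN2 n (leq_maxr _ _).
have bS : bounded_op (op_horner (q n) A \- T).
  by apply: bounded_sub => //; exact: (op_horner_selfadj _ sA).1.
rewrite sub0r normrN ger0_norm ?opnorm_ge0 // in h2.
have -> : op_horner p A x - T x = op_horner (p - q n) A x + (op_horner (q n) A \- T) x.
  by rewrite /= op_hornerB subrKA.
have -> : e + d = (e + d / 2) + d / 2 by lra.
apply: n2D_opnorm_le; [lra|lra| |].
  apply: op_horner_norm_le => //; first lra.
  move=> t spt; rewrite hornerD hornerN -(subrKA (f t)).
  apply: le_trans (ler_normD _ _) _; apply: lerD; first exact: hp.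
  by rewrite distrC; apply/ltW/hN1 => //; exact: leq_maxl.
apply: le_trans (opnorm_ub x bS) _; rewrite ler_wpM2r ?ip_ge0 //.
by rewrite ler_pXn2r ?nnegrE ?opnorm_ge0 // ltW.
Qed.

Lemma is_fcalc_unique f A T T' : selfadj A -> is_fcalc f A T -> is_fcalc f A T' ->
  T = T'.
Proof.
move=> sA hT hT'; have [_ [q [/uniform_cvgP qf _]]] := hT.
apply/funext => x; apply/eqP; rewrite -subr_eq0; apply/eqP/ip_eq0/eqP.
suff h : ip (T x - T' x) (T x - T' x) <= 0 ^+ 2 * ip x x.
  by rewrite eq_le ip_ge0 andbT; move: h; rewrite expr0n mul0r.
apply: le_epsilon_sqr => // [|d d0]; first exact: ip_ge0.
have d2 : 0 < d / 2 by rewrite divr_gt0.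
have [N hN] := qf _ d2.
have hq t : real_spectrum A t -> `|(q N).[t] - f t| <= d / 2.
  by move=> spt; apply/ltW/hN.
have h1 := is_fcalc_key sA hT (ltW d2) hq x.
have h2 := is_fcalc_key sA hT' (ltW d2) hq x.
have -> : T x - T' x = - (op_horner (q N) A x - T x) + (op_horner (q N) A x - T' x).
  by rewrite opprB subrKA.
have -> : 0 + d = d / 2 + d / 2 by lra.
by apply: n2D_opnorm_le; rewrite ?(ltW d2) // ipNl ipNr opprK.
Qed.

Lemma fcalcE f A T : selfadj A -> is_fcalc f A T -> fcalc f A = T.
Proof.
move=> sA hT; rewrite /fcalc; case: xgetP => [T' _ hT'|/(_ T)//].
exact: is_fcalc_unique hT.
Qed.

(** Weierstrass polynomials with error 1 / (n + 1) on [a, b], which contains the spectrum, give an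
    operator sequence that is Cauchy in norm; T is its pointwise limit. *)
Lemma is_fcalc_exists f A (a b : R) : a < b -> opint a b A -> contin_on f a b ->
  exists T, is_fcalc f A T.
Proof.
move=> ab oA cf; have [sA _] := oA; have [bA _] := sA.
have inv_gt0 n : 0 < n.+1%:R^-1 :> R by rewrite invr_gt0 ltr0n.
have [p hp] := choice (fun n : nat => weierstrass ab cf (inv_gt0 n)).
have bP n : bounded_op (op_horner (p n) A) := (op_horner_selfadj _ sA).1.
have diff m n x : ip (op_horner (p m) A x - op_horner (p n) A x)
    (op_horner (p m) A x - op_horner (p n) A x) <=
    (m.+1%:R^-1 + n.+1%:R^-1) ^+ 2 * ip x x.
  rewrite -op_hornerB; apply: op_horner_norm_le => //.
  move=> t /(real_spectrum_opint oA) tab; rewrite hornerD hornerN -(subrKA (f t)).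
  by apply: le_trans (ler_normD _ _) _; rewrite lerD // ?[`|f t - _|]distrC; exact: hp.
have small (c e : R) : 0 < e -> exists N, forall n, (N <= n)%N -> c ^+ 2 / n.+1%:R <= e.
  move=> e0; have [N hN] := archi_small (c ^+ 2) e0.
  exists N => n Nn; apply: le_trans hN; apply: ler_wpM2l; first exact: sqr_ge0.
  by rewrite lef_pV2 ?posrE ?ltr0n // ler_nat.
have cauchy x (e : R) : 0 < e -> exists N, forall m n, (N <= m)%N -> (N <= n)%N ->
    ip (op_horner (p m) A x - op_horner (p n) A x)
      (op_horner (p m) A x - op_horner (p n) A x) < e.
  move=> e0.
  (* As u, v <= 1, (u + v)^2 w <= 2 u w + 2 v w <= 4 e / 5, strictly below e. *)
  have e4 : 0 < e / 5 by rewrite divr_gt0.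
  have [N hN] := small (Num.sqrt (ip x x)) _ e4; rewrite sqr_sqrtr ?ip_ge0 // in hN.
  exists N => m n Nm Nn; apply: le_lt_trans (diff _ _ _) _.
  have := hN _ Nm; have := hN _ Nn; have := ip_ge0 x.
  have := inv_gt0 m; have := inv_gt0 n.
  have : n.+1%:R^-1 <= 1 :> R by rewrite invf_le1 ?ltr0n // ler1n.
  have : m.+1%:R^-1 <= 1 :> R by rewrite invf_le1 ?ltr0n // ler1n.
  set u := m.+1%:R^-1; set v := n.+1%:R^-1; set w := ip x x.
  move=> u1 v1 v0 u0 w0 h1 h2.
  have h3 : (u + v) ^+ 2 <= 2 * u + 2 * v by nra.
  apply: le_lt_trans (ler_wpM2r w0 h3) _; lra.
have [T hT] := choice (fun x => hilbert_complete (cauchy x)).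
have lim n x : ip (op_horner (p n) A x - T x) (op_horner (p n) A x - T x) <=
    (2 * n.+1%:R^-1) ^+ 2 * ip x x.
  apply: le_epsilon_sqr => // [|d d0]; first exact: ip_ge0.
  (* The other case asks the limit for the tolerance d^2 <x, x>, which must be positive. *)
  have [x0|xN] := eqVneq (ip x x) 0.
    have [_ [M M0 hM]] := (bounded_opP _).1 (bP n).
    rewrite (ip_eq0 x0) (op0 (bP n)) sub0r ip0l mulr0 ipNl ipNr opprK.
    apply/ler_addgt0Pr => e e0; rewrite add0r.
    have [N hN] := hT 0 e e0; have := hN N (leqnn _).
    by rewrite (op0 (bP N)) sub0r ipNl ipNr opprK => /ltW.
  have x_gt0 : 0 < ip x x by rewrite lt_def xN ip_ge0.
  have [N hN] := hT x _ (mulr_gt0 (exprn_gt0 2 d0) x_gt0).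
  pose m := maxn n N.
  have -> : op_horner (p n) A x - T x =
     (op_horner (p n) A x - op_horner (p m) A x) + (op_horner (p m) A x - T x).
    by rewrite subrKA.
  apply: n2D_opnorm_le; [by rewrite mulr_ge0 // ltW|exact: ltW| |].
    apply: le_trans (diff _ _ _) _; rewrite ler_wpM2r ?ip_ge0 //.
    rewrite ler_pXn2r ?nnegrE ?addr_ge0 ?mulr_ge0 // ?(ltW (inv_gt0 _)) //.
    rewrite mulr_natl mulr2n lerD2l lef_pV2 ?posrE ?ltr0n // ler_nat ltnS.
    exact: leq_maxl.
  by apply/ltW/hN; exact: leq_maxr.
have bT : bounded_op T.
  apply/bounded_opP; split.
    move=> c x y; apply/eqP; rewrite -subr_eq0; apply/eqP/ip_eq0/eqP.
    rewrite eq_le ip_ge0 andbT; apply/ler_addgt0Pr => e; rewrite add0r => e0.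
    have e1 : 0 < e / 16 by rewrite divr_gt0.
    pose c2 := complex.Re `|c| ^+ 2 + 1.
    have c20 : 0 < c2 by rewrite ltr_wpDl ?sqr_ge0.
    have e2 : 0 < e / 16 / c2 by rewrite divr_gt0.
    have [N1 hN1] := hT (c *: x + y) _ e1.
    have [N2 hN2] := hT x _ e2; have [N3 hN3] := hT y _ e1.
    pose n := maxn N1 (maxn N2 N3).
    have n1 : (N1 <= n)%N by rewrite leq_maxl.
    have n2 : (N2 <= n)%N by rewrite /n !leq_max leqnn orbT.
    have n3 : (N3 <= n)%N by rewrite /n !leq_max leqnn !orbT.
    move: (hN1 n n1) (hN2 n n2) (hN3 n n3).
    rewrite (opD _ _ (bP n)) (opZ _ _ (bP n)).
    set P := op_horner (p n) A => h1 h2 h3.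
    have -> : T (c *: x + y) - (c *: T x + T y) =
        - (c *: P x + P y - T (c *: x + y)) + (c *: (P x - T x) + (P y - T y)).
      by rewrite opprB scalerBr [X in _ = _ + X]addrACA -opprD subrKA.
    apply: le_trans (n2D_le _ _) _; rewrite ipNl ipNr opprK.
    have h4 := n2D_le (c *: (P x - T x)) (P y - T y); rewrite ip_scale in h4.
    rewrite ltr_pdivlMr // /c2 in h2.
    have := ip_ge0 (P x - T x); lra.
  have [_ [M M0 hM]] := (bounded_opP _).1 (bP 0%N).
  exists (M + 2) => [|x]; first lra.
  have -> : T x = op_horner (p 0%N) A x + - (op_horner (p 0%N) A x - T x).
    by rewrite opprB addrC subrK.
  apply: n2D_opnorm_le => //; rewrite ipNl ipNr opprK.
  by have := lim 0%N x; rewrite invr1 mulr1.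
exists T; split=> //; exists p; split.
  apply/uniform_cvgP => e e0.
  have e2 : 0 < e / 2 by rewrite divr_gt0.
  have [N hN] := small 1 _ e2; exists N => n Nn t /(real_spectrum_opint oA) tab.
  have h1 := hp n t tab; have h2 := hN n Nn; rewrite expr1n mul1r in h2.
  apply: le_lt_trans (le_trans h1 h2) _; lra.
apply/cvgrPdist_lt => /= e e0.
have e4 : 0 < e / 4 by rewrite divr_gt0.
have [N hN] := small 1 _ e4; exists N => // n /= Nn.
have bS : bounded_op (op_horner (p n) A \- T) by exact: bounded_sub.
rewrite sub0r normrN ger0_norm ?opnorm_ge0 //.
have h : opnorm (op_horner (p n) A \- T) <= 2 * n.+1%:R^-1.
  by apply: opnorm_le; [rewrite mulr_ge0 // ltW | exact: lim].
have h2 := hN n Nn; rewrite expr1n mul1r in h2.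
apply: le_lt_trans h _; apply: (@le_lt_trans _ _ (2 * (e / 4))); last by lra.
by rewrite ler_wpM2l.
Qed.

(** * Calculus for operators with spectrum in (0, oo) *)

Definition cont_pos (f : R -> R) := forall t, 0 < t -> {for t, continuous f}.

(** The strict a < b gives scalar operators too a nondegenerate segment, as Bernstein polynomials
    require. *)
Definition posint (a b : R) A := [/\ 0 < a, a < b & opint a b A].

Lemma cont_pos_on f (a b : R) : 0 < a -> cont_pos f -> contin_on f a b.
Proof. by move=> a0 cf t /andP[ta _]; apply: cf; exact: lt_le_trans ta. Qed.

Definition posinv A := exists a b : R, posint a b A.

Lemma posinvopP A : posinvop dot A <-> posinv A.
Proof.
split.
  move=> [/posopP[sA pA] iA].
  have [c c0 hc] := pos_invertible_coercive sA pA iA.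
  have [M M0 hM] := bounded_form sA.1.
  exists c, (M + c); split; [by []|lra|split=> // x].
  rewrite hc; have /andP[_ h] := hM x; have := ip_ge0 x.
  by move=> x0 /=; apply: le_trans h _; rewrite mulrDl lerDl mulr_ge0 // ltW.
move=> [a [b [a0 ab [sA hA]]]].
have hA' x : a * ip x x <= ip (A x) x by case/andP: (hA x).
split; last exact: coercive_invertible sA a0 hA'.
apply/posopP; split=> // x; apply: le_trans (hA' x).
by rewrite mulr_ge0 ?ip_ge0 // ltW.
Qed.

Lemma cont_bounded f (a b : R) : contin_on f a b ->
  exists2 M : R, 0 <= M & forall t, a <= t <= b -> `|f t| <= M.
Proof.
move=> cf; have [K K0 hK] := quadratic_modulus cf ltr01.
exists (`|f a| + (1 + K * (b - a) ^+ 2)) => [|t tab].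
  by rewrite addr_ge0 // addr_ge0 // mulr_ge0 // sqr_ge0.
have aab : a <= a <= b by rewrite lexx /=; case/andP: tab; exact: le_trans.
rewrite -{1}(subrK (f a) (f t)) addrC; apply: le_trans (ler_normD _ _) _.
rewrite lerD2l; apply: le_trans (hK _ _ tab aab) _.
rewrite lerD2l; apply: ler_wpM2l => //; case/andP: tab => ? ?; nra.
Qed.

Section Calculus.
Variables (a b : R) (A : H -> H).
Hypothesis pA : posint a b A.

Let a0 : 0 < a. Proof. by case: pA. Qed.
Let ab : a < b. Proof. by case: pA. Qed.
Let oA : opint a b A. Proof. by case: pA. Qed.
Let sA : selfadj A. Proof. by case: oA. Qed.
Let bA : bounded_op A. Proof. by case: sA. Qed.

Lemma fcalcP f : cont_pos f -> is_fcalc f A (fcalc f A).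
Proof.
move=> cf; have [T hT] := is_fcalc_exists ab oA (cont_pos_on a0 cf).
by rewrite (fcalcE sA hT).
Qed.

Lemma fcalc_bounded f : cont_pos f -> bounded_op (fcalc f A).
Proof. by move=> /fcalcP[]. Qed.

Lemma fcalc_key f p (e : R) : cont_pos f -> 0 <= e ->
  (forall t, a <= t <= b -> `|p.[t] - f t| <= e) ->
  forall x, ip (op_horner p A x - fcalc f A x) (op_horner p A x - fcalc f A x)
    <= e ^+ 2 * ip x x.
Proof.
move=> /fcalcP hf e0 hp; apply: (is_fcalc_key sA hf e0) => t spt.
by apply: hp; exact: real_spectrum_opint oA spt.
Qed.

Lemma fcalc_approx f (e : R) : cont_pos f -> 0 < e ->
  exists2 p : {poly R}, (forall t, a <= t <= b -> `|p.[t] - f t| <= e) &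
  forall x, ip (op_horner p A x - fcalc f A x) (op_horner p A x - fcalc f A x)
    <= e ^+ 2 * ip x x.
Proof.
move=> cf e0; have [p hp] := weierstrass ab (cont_pos_on a0 cf) e0.
by exists p => //; apply: fcalc_key => //; exact: ltW.
Qed.

Lemma ip_small x y z (e : R) : 0 < e -> ip x x <= e ^+ 2 * ip z z ->
  `|ip x y| <= e * (ip z z + ip y y).
Proof.
move=> e0 hx; have h1 := ip_ge0 (x - e%:C *: y).
have h2 := ip_ge0 (x + e%:C *: y); have z0 := ip_ge0 z; have y0 := ip_ge0 y.
move: h1 h2; rewrite !ipE (ipC y x) => h1 h2.
rewrite ler_norml; apply/andP; split; rewrite -(ler_pM2l e0); nra.
Qed.

Lemma small_zero x (M : R) : (forall e, 0 < e -> ip x x <= e ^+ 2 * M) -> x = 0.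
Proof.
move=> h; apply/ip_eq0/eqP; rewrite eq_le ip_ge0 andbT.
apply/ler_addgt0Pr => e e0; rewrite add0r.
have M1 : 0 < `|M| + 1 by rewrite ltr_wpDl.
pose d := Num.min 1 (e / (`|M| + 1)).
have d0 : 0 < d by rewrite lt_min ltr01 divr_gt0.
have d1 : d <= 1 by rewrite ge_min lexx.
have de : d * (`|M| + 1) <= e by rewrite -ler_pdivlMr // ge_min lexx orbT.
apply: le_trans (h d d0) _; apply: le_trans de.
have h1 := ler_norm M; have h2 := normr_ge0 M.
have h3 : d ^+ 2 <= d by rewrite expr2 ler_piMl // ltW.
apply: le_trans (ler_wpM2l (sqr_ge0 d) h1) _.
by apply: le_trans (ler_wpM2r h2 h3) _; rewrite ler_wpM2l ?(ltW d0) // lerDl.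
Qed.

Lemma fcalc_selfadj f : cont_pos f -> selfadj (fcalc f A).
Proof.
move=> cf; split=> [|x y]; first exact: fcalc_bounded.
apply/eqP; rewrite -subr_eq0 -normr_le0; apply/ler_addgt0Pr => e e0; rewrite add0r.
pose m := 2 * (ip x x + ip y y) + 1.
have m0 : 0 < m by rewrite /m; have := ip_ge0 x; have := ip_ge0 y; lra.
have em : 0 < e / m by rewrite divr_gt0.
have [p _ hp] := fcalc_approx cf em.
have h1 := ip_small y em (hp x); have h2 := ip_small x em (hp y).
have [_ sP] := op_horner_selfadj p sA.
have h3 : e / m * m = e by rewrite divfK // gt_eqF.
move: h1 h2; rewrite !ipDl !ipNl sP (ipC x (_ y)) (ipC x (fcalc f A y)).
rewrite !ler_norml => /andP[h4 h5] /andP[h6 h7].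
by rewrite -h3 /m; apply/andP; split; lra.
Qed.

Lemma fcalc_le_eps f g (e : R) : cont_pos f -> cont_pos g ->
  (forall t, a <= t <= b -> f t <= g t + e) ->
  forall x, ip (fcalc f A x) x <= ip (fcalc g A x) x + e * ip x x.
Proof.
move=> cf cg fg x; apply/ler_addgt0Pr => d d0.
(* The error is 6 (d / m) <x, x>: 2 from the shift that makes q - p + e nonnegative, and 2 from each
   use of [ip_small]. *)
pose m := 6 * ip x x + 1; have x0 := ip_ge0 x.
have m0 : 0 < m by rewrite /m; lra.
have dm : 0 < d / m by rewrite divr_gt0.
have [p hp1 hp2] := fcalc_approx cf dm; have [q hq1 hq2] := fcalc_approx cg dm.
have := ip_small x dm (hp2 x); have := ip_small x dm (hq2 x).
have : 0 <= ip (op_horner (q - p + (e + 2 * (d / m))%:P) A x) x.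
  apply: op_horner_ge0 => // t /(real_spectrum_opint oA) tab.
  have := hp1 t tab; have := hq1 t tab; have := fg t tab.
  rewrite !ler_norml !hornerD hornerN hornerC => ? /andP[? ?] /andP[? ?]; lra.
rewrite op_hornerD op_hornerB op_hornerC !ipE.
have h3 : d / m * m = d by rewrite divfK // gt_eqF.
rewrite !ler_norml => h1 /andP[h4 h5] /andP[h6 h7].
by rewrite -[X in _ + X]h3 /m; rewrite /m in h1 h4 h5 h6 h7 *; lra.
Qed.

Lemma fcalc_le f g : cont_pos f -> cont_pos g ->
  (forall t, a <= t <= b -> f t <= g t) ->
  forall x, ip (fcalc f A x) x <= ip (fcalc g A x) x.
Proof.
move=> cf cg fg x; rewrite -[leRHS]addr0 -(mul0r (ip x x)).
by apply: fcalc_le_eps => // t tab; rewrite addr0 fg.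
Qed.

Lemma cont_horner p : cont_pos (fun t => p.[t]).
Proof. by move=> t _; exact: continuous_horner. Qed.

Lemma fcalc_close f g (e : R) : cont_pos f -> cont_pos g -> 0 <= e ->
  (forall t, a <= t <= b -> `|f t - g t| <= e) ->
  forall x, ip (fcalc f A x - fcalc g A x) (fcalc f A x - fcalc g A x) <= e ^+ 2 * ip x x.
Proof.
move=> cf cg e0 fg x.
apply: (@selfadj_norm_le (fcalc f A \- fcalc g A)) => // [|y].
  by apply: selfadj_sub; exact: fcalc_selfadj.
have h1 : ip (fcalc f A y) y <= ip (fcalc g A y) y + e * ip y y.
  by apply: fcalc_le_eps => // t /fg; rewrite ler_norml => /andP[]; lra.
have h2 : ip (fcalc g A y) y <= ip (fcalc f A y) y + e * ip y y.
  by apply: fcalc_le_eps => // t /fg; rewrite ler_norml => /andP[]; lra.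
by rewrite /= !ipE; apply/andP; split; lra.
Qed.

Lemma fcalc_ext f g : cont_pos f -> cont_pos g ->
  (forall t, a <= t <= b -> f t = g t) -> fcalc f A = fcalc g A.
Proof.
move=> cf cg fg; apply/funext => x; apply/eqP; rewrite -subr_eq0; apply/eqP.
apply/ip_eq0/eqP; rewrite eq_le ip_ge0 andbT.
have := @fcalc_close f g 0 cf cg (lexx 0) _ x; rewrite expr0n mul0r; apply.
by move=> t /fg ->; rewrite subrr normr0.
Qed.

Lemma fcalc_poly f p : cont_pos f -> (forall t, a <= t <= b -> f t = p.[t]) ->
  fcalc f A = op_horner p A.
Proof.
move=> cf fp; apply/funext => x; apply/esym/eqP; rewrite -subr_eq0; apply/eqP.
apply/ip_eq0/eqP; rewrite eq_le ip_ge0 andbT.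
have := @fcalc_key f p 0 cf (lexx 0) _ x; rewrite expr0n mul0r; apply.
by move=> t /fp ->; rewrite subrr normr0.
Qed.

Lemma cont_cst (c : R) : cont_pos (fun=> c).
Proof. by move=> t _; exact: cst_continuous. Qed.

Lemma cont_id : cont_pos (fun t => t).
Proof. by move=> t _ U. Qed.

Lemma contD f g : cont_pos f -> cont_pos g -> cont_pos (fun t => f t + g t).
Proof. by move=> cf cg t t0; apply: continuousD; [exact: cf | exact: cg]. Qed.

Lemma contM f g : cont_pos f -> cont_pos g -> cont_pos (fun t => f t * g t).
Proof. by move=> cf cg t t0; apply: continuousM; [exact: cf | exact: cg]. Qed.

Lemma cont_comp f g : cont_pos f -> cont_pos g -> (forall t, 0 < t -> 0 < f t) ->
  cont_pos (fun t => g (f t)).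
Proof.
by move=> cf cg f0 t t0; apply: continuous_comp; [exact: cf | apply/cg/f0].
Qed.

Lemma fcalc_cst (c : R) x : fcalc (fun=> c) A x = c%:C *: x.
Proof.
rewrite (@fcalc_poly _ c%:P (@cont_cst c)) ?op_hornerC // => t _.
by rewrite hornerC.
Qed.

Lemma fcalc_id : fcalc (fun t => t) A = A.
Proof.
rewrite (@fcalc_poly _ 'X cont_id) => [|t _]; last by rewrite hornerX.
by apply/funext => x; rewrite op_hornerX.
Qed.

Lemma ip_opp x : ip (- x) (- x) = ip x x.
Proof. by rewrite ipNl ipNr opprK. Qed.

Lemma fcalcD f g x : cont_pos f -> cont_pos g ->
  fcalc (fun t => f t + g t) A x = fcalc f A x + fcalc g A x.
Proof.
move=> cf cg; apply/eqP; rewrite -subr_eq0; apply/eqP/(@small_zero _ (16 * ip x x)).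
move=> e e0; have [p hp1 hp2] := fcalc_approx cf e0.
have [q hq1 hq2] := fcalc_approx cg e0.
have h : forall t, a <= t <= b -> `|(p + q).[t] - (f t + g t)| <= 2 * e.
  move=> t tab; rewrite hornerD opprD addrACA.
  by apply: le_trans (ler_normD _ _) _; have := hp1 t tab; have := hq1 t tab; lra.
have e20 : 0 <= 2 * e by lra.
have h1 := fcalc_key (contD cf cg) e20 h x.
have h2 := n2D_opnorm_le (ltW e0) (ltW e0) (hp2 x) (hq2 x).
have -> : fcalc (fun t => f t + g t) A x - (fcalc f A x + fcalc g A x) =
  - (op_horner (p + q) A x - fcalc (fun t => f t + g t) A x) +
  ((op_horner p A x - fcalc f A x) + (op_horner q A x - fcalc g A x)).
  by rewrite op_hornerD opprB [X in _ = _ + X]addrACA -opprD subrKA.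
rewrite -ip_opp in h1.
have := n2D_opnorm_le e20 (addr_ge0 (ltW e0) (ltW e0)) h1 h2; lra.
Qed.

Lemma fcalcM f g x : cont_pos f -> cont_pos g ->
  fcalc (fun t => f t * g t) A x = fcalc f A (fcalc g A x).
Proof.
move=> cf cg.
have [M M0 hM] := cont_bounded (cont_pos_on (b := b) a0 cf).
have [N N0 hN] := cont_bounded (cont_pos_on (b := b) a0 cg).
(* The restriction e <= 1 gives |p| <= M + 1 independently of e; larger e follow from e = 1. *)
have key (e : R) : 0 < e -> e <= 1 ->
    ip (fcalc (fun t => f t * g t) A x - fcalc f A (fcalc g A x))
       (fcalc (fun t => f t * g t) A x - fcalc f A (fcalc g A x)) <=
    e ^+ 2 * (((M + 1 + N) + (M + 1 + N)) ^+ 2 * ip x x).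
  move=> e0 e1; have [p hp1 hp2] := fcalc_approx cf e0.
  have [q hq1 hq2] := fcalc_approx cg e0.
  have pM t : a <= t <= b -> `|p.[t]| <= M + 1.
    move=> tab; rewrite -(subrK (f t) p.[t]); apply: le_trans (ler_normD _ _) _.
    by have := hp1 t tab; have := hM t tab; lra.
  have k0 : 0 <= e * (M + 1 + N) by rewrite mulr_ge0 ?(ltW e0) //; lra.
  have h : forall t, a <= t <= b -> `|(p * q).[t] - (f t * g t)| <= e * (M + 1 + N).
    move=> t tab; rewrite hornerM.
    have -> : p.[t] * q.[t] - f t * g t = p.[t] * (q.[t] - g t) + (p.[t] - f t) * g t.
      by ring.
    apply: le_trans (ler_normD _ _) _; rewrite !normrM.
    have h1 := ler_pM (normr_ge0 _) (normr_ge0 _) (pM t tab) (hq1 t tab).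
    have h2 := ler_pM (normr_ge0 _) (normr_ge0 _) (hp1 t tab) (hN t tab).
    by apply: le_trans (lerD h1 h2) _; lra.
  have h1 := fcalc_key (contM cf cg) k0 h x; rewrite -ip_opp in h1.
  have P1 z : ip (op_horner p A z) (op_horner p A z) <= (M + 1) ^+ 2 * ip z z.
    apply: op_horner_norm_le => //; first lra.
    by move=> t /(real_spectrum_opint oA); exact: pM.
  have G1 : ip (fcalc g A x) (fcalc g A x) <= N ^+ 2 * ip x x.
    have := fcalc_close cg (@cont_cst 0) N0 _ x; rewrite fcalc_cst rmorph0 scale0r subr0.
    by apply=> t tab; rewrite subr0; exact: hN.
  have h2 : ip (op_horner p A (op_horner q A x - fcalc g A x))
      (op_horner p A (op_horner q A x - fcalc g A x)) <= (e * (M + 1)) ^+ 2 * ip x x.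
    apply: le_trans (P1 _) _; rewrite exprMn [e ^+ 2 * _]mulrC.
    by rewrite -(mulrA (_ ^+ 2)) ler_wpM2l ?sqr_ge0.
  have h3 : ip (op_horner p A (fcalc g A x) - fcalc f A (fcalc g A x))
      (op_horner p A (fcalc g A x) - fcalc f A (fcalc g A x)) <= (e * N) ^+ 2 * ip x x.
    apply: le_trans (hp2 _) _; rewrite exprMn.
    by rewrite -(mulrA (_ ^+ 2)) ler_wpM2l ?sqr_ge0.
  have k1 : 0 <= e * (M + 1) by rewrite mulr_ge0 ?(ltW e0) //; lra.
  have k2 : 0 <= e * N by rewrite mulr_ge0 ?(ltW e0).
  have h4 := n2D_opnorm_le k1 k2 h2 h3.
  have h5 := n2D_opnorm_le k0 (addr_ge0 k1 k2) h1 h4.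
  have bP : bounded_op (op_horner p A) := (op_horner_selfadj p sA).1.
  rewrite op_hornerM // (opB _ _ bP) subrKA opprB subrKA in h5.
  by apply: le_trans h5 _; rewrite -!mulrDr exprMn mulrA lexx.
apply/eqP; rewrite -subr_eq0; apply/eqP.
apply/(@small_zero _ (((M + 1 + N) + (M + 1 + N)) ^+ 2 * ip x x)) => e e0.
have [e1|e1] := leP e 1; first exact: key.
apply: le_trans (key 1 ltr01 (lexx 1)) _; rewrite expr1n mul1r ler_peMl //.
  by rewrite mulr_ge0 ?sqr_ge0 ?ip_ge0.
by rewrite expr_ge1 // ltW.
Qed.

Lemma op_horner_fcalc q f x : cont_pos f ->
  op_horner q (fcalc f A) x = fcalc (fun t => q.[f t]) A x.
Proof.
move=> cf; elim/poly_ind: q x => [|q c IH] x.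
  by rewrite op_horner0; under eq_fun do rewrite horner0; rewrite fcalc_cst scale0r.
have cq : cont_pos (fun t => q.[f t]).
  by move=> t t0; apply: continuous_comp; [exact: cf | exact: continuous_horner].
rewrite op_hornerMXaddC IH -fcalcM // -(fcalc_cst c x) -fcalcD //.
- by congr fcalc; apply/funext => t; rewrite hornerMXaddC.
- exact: contM.
- exact: cont_cst.
Qed.

Lemma fcalc_opint f (c d : R) : cont_pos f ->
  (forall t, a <= t <= b -> c <= f t <= d) -> opint c d (fcalc f A).
Proof.
move=> cf hf; split=> [|x]; first exact: fcalc_selfadj.
have h1 := @fcalc_le (fun=> c) f (@cont_cst c) cf (fun t tab => proj1 (andP (hf t tab))) x.
have h2 := @fcalc_le f (fun=> d) cf (@cont_cst d) (fun t tab => proj2 (andP (hf t tab))) x.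
by move: h1 h2; rewrite !fcalc_cst !ipZl => -> ->.
Qed.

End Calculus.
(** For a polynomial q close to g on the range of f, q(f(A)) is (q o f)(A) by [op_horner_fcalc];
    both sides are then within e of it. *)
Lemma fcalc_comp (a b c d : R) A f g x : posint a b A -> cont_pos f -> cont_pos g ->
  (forall t, 0 < t -> 0 < f t) -> 0 < c -> c < d ->
  (forall t, a <= t <= b -> c <= f t <= d) ->
  fcalc g (fcalc f A) x = fcalc (fun t => g (f t)) A x.
Proof.
move=> pA cf cg f0 c0 cd hf.
have pf : posint c d (fcalc f A) by split=> //; exact: (fcalc_opint pA).
have cgf := cont_comp cf cg f0.
apply/eqP; rewrite -subr_eq0; apply/eqP/(@small_zero _ (4 * ip x x)) => e e0.
have [q hq1 hq2] := fcalc_approx pf cg e0.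
have cq : cont_pos (fun t => q.[f t]).
  by move=> t t0; apply: continuous_comp; [exact: cf | exact: continuous_horner].
have h1 := fcalc_close pA cq cgf (ltW e0) _ x.
have {h1} := h1 (fun t tab => hq1 _ (hf t tab)).
have := hq2 x; rewrite (op_horner_fcalc pA) // -ip_opp opprB => h2 h1.
have := n2D_opnorm_le (ltW e0) (ltW e0) h2 h1.
by rewrite subrKA => h; apply: le_trans h _; lra.
Qed.

Lemma posint_range (a b : R) A f : posint a b A -> cont_pos f ->
  (forall t, 0 < t -> 0 < f t) ->
  exists c d : R, [/\ 0 < c, c < d & forall t, a <= t <= b -> c <= f t <= d].
Proof.
move=> [a0 ab _] cf f0; have cab := cont_pos_on (b := b) a0 cf.
have cw : {within `[a, b], continuous f}.
  by apply: continuous_in_subspaceT => x; rewrite inE /= in_itv /=; exact: cab.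
have [c1 c1ab hmin] := EVT_min (ltW ab) cw; have [c2 _ hmax] := EVT_max (ltW ab) cw.
rewrite in_itv /= in c1ab.
have c1_gt0 : 0 < c1 by case/andP: c1ab => h _; exact: lt_le_trans h.
exists (f c1), (f c2 + f c1); split.
- exact: f0.
- rewrite ltrDr; apply: lt_le_trans (f0 _ c1_gt0) _.
  by apply: hmax; rewrite in_itv.
- move=> t tab; rewrite hmin ?in_itv //=.
  by apply: le_trans (hmax t _) _; rewrite ?in_itv // lerDl ltW // f0.
Qed.

Lemma fcalc_posint (a b : R) A f : posint a b A -> cont_pos f ->
  (forall t, 0 < t -> 0 < f t) -> exists c d, posint c d (fcalc f A).
Proof.
move=> pA cf f0; have [c [d [c0 cd hf]]] := posint_range pA cf f0.
by exists c, d; split=> //; exact: (fcalc_opint pA).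
Qed.

Lemma fcalc_fcalc (a b : R) A f g x : posint a b A -> cont_pos f -> cont_pos g ->
  (forall t, 0 < t -> 0 < f t) ->
  fcalc g (fcalc f A) x = fcalc (fun t => g (f t)) A x.
Proof.
move=> pA cf cg f0; have [c [d [c0 cd hf]]] := posint_range pA cf f0.
exact: fcalc_comp pA _ _ _ c0 cd hf.
Qed.

Lemma op_horner_intertwine p A B Y x : bounded_op A -> bounded_op B -> bounded_op Y ->
  (forall x, Y (A x) = B (Y x)) -> Y (op_horner p A x) = op_horner p B (Y x).
Proof.
move=> bA bB bY YA; elim/poly_ind: p x => [|p c IH] x.
  by rewrite !op_horner0 (op0 bY).
by rewrite !op_hornerMXaddC (opD _ _ bY) (opZ _ _ bY) IH YA.
Qed.

Lemma posint_widen (a b a' b' : R) A : 0 < a' -> a' <= a -> b <= b' ->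
  posint a b A -> posint a' b' A.
Proof.
move=> a'0 aa bb [a0 ab [sA hA]]; split=> //; first lra.
by split=> // x; have /andP[h1 h2] := hA x; have x0 := ip_ge0 x; apply/andP; split; nra.
Qed.

Lemma fcalc_intertwine (a b c d : R) f A B Y x : posint a b A -> posint c d B ->
  bounded_op Y -> cont_pos f -> (forall x, Y (A x) = B (Y x)) ->
  Y (fcalc f A x) = fcalc f B (Y x).
Proof.
move=> pA0 pB0 bY cf YA; have [a0 ab _] := pA0; have [c0 cd _] := pB0.
(* A common segment lets one polynomial approximate f for both operators. *)
have pA : posint (Num.min a c) (Num.max b d) A.
  by apply: posint_widen pA0; rewrite ?lt_min ?a0 ?ge_min ?le_max ?lexx.
have pB : posint (Num.min a c) (Num.max b d) B.
  by apply: posint_widen pB0; rewrite ?lt_min ?a0 ?ge_min ?le_max ?lexx ?orbT.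
have [_ [M M0 hM]] := (bounded_opP _).1 bY.
have [lt0 ltab oA] := pA; have [_ _ oB] := pB.
have [[bA _] _] := oA; have [[bB _] _] := oB.
apply/eqP; rewrite -subr_eq0; apply/eqP/(@small_zero _ ((2 * M) ^+ 2 * ip x x)) => e e0.
have [p hp] := weierstrass ltab (cont_pos_on lt0 cf) e0.
have h1 := fcalc_key pA cf (ltW e0) hp x.
have h2 := fcalc_key pB cf (ltW e0) hp (Y x).
have k0 : 0 <= e * M by rewrite mulr_ge0 // ltW.
have {}h1 : ip (- Y (op_horner p A x - fcalc f A x)) (- Y (op_horner p A x - fcalc f A x))
    <= (e * M) ^+ 2 * ip x x.
  rewrite ip_opp; apply: le_trans (hM _) _.
  by rewrite exprMn [e ^+ 2 * _]mulrC -(mulrA (_ ^+ 2)) ler_wpM2l ?sqr_ge0.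
have {}h2 : ip (op_horner p B (Y x) - fcalc f B (Y x))
    (op_horner p B (Y x) - fcalc f B (Y x)) <= (e * M) ^+ 2 * ip x x.
  by apply: le_trans h2 _; rewrite exprMn -(mulrA (_ ^+ 2)) ler_wpM2l ?sqr_ge0.
have := n2D_opnorm_le k0 k0 h1 h2.
rewrite (opB _ _ bY) (op_horner_intertwine _ _ bA bB bY YA) opprB subrKA.
by move=> h; apply: le_trans h _; lra.
Qed.

Lemma fcalc_comm (a b : R) f A Y x : posint a b A -> bounded_op Y -> cont_pos f ->
  (forall x, A (Y x) = Y (A x)) -> fcalc f A (Y x) = Y (fcalc f A x).
Proof.
by move=> pA bY cf AY; apply/esym/(fcalc_intertwine x pA pA bY cf) => y; rewrite AY.
Qed.

Lemma op_horner_eigen p A x (t : R) : bounded_op A -> A x = t%:C *: x ->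
  op_horner p A x = p.[t]%:C *: x.
Proof.
move=> bA Ax; elim/poly_ind: p => [|p c IH].
  by rewrite op_horner0 horner0 scale0r.
have bP : bounded_op (op_horner p A).
  by have -> : op_horner p A = chorner (map_poly (real_complex R) p) A;
    [apply/funext => y; exact: op_hornerE | exact: chorner_bounded].
rewrite op_hornerMXaddC Ax (opZ _ _ bP) IH scalerA -scalerDl hornerMXaddC.
by rewrite -rmorphM -rmorphD mulrC.
Qed.

Lemma fcalc_eigen (a b : R) f A x (t : R) : posint a b A -> cont_pos f ->
  a <= t <= b -> A x = t%:C *: x -> fcalc f A x = (f t)%:C *: x.
Proof.
move=> pA cf tab Ax; have [_ _ [[bA _] _]] := pA.
apply/eqP; rewrite -subr_eq0; apply/eqP/(@small_zero _ (4 * ip x x)) => e e0.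
have [p hp1 hp2] := fcalc_approx pA cf e0.
have h1 := hp2 x; rewrite (op_horner_eigen _ bA Ax) -ip_opp opprB in h1.
have h2 : ip (p.[t]%:C *: x - (f t)%:C *: x) (p.[t]%:C *: x - (f t)%:C *: x) <= e ^+ 2 * ip x x.
  rewrite -scalerBl -rmorphB ipZl ipZr mulrA -expr2 ler_wpM2r ?ip_ge0 //.
  by rewrite -[leLHS]real_normK ?num_real // ler_pXn2r ?nnegrE ?(ltW e0) // hp1.
have := n2D_opnorm_le (ltW e0) (ltW e0) h1 h2.
by rewrite subrKA => h; apply: le_trans h _; lra.
Qed.

(** * Real powers of positive invertible operators *)

Lemma cont_powR (s : R) : cont_pos (fun t => t `^ s).
Proof.
move=> t t0; apply: differentiable_continuous; apply/derivable1_diffP.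
by apply: derivable_powR; rewrite in_itv /= t0.
Qed.

Lemma cont_inv : cont_pos (fun t => t^-1).
Proof. by move=> t t0; apply: inv_continuous; rewrite gt_eqF. Qed.

Section PositiveCalculus.
Variable A : H -> H.
Hypothesis pA : posinv A.

Lemma posinv_selfadj : selfadj A.
Proof. by case: pA => [a [b [_ _ []]]]. Qed.

Lemma posinv_bounded : bounded_op A.
Proof. exact: posinv_selfadj.1. Qed.

Lemma posinv_ge0 x : 0 <= ip (A x) x.
Proof.
case: pA => [a [b [a0 ab [_ h]]]]; have /andP[+ _] := h x; apply: le_trans.
by rewrite mulr_ge0 ?ip_ge0 // ltW.
Qed.

Lemma pfcalc_selfadj f : cont_pos f -> selfadj (fcalc f A).
Proof. by case: pA => [a [b h]]; exact: fcalc_selfadj h _. Qed.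

Lemma pfcalc_posinv f : cont_pos f -> (forall t, 0 < t -> 0 < f t) -> posinv (fcalc f A).
Proof. by case: pA => [a [b h]]; exact: fcalc_posint h. Qed.

Lemma pfcalc_le f g : cont_pos f -> cont_pos g -> (forall t, 0 < t -> f t <= g t) ->
  forall x, ip (fcalc f A x) x <= ip (fcalc g A x) x.
Proof.
case: pA => [a [b h]] cf cg fg; apply: (fcalc_le h) => // t /andP[ta _].
by apply: fg; case: h => a0 _ _; exact: lt_le_trans ta.
Qed.

Lemma pfcalc_ext f g : cont_pos f -> cont_pos g -> (forall t, 0 < t -> f t = g t) ->
  fcalc f A = fcalc g A.
Proof.
case: pA => [a [b h]] cf cg fg; apply: (fcalc_ext h) => // t /andP[ta _].
by apply: fg; case: h => a0 _ _; exact: lt_le_trans ta.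
Qed.

Lemma pfcalc_cst (c : R) x : fcalc (fun=> c) A x = c%:C *: x.
Proof. by case: pA => [a [b h]]; exact: fcalc_cst h _ _. Qed.

Lemma pfcalc_id : fcalc (fun t => t) A = A.
Proof. by case: pA => [a [b h]]; exact: fcalc_id h. Qed.

Lemma pfcalcM f g x : cont_pos f -> cont_pos g ->
  fcalc (fun t => f t * g t) A x = fcalc f A (fcalc g A x).
Proof. by case: pA => [a [b h]]; exact: fcalcM h _ _ _. Qed.

Lemma pfcalc_fcalc f g x : cont_pos f -> cont_pos g -> (forall t, 0 < t -> 0 < f t) ->
  fcalc g (fcalc f A) x = fcalc (fun t => g (f t)) A x.
Proof. by case: pA => [a [b h]]; exact: fcalc_fcalc h. Qed.

Lemma pfcalc_comm f Y x : bounded_op Y -> cont_pos f ->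
  (forall x, A (Y x) = Y (A x)) -> fcalc f A (Y x) = Y (fcalc f A x).
Proof. by case: pA => [a [b h]]; exact: fcalc_comm h. Qed.

Lemma oppowD (s t : R) x : oppow A s (oppow A t x) = oppow A (s + t) x.
Proof.
rewrite /oppow -pfcalcM; try exact: cont_powR.
have := @pfcalc_ext (fun u => u `^ s * u `^ t) (fun u => u `^ (s + t)).
move=> ->//; [exact: contM (@cont_powR _) (@cont_powR _)|exact: cont_powR|].
by move=> u u0; rewrite powRD // (gt_eqF u0) implybT.
Qed.

Lemma oppow0 x : oppow A 0 x = x.
Proof.
rewrite /oppow (@pfcalc_ext _ (fun=> 1)) ?pfcalc_cst ?rmorph1 ?scale1r //.
- exact: cont_powR.
- exact: cont_cst.
- by move=> t t0; rewrite powRr0.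
Qed.

Lemma oppow1 : oppow A 1 = A.
Proof.
rewrite /oppow (@pfcalc_ext _ (fun t => t)) ?pfcalc_id //.
- exact: cont_powR.
- exact: cont_id.
- by move=> t t0; rewrite powRr1 // ltW.
Qed.

Lemma oppow_posinv (s : R) : posinv (oppow A s).
Proof. by apply: pfcalc_posinv; [exact: cont_powR | move=> t; exact: powR_gt0]. Qed.

Lemma oppowM (s t : R) x : oppow (oppow A s) t x = oppow A (s * t) x.
Proof.
rewrite /oppow pfcalc_fcalc; try exact: cont_powR; last by move=> u; exact: powR_gt0.
by congr fcalc; apply/funext => u; rewrite powRrM.
Qed.

Lemma oppowK (s : R) x : oppow A s (oppow A (- s) x) = x.
Proof. by rewrite oppowD subrr oppow0. Qed.

Lemma oppowNK (s : R) x : oppow A (- s) (oppow A s x) = x.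
Proof. by rewrite oppowD addNr oppow0. Qed.

End PositiveCalculus.

Lemma pfcalc_intertwine f A B Y x : posinv A -> posinv B ->
  bounded_op Y -> cont_pos f -> (forall x, Y (A x) = B (Y x)) ->
  Y (fcalc f A x) = fcalc f B (Y x).
Proof. by move=> [a [b pA]] [c [d pB]]; exact: fcalc_intertwine pA pB. Qed.

Lemma posinv_conj A S : posinv A -> posinv S -> posinv (S \o A \o S).
Proof.
move=> [a [b [a0 ab [sA hA]]]] [c [d [c0 cd [sS hS]]]].
have h1 := coercive_norm (ltW c0) (fun x => proj1 (andP (hS x))).
have [_ sS'] := sS.
exists (a * c ^+ 2), (b * d ^+ 2); split.
- by rewrite mulr_gt0 ?exprn_gt0.
- by apply: ltr_pM => //; rewrite ?(ltW a0) ?sqr_ge0 // ltr_pXn2r ?nnegrE ?(ltW c0) // ltW // (lt_trans c0).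
split=> [|x]; first exact: selfadj_conj.
have d0 : 0 < d := lt_trans c0 cd; have b0 : 0 < b := lt_trans a0 ab.
have x0 := ip_ge0 x.
have h3 : ip (S x) (S x) <= d ^+ 2 * ip x x.
  apply: (selfadj_norm_le sS (ltW d0)) => y; have /andP[h4 h5] := hS y.
  rewrite h5 andbT; apply: le_trans h4; have y0 := ip_ge0 y; nra.
have /andP[h4 h5] := hA (S x); have h6 := h1 x.
rewrite /= sS' -(mulrA a) -(mulrA b); apply/andP; split.
  by apply: le_trans h4; rewrite ler_wpM2l // (ltW a0).
by apply: le_trans h5 _; rewrite ler_wpM2l // (ltW b0).
Qed.

Lemma posinv_inverse_unique A B : posinv A -> (forall x, A (B x) = x) ->
  B = oppow A (- 1).
Proof.
move=> pA AB; apply/funext => x; rewrite -{2}(AB x).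
by have := oppowNK pA 1 (B x); rewrite (oppow1 pA).
Qed.

(** * The Loewner-Heinz inequality *)

Lemma square_root_le A B : posinv A -> posinv B ->
  (forall x, ip (A (A x)) x <= ip (B (B x)) x) ->
  forall x, ip (A x) x <= ip (B x) x.
Proof.
move=> pA [b [b' [b0 _ [sB hB]]]] AB; have [bA sA] := posinv_selfadj pA.
have [bB sB'] := sB.
have sD : selfadj (B \- A) by apply: selfadj_sub => //; split.
have [s [lb glb]] := form_inf sD.
suff s0 : 0 <= s.
  by move=> x; have := lb x; rewrite /= !ipE; have := mulr_ge0 s0 (ip_ge0 x); lra.
rewrite leNgt; apply/negP => s0.
pose S := (B \- A) \- s%:C \*: (idfun : H -> H).
have sS : selfadj S by exact: (selfadj_sub sD (selfadj_scale _ selfadj_id)).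
have [M M0 hM] := bounded_form sS.1.
have S0 x : 0 <= ip (S x) x by rewrite /S /= !ipE; have := lb x; rewrite /= !ipE; lra.
have hS x : ip (S x) (S x) <= M * ip (S x) x.
  by apply: pos_norm_le => // y; rewrite S0; case/andP: (hM y).
have [K [K0 hK]] : exists K : R, 0 < K /\ forall x, ip (B x) (B x) <= K ^+ 2 * ip x x.
  have [_ [K K0 hK]] := (bounded_opP _).1 bB.
  exists (K + 1); split; first lra.
  by move=> x; apply: le_trans (hK x) _; rewrite ler_wpM2r ?ip_ge0 //; nra.
(* |Ax| <= |Bx| gives <Bx, Dx> >= 0 for D = B - A.  If s = inf <Dx, x> were negative,
   then along a minimizing sequence S x = D x - s x tends to 0 while
   <Bx, Dx> = s <Bx, x> + <Bx, S x> would stay negative. *)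
have key x : - s * b * ip x x <= ip (B x) (S x).
  have h1 := AB x; have h2 := ip_ge0 (B x - A x).
  rewrite sA (sB' (B x)) in h1.
  have /andP[h3 _] := hB x; have x0 := ip_ge0 x.
  have h4 : ip (B x) (S x) = ip (B x) (B x) - ip (B x) (A x) - s * ip (B x) x.
    by rewrite /S /= !ipE; ring.
  rewrite !ipE (ipC (A x) (B x)) in h2.
  rewrite h4; nra.
(* Chosen so that [key] reads e K |x|^2 <= <Bx, Sx>. Cauchy-Schwarz with |Bx| <= K |x| and |Sx|^2 <=
   M <Sx, x> then gives e^2 |x|^2 <= M <Sx, x>, so s + e^2 / M would be a lower bound above the
   infimum s. *)
pose e := - s * b / K.
have e0 : 0 < e by rewrite divr_gt0 // mulr_gt0 // oppr_gt0.
suff : s + e ^+ 2 / M <= s by have := divr_gt0 (exprn_gt0 2 e0) M0; lra.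
apply: glb => x.
have h1 := cauchy_schwarz (B x) (S x); have h2 := key x; have x0 := ip_ge0 x.
have h3 : (e * K * ip x x) ^+ 2 <= K ^+ 2 * ip x x * (M * ip (S x) x).
  apply: (@le_trans _ _ (ip (B x) (S x) ^+ 2)).
    rewrite ler_pXn2r ?nnegrE // /e ?divfK ?(gt_eqF K0) //.
      by rewrite mulr_ge0 // mulr_ge0 ?(ltW b0) // oppr_ge0 ltW.
    by apply: le_trans h2; rewrite mulr_ge0 // mulr_ge0 ?(ltW b0) // oppr_ge0 ltW.
  apply: le_trans h1 _; apply: ler_pM => //; exact: ip_ge0.
have h4 : e ^+ 2 * ip x x <= M * ip (S x) x.
  have [xz|xN] := eqVneq (ip x x) 0; first by rewrite xz mulr0 mulr_ge0 ?S0 // ltW.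
  have xp : 0 < ip x x by rewrite lt_def xN.
  rewrite -(ler_pM2l (mulr_gt0 (exprn_gt0 2 K0) xp)); lra.
have h5 : ip (S x) x = ip ((B \- A) x) x - s * ip x x by rewrite /S /= !ipE.
rewrite h5 in h4; rewrite mulrDl mulrAC -lerBrDl ler_pdivrMr //; lra.
Qed.

Lemma pfcalcZ A f (c : R) x : posinv A -> cont_pos f ->
  fcalc (fun t => c * f t) A x = c%:C *: fcalc f A x.
Proof. by move=> pA cf; rewrite pfcalcM // ?pfcalc_cst //; exact: cont_cst. Qed.

(** The weighted geometric mean A #_s B. *)
Definition sandwich A B (s : R) : H -> H :=
  oppow A 2^-1 \o oppow (oppow A (- 2^-1) \o B \o oppow A (- 2^-1)) s \o oppow A 2^-1.

Lemma half_add : 2^-1 + 2^-1 = 1 :> R. Proof. by lra. Qed.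

Lemma oppow_half2 A x : posinv A -> oppow A 2^-1 (oppow A 2^-1 x) = A x.
Proof. by move=> pA; rewrite oppowD // half_add oppow1. Qed.

Lemma oppow_op A (s : R) x : posinv A -> oppow A s (A x) = oppow A (s + 1) x.
Proof. by move=> pA; rewrite -oppowD // oppow1. Qed.

(* With Y = A^(-1/2) B^(1/2) one has A^(-1/2) B A^(-1/2) = Y Y^* and
   B^(1/2) A^(-1) B^(1/2) = Y^* Y; then Y g(Y^* Y) = g(Y Y^* ) Y. *)
Lemma sandwich_transpose A B (s : R) : posinv A -> posinv B ->
  sandwich A B s = sandwich B A (1 - s).
Proof.
move=> pA pB; have pAh u := oppow_posinv pA u; have pBh u := oppow_posinv pB u.
pose M := oppow A (- 2^-1) \o B \o oppow A (- 2^-1).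
pose L := oppow B (- 2^-1) \o A \o oppow B (- 2^-1).
pose N := oppow B 2^-1 \o oppow A (- 1) \o oppow B 2^-1.
have pM : posinv M by exact: posinv_conj.
have pL : posinv L by exact: posinv_conj.
have pN : posinv N by exact: posinv_conj.
have NL x : N (L x) = x.
  by rewrite /N /L /= oppowK // oppow_op // addNr oppow0 // oppowK.
have LE : L = oppow N (- 1) by exact: posinv_inverse_unique.
pose Y := oppow A (- 2^-1) \o oppow B 2^-1.
have bY : bounded_op Y by apply: bounded_comp; exact: posinv_bounded.
have YN x : Y (N x) = M (Y x).
  rewrite /Y /N /M /= oppow_half2 //; congr (oppow A _ (B _)).
  by rewrite oppowD //; congr (oppow A _ _); lra.
have YNs x : Y (oppow N s x) = oppow M s (Y x).
  by apply: pfcalc_intertwine => //; exact: cont_powR.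
apply/funext => x; rewrite /sandwich /= -/M -/L.
have -> : oppow A 2^-1 x = Y (oppow B (- 2^-1) (A x)).
  rewrite /Y /= oppowK // oppow_op //; congr (oppow A _ _); lra.
rewrite -YNs /Y /= oppowK //; congr (oppow B _ _).
have -> : oppow B (- 2^-1) (A x) = L (oppow B 2^-1 x) by rewrite /L /= oppowNK.
rewrite {1}LE oppowD // LE oppowM //; congr (oppow N _ _); lra.
Qed.

Definition op_le A B := forall x, ip (A x) x <= ip (B x) x.

(** Loewner-Heinz for a single exponent, so that the set of admissible exponents can be bisected. *)
Definition power_monotone (s : R) := forall A B, posinv A -> posinv B ->
  op_le A B -> op_le (oppow A s) (oppow B s).

Lemma op_le_conj S A B : selfadj S -> op_le A B -> op_le (S \o A \o S) (S \o B \o S).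
Proof. by move=> [_ sS] AB x; rewrite /= !sS; exact: AB. Qed.

Lemma sandwich_le A B B' (s : R) : power_monotone s -> posinv A -> posinv B ->
  posinv B' -> op_le B B' -> op_le (sandwich A B s) (sandwich A B' s).
Proof.
move=> ms pA pB pB' BB'; have sAh u := posinv_selfadj (oppow_posinv pA u).
apply: op_le_conj => //; apply: ms.
- by apply: posinv_conj => //; exact: oppow_posinv.
- by apply: posinv_conj => //; exact: oppow_posinv.
- exact: op_le_conj.
Qed.

Lemma power_monotone_half : power_monotone 2^-1.
Proof.
move=> A B pA pB AB; apply: square_root_le; try exact: oppow_posinv.
by move=> x; rewrite !oppow_half2.
Qed.

(** On commuting powers the geometric mean averages the exponents, which is how midpoints enter. *)
Lemma sandwich_oppow A (s t : R) : posinv A ->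
  sandwich (oppow A s) (oppow A t) 2^-1 = oppow A ((s + t) / 2).
Proof.
move=> pA; apply/funext => x; rewrite /sandwich /=.
have -> : oppow (oppow A s) (- 2^-1) \o oppow A t \o oppow (oppow A s) (- 2^-1) =
    oppow A (t - s).
  apply/funext => y; rewrite /= !oppowM // !oppowD //; congr (oppow A _ _); lra.
rewrite !oppowM // !oppowD //; congr (oppow A _ _); lra.
Qed.

(** One argument of A^s # A^t is enlarged at a time: the second directly, the first after
    [sandwich_transpose], which preserves the weight 1/2. *)
Lemma power_monotone_midpoint (s t : R) : power_monotone s -> power_monotone t ->
  power_monotone ((s + t) / 2).
Proof.
move=> ms mt A B pA pB AB x; rewrite -(sandwich_oppow s t pA) -(sandwich_oppow s t pB).
have pAp u := oppow_posinv pA u; have pBp u := oppow_posinv pB u.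
apply: le_trans (sandwich_le power_monotone_half (pAp s) (pAp t) (pBp t) _ x) _.
  exact: mt.
have half : 1 - 2^-1 = 2^-1 :> R by lra.
rewrite (sandwich_transpose _ (pAp s) (pBp t)) (sandwich_transpose _ (pBp s) (pBp t)) half.
by apply: sandwich_le => //; [exact: power_monotone_half | exact: ms].
Qed.

Lemma power_monotone_below (s d : R) : 0 <= s <= 1 -> 0 < d ->
  exists u, power_monotone u /\ u <= s <= u + d.
Proof.
move=> s01 d0.
have step n : exists u v, [/\ power_monotone u, power_monotone v, u <= s <= v &
    v - u <= 1 / 2 ^+ n].
  elim: n => [|n [u [v [mu mv /andP[us sv] vu]]]].
    exists 0, 1; split=> //.
    - by move=> A B pA pB AB x; rewrite !oppow0.
    - by move=> A B pA pB AB x; rewrite !oppow1.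
    - by rewrite expr0; lra.
  have mm := power_monotone_midpoint mu mv.
  have e : 1 / 2 ^+ n.+1 = (1 / 2 ^+ n) / 2 :> R by rewrite exprS; field.
  have [sm|ms] := leP s ((u + v) / 2).
    exists u, ((u + v) / 2); split=> //; first by rewrite us.
    by rewrite e; lra.
  exists ((u + v) / 2), v; split=> //; first by rewrite (ltW ms).
  by rewrite e; lra.
have h2 : 0 <= (2^-1 : R) < 1 by apply/andP; split; lra.
have [N hN] := geometric_small 1 h2 d0.
have [u [v [mu _ /andP[us sv] vu]]] := step N.
exists u; split=> //; rewrite us /=.
have := hN N (leqnn _); rewrite mulr1 exprVn => h3.
rewrite div1r in vu; lra.
Qed.

Lemma powR_near1 (a b e : R) : 0 < a -> 0 < e ->
  exists2 d, 0 < d & forall w t, 0 <= w <= d -> a <= t <= b ->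
    t `^ w <= 1 + e /\ t `^ (- w) <= 1 + e.
Proof.
move=> a0 e0; pose M := Num.max 1 (Num.max b a^-1).
have M1 : 1 <= M by rewrite le_max lexx.
have Mb : b <= M by rewrite !le_max lexx orbT.
have Ma : a^-1 <= M by rewrite !le_max lexx !orbT.
have M0 : 0 < M := lt_le_trans ltr01 M1.
have lM : 0 <= ln M by rewrite ln_ge0.
have le0 : 0 < ln (1 + e) by rewrite ln_gt0 // ltrDl.
exists (ln (1 + e) / (ln M + 1)); first by rewrite divr_gt0 // ltr_wpDl.
move=> w t /andP[w0 wd] /andP[ta tb]; have t0 : 0 < t := lt_le_trans a0 ta.
have Mw : M `^ w <= 1 + e.
  rewrite /powR gt_eqF // -(@lnK _ (1 + e)); last by rewrite posrE; lra.
  rewrite ler_expR; apply: (@le_trans _ _ (w * (ln M + 1))).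
    by rewrite ler_wpM2l // lerDl.
  by rewrite -ler_pdivlMr // ltr_wpDl.
split; last rewrite powRN -powR_inv1 ?powR_ge0 // powRAC powR_inv1 ?(ltW t0) //.
  apply: le_trans Mw; apply: ge0_ler_powR; rewrite ?nnegrE ?(ltW t0) ?(ltW M0) //.
  exact: le_trans Mb.
apply: le_trans Mw; apply: ge0_ler_powR; rewrite ?nnegrE ?invr_ge0 ?(ltW t0) ?(ltW M0) //.
by apply: le_trans Ma; rewrite lef_pV2 ?posrE.
Qed.

Lemma lowner_heinz (s : R) : 0 <= s <= 1 -> power_monotone s.
Proof.
move=> s01 A B [a [b pA0]] [a' [b' pB0]] AB x.
have [a0 _ _] := pA0; have [a'0 _ _] := pB0.
pose l := Num.min a a'; pose m := Num.max b b'.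
have pA : posint l m A.
  by apply: posint_widen pA0; rewrite ?lt_min ?a0 ?ge_min ?le_max ?lexx.
have pB : posint l m B.
  by apply: posint_widen pB0; rewrite ?lt_min ?a0 ?ge_min ?le_max ?lexx ?orbT.
have l0 : 0 < l by rewrite lt_min a0.
have posA : posinv A by exists l, m.
have posB : posinv B by exists l, m.
have cZ (c u : R) : cont_pos (fun t => c * t `^ u).
  exact: contM (@cont_cst c) (@cont_powR u).
have key (e : R) : 0 < e -> ip (oppow A s x) x <= (1 + e) * ((1 + e) * ip (oppow B s x) x).
  move=> e0; have [d d0 hd] := powR_near1 m l0 e0.
  have [u [mu /andP[us sud]]] := power_monotone_below s01 d0.
  have w0 : 0 <= s - u <= d by apply/andP; split; lra.
  have h1 : ip (oppow A s x) x <= (1 + e) * ip (oppow A u x) x.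
    rewrite -ipZl -[_ *: oppow A u x]pfcalcZ //; last exact: cont_powR.
    apply: (fcalc_le pA (@cont_powR s) (cZ _ _)) => t tlm.
    have [h _] := hd _ _ w0 tlm; have t0 : 0 < t := lt_le_trans l0 (proj1 (andP tlm)).
    have -> : t `^ s = t `^ (s - u) * t `^ u.
      by rewrite -powRD ?(gt_eqF t0) ?implybT // subrK.
    by rewrite ler_wpM2r ?powR_ge0.
  have h2 : ip (oppow B u x) x <= (1 + e) * ip (oppow B s x) x.
    rewrite -ipZl -[_ *: oppow B s x]pfcalcZ //; last exact: cont_powR.
    apply: (fcalc_le pB (@cont_powR u) (cZ _ _)) => t tlm.
    have [_ h] := hd _ _ w0 tlm; have t0 : 0 < t := lt_le_trans l0 (proj1 (andP tlm)).
    have -> : t `^ u = t `^ (- (s - u)) * t `^ s.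
      by rewrite -powRD ?(gt_eqF t0) ?implybT // opprB subrK.
    by rewrite ler_wpM2r ?powR_ge0.
  apply: le_trans h1 _; rewrite ler_wpM2l //; first lra.
  by apply: le_trans h2; exact: mu.
have Bs0 := posinv_ge0 (oppow_posinv posB s) x; set v := ip _ x in Bs0 *.
apply/ler_addgt0Pr => e e0.
pose c := Num.min 1 (e / (3 * (v + 1))).
have v1 : 0 < 3 * (v + 1) by lra.
have c0 : 0 < c by rewrite lt_min ltr01 divr_gt0.
have c1 : c <= 1 by rewrite ge_min lexx.
have ce : c * (3 * (v + 1)) <= e by rewrite -ler_pdivlMr // ge_min lexx orbT.
apply: le_trans (key c c0) _; rewrite -/v.
have : c * c <= c by nra.
nra.
Qed.

(** * Operator means *)

Lemma ip_sumr (I : Type) (r : seq I) (P : pred I) (F : I -> H) x :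
  ip x (\sum_(i <- r | P i) F i) = \sum_(i <- r | P i) ip x (F i).
Proof.
by elim/big_rec2: _ => [|i y z _ <-]; [exact: ip0r | rewrite ipDr].
Qed.

Lemma bern_centered (a b : R) n : a < b ->
  \sum_(i < n.+2) bern a b n i * ((bnode a b n i)%:P - 'X) = 0.
Proof.
move=> ab; under eq_bigr do rewrite mulrBr mulrC mul_polyC.
by rewrite sumrB bern_mean // -mulr_suml bern_total // mul1r subrr.
Qed.

Lemma bern_centered_node (a b : R) n : a < b ->
  \sum_(i < n.+2) bnode a b n i *: (bern a b n i * ((bnode a b n i)%:P - 'X)) =
  n.+1%:R^-1 *: (('X - a%:P) * (b%:P - 'X)).
Proof.
move=> ab; have E := congr1 (fun p => 'X * p) (bern_centered n ab).
rewrite mulr0 in E; rewrite -bern_variance // -[LHS]subr0 -[X in _ - X]E.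
rewrite mulr_sumr -sumrB; apply: eq_bigr => i _.
rewrite -mul_polyC; ring.
Qed.

(* Bernstein polynomials C_i of K with nodes a_i: the nonnegative numbers
   <M y_i, C_i y_i> for y_i = (a_i - K) x + s w sum up to
   s <(K M - M K) x, w> + O(s^2) + O(1/n), whence K M = M K. *)
Lemma commute_of_positivity (a b : R) M K : a < b -> selfadj M -> opint a b K ->
  (forall p, (forall x, 0 <= ip (op_horner p K x) x) ->
     forall x, 0 <= ip (M x) (op_horner p K x)) ->
  forall x, M (K x) = K (M x).
Proof.
move=> ab [bM sM] oK pos x; have [sK hK] := oK; have [bK sK'] := sK.
apply: (@eq_ip) => w; apply/eqP; rewrite -subr_eq0; apply/eqP.
set g := _ - _; pose h := ip (M w) w.
pose V := op_horner (('X - a%:P) * (b%:P - 'X)) K.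
have key (n : nat) (s : R) : 0 <= n.+1%:R^-1 * ip (M x) (V x) - s * g + s ^+ 2 * h.
  pose A i := bnode a b n i; pose C i := op_horner (bern a b n i) K.
  have bC i : bounded_op (C i) := (op_horner_selfadj _ sK).1.
  pose z i := (A i)%:C *: x - K x.
  pose y i := z i + s%:C *: w.
  have Cz i : C i (z i) = op_horner (bern a b n i * ((A i)%:P - 'X)) K x.
    by rewrite op_hornerM // op_hornerB op_hornerC op_hornerX.
  have Cpos i : 0 <= ip (M (y i)) (C i (y i)).
    apply: pos => u; apply: op_horner_ge0 => // t /(real_spectrum_opint oK) tab.
    exact: bern_ge0.
  have sum0 : \sum_(i < n.+2) C i (z i) = 0.
    under eq_bigr do rewrite Cz.
    by rewrite -op_horner_sum bern_centered // op_horner0.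
  have sumA : \sum_(i < n.+2) (A i)%:C *: C i (z i) = n.+1%:R^-1%:C *: V x.
    under eq_bigr do rewrite Cz -op_hornerZ.
    by rewrite -op_horner_sum bern_centered_node // op_hornerZ.
  have sumC u : \sum_(i < n.+2) C i u = u.
    by rewrite -op_horner_sum bern_total // op_horner1.
  have sumAC u : \sum_(i < n.+2) (A i)%:C *: C i u = K u.
    under eq_bigr do rewrite -op_hornerZ.
    by rewrite -op_horner_sum bern_mean // op_hornerX.
  have E i : ip (M (y i)) (C i (y i)) =
      ip (M x) ((A i)%:C *: C i (z i)) - ip (M (K x)) (C i (z i)) +
      s * (ip (M x) ((A i)%:C *: C i w) - ip (M (K x)) (C i w)) +
      s * ip (M w) (C i (z i)) + s ^+ 2 * ip (M w) (C i w).
    rewrite /y (opD _ _ (bC i)) (opZ _ _ (bC i)) (opD _ _ bM) (opZ _ _ bM).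
    rewrite {1}/z (opB _ _ bM) (opZ _ _ bM) !ipE; ring.
  have : 0 <= \sum_(i < n.+2) ip (M (y i)) (C i (y i)) by exact: sumr_ge0.
  under eq_bigr do rewrite E.
  rewrite !big_split /= !sumrN -!mulr_sumr !big_split /= !sumrN -!ip_sumr.
  rewrite sum0 sumA sumC sumAC !ip0r ipZr -(sK' (M x) w) -/h => hh.
  by move: hh; rewrite /g; move: (_ * ip (M x) (V x)) => k hh; lra.
have key2 (s : R) : 0 <= - s * g + s ^+ 2 * h.
  apply/ler_addgt0Pr => e e0; have [n hn] := archi_small (ip (M x) (V x)) e0.
  have := key n s; rewrite mulrC; move: hn; set v := _ / _; lra.
pose d := `|h| + 1; have d0 : 0 < d by rewrite ltr_wpDl.
have hd : h <= d - 1 by rewrite /d addrK ler_norm.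
pose u := g / d; have gE : g = u * d by rewrite divfK // gt_eqF.
have := key2 u; rewrite gE => hu.
have u0 : u ^+ 2 <= 0 by have := ler_wpM2l (sqr_ge0 u) hd; lra.
have /eqP : u ^+ 2 == 0 by rewrite eq_le u0 sqr_ge0.
by move/eqP; rewrite sqrf_eq0 => /eqP ->; rewrite mul0r.
Qed.

Lemma cont_sqrt_horner p : cont_pos (fun t => Num.sqrt p.[t]).
Proof.
by move=> t _; apply: continuous_comp; [exact: continuous_horner | exact: sqrt_continuous].
Qed.

Lemma form_le_of_quadratic (a b : R) N T (e k : R) : posint a b T -> selfadj N ->
  (forall x, N (T x) = T (N x)) -> 0 <= k ->
  (forall c x, a <= c <= b ->
     ip (N x) x <= e * ip x x + k * ip (T x - c%:C *: x) (T x - c%:C *: x)) ->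
  forall x, ip (N x) x <= e * ip x x.
Proof.
move=> pT [bN sN] NT k0 hN x; have [a0 ab oT] := pT; have [[bT sT] _] := oT.
pose V := op_horner (('X - a%:P) * (b%:P - 'X)) T.
suff key (n : nat) : ip (N x) x <= e * ip x x + k * ip x (V x) / n.+1%:R.
  apply/ler_addgt0Pr => d d0; have [n hn] := archi_small (k * ip x (V x)) d0.
  by apply: le_trans (key n) _; rewrite lerD2l.
pose A i := bnode a b n i; pose C i := op_horner (bern a b n i) T.
pose r i := fun t => Num.sqrt (bern a b n i).[t].
have cr i : cont_pos (r i) by exact: cont_sqrt_horner.
pose S i := fcalc (r i) T.
have sS i : selfadj (S i) by exact: (fcalc_selfadj pT).
have bS i : bounded_op (S i) := (sS i).1.
have SS i y : S i (S i y) = C i y.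
  rewrite /S -(fcalcM pT) // (fcalc_poly pT (p := bern a b n i)) //.
    exact: contM.
  by move=> t tab; rewrite -expr2 sqr_sqrtr // bern_ge0.
have NS i y : N (S i y) = S i (N y).
  exact: esym (fcalc_comm y pT bN (cr i) (fun z => esym (NT z))).
have TS i y : T (S i y) = S i (T y).
  exact: esym (fcalc_comm y pT bT (cr i) (fun z => erefl)).
have sumC u : \sum_(i < n.+2) C i u = u.
  by rewrite -op_horner_sum bern_total // op_horner1.
have step i : a <= A i <= b -> ip (N x) (C i x) <=
    e * ip x (C i x) + k * ip x (op_horner (bern a b n i * ('X - (A i)%:P) ^+ 2) T x).
  move=> Aab; have := hN (A i) (S i x) Aab.
  rewrite NS TS -(opZ _ _ (bS i)) -(opB _ _ (bS i)) !(sS i).2 !SS.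
  have [bQ sQ] := op_horner_selfadj ('X - (A i)%:P) (proj1 oT).
  have -> : T x - (A i)%:C *: x = op_horner ('X - (A i)%:P) T x.
    by rewrite op_hornerB op_hornerX op_hornerC.
  rewrite sQ /C -!op_hornerM // -/(C i).
  by have -> : ('X - (A i)%:P) * bern a b n i * ('X - (A i)%:P) =
    bern a b n i * ('X - (A i)%:P) ^+ 2 by ring.
have : \sum_(i < n.+2) ip (N x) (C i x) <= \sum_(i < n.+2) (e * ip x (C i x) +
     k * ip x (op_horner (bern a b n i * ('X - (A i)%:P) ^+ 2) T x)).
  by apply: ler_sum => i _; apply: step; exact: bnode_itv.
rewrite big_split /= -!mulr_sumr -!ip_sumr !sumC -op_horner_sum bern_variance //.
rewrite op_hornerZ ipZr -/V => h; apply: le_trans h _.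
by rewrite lerD2l mulrCA mulrC.
Qed.

Lemma posinv_posop A : posinv A -> posop dot A.
Proof.
by move=> pA; apply/posopP; split; [exact: posinv_selfadj | exact: posinv_ge0].
Qed.

Lemma posop_selfadj A : posop dot A -> selfadj A.
Proof. by move=> /posopP[]. Qed.

Lemma posop_ge0 A x : posop dot A -> 0 <= ip (A x) x.
Proof. by move=> /posopP[]. Qed.

Lemma posop_conj A S : posop dot A -> selfadj S -> posop dot (S \o A \o S).
Proof.
move=> /posopP[sA A0] sS; apply/posopP; split; first exact: selfadj_conj.
by move=> x; rewrite /= sS.2.
Qed.

Lemma leop_form A B : leop dot A B -> forall x, ip (A x) x <= ip (B x) x.
Proof. by move=> /posopP[_ h] x; have := h x; rewrite /= !ipE subr_ge0. Qed.

Lemma leop_posop A B : posop dot A -> posop dot B -> op_le A B -> leop dot A B.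
Proof. by move=> pA pB AB; apply/leopP => //; exact: posop_selfadj. Qed.

Lemma op_le_eq A B : selfadj A -> selfadj B -> op_le A B -> op_le B A -> A = B.
Proof. by move=> sA sB AB BA; apply: selfadj_eq => // x; apply/le_anti; rewrite AB BA. Qed.

Variable tau : (H -> H) -> (H -> H) -> (H -> H).
Hypothesis tau_mean : operator_mean dot tau.

Lemma tau_pos A B : posop dot A -> posop dot B -> posop dot (tau A B).
Proof. exact: (om_pos tau_mean). Qed.

Lemma tau_le A B C D : posop dot A -> posop dot B -> posop dot C -> posop dot D ->
  op_le A C -> op_le B D -> op_le (tau A B) (tau C D).
Proof.
move=> pA pB pC pD AC BD; apply: leop_form.
by apply: (om_mono tau_mean) => //; exact: leop_posop.
Qed.

Lemma tau_conj_le A B C : posop dot A -> posop dot B -> posop dot C ->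
  op_le (C \o tau A B \o C) (tau (C \o A \o C) (C \o B \o C)).
Proof. by move=> pA pB pC; apply: leop_form; exact: (om_transformer tau_mean). Qed.

Lemma tau_conj A B C : posop dot A -> posop dot B -> posinv C ->
  C \o tau A B \o C = tau (C \o A \o C) (C \o B \o C).
Proof.
move=> pA pB pC; have sC := posinv_selfadj pC.
have pCA := posop_conj pA sC; have pCB := posop_conj pB sC.
apply: op_le_eq.
- by apply: posop_selfadj; apply: posop_conj => //; exact: tau_pos.
- by apply: posop_selfadj; exact: tau_pos.
- by apply: tau_conj_le => //; exact: posinv_posop.
pose D := oppow C (- 1); have pD : posinv D by exact: oppow_posinv.
have CD x : C (D x) = x by rewrite -{1}(oppow1 pC) oppowK.
have DC x : D (C x) = x by rewrite /D oppow_op // addNr oppow0.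
have back A' : D \o (C \o A' \o C) \o D = A'.
  by apply/funext => x; rewrite /= CD DC.
move=> x; have := tau_conj_le pCA pCB (posinv_posop pD) (C x).
by rewrite !back /= !(posinv_selfadj pD).2 !sC.2 !DC.
Qed.

Lemma posop_id : posop dot (idfun : H -> H).
Proof. by apply/posopP; split; [exact: selfadj_id | move=> x; exact: ip_ge0]. Qed.

(* With C = I - L/m one has C T C <= T, so C (I tau T) C <= C^2 tau C T C <= I tau T. *)
Lemma tau_id_positivity T L x : posinv T -> posop dot L ->
  (forall y, T (L y) = L (T y)) -> 0 <= ip (tau idfun T x) (L x).
Proof.
move=> pT /posopP[sL L0] TL; have [bL sL'] := sL.
have [m m0 hm] := bounded_form bL.
pose C := (idfun : H -> H) \- m^-1%:C \*: L.
have sC : selfadj C by exact: (selfadj_sub selfadj_id (selfadj_scale _ sL)).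
have [bC sC'] := sC.
have C0 y : 0 <= ip (C y) y <= 1 * ip y y.
  rewrite /C /= !ipE; have /andP[_ h] := hm y; have h0 := L0 y.
  have h1 : m^-1 * ip (L y) y <= ip y y by rewrite ler_pdivrMl.
  have h2 : 0 <= m^-1 * ip (L y) y by rewrite mulr_ge0 // invr_ge0 ltW.
  by apply/andP; split; lra.
have CC y : ip (C y) (C y) <= ip y y.
  by rewrite (le_trans (pos_norm_le sC ltr01 C0 y)) // mul1r; have /andP[_] := C0 y; rewrite mul1r.
have pC : posop dot C by apply/posopP; split=> // y; case/andP: (C0 y).
have pTo := posinv_posop pT.
have TC y : T (C y) = C (T y).
  by rewrite /C /= (opB _ _ (posinv_bounded pT)) (opZ _ _ (posinv_bounded pT)) TL.
have leT : op_le (C \o T \o C) T.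
  move=> y; pose S := oppow T 2^-1.
  have [bS sS] : selfadj S := posinv_selfadj (oppow_posinv pT _).
  have SC z : S (C z) = C (S z) by apply: pfcalc_comm => //; exact: cont_powR.
  have TS z : ip (T z) z = ip (S z) (S z) by rewrite -sS /S oppow_half2.
  have -> : ip ((C \o T \o C) y) y = ip (T (C y)) (C y) by rewrite -sC'.
  by rewrite !TS SC; exact: CC.
have le1 : op_le (C \o idfun \o C) idfun by move=> y; rewrite /= sC'; exact: CC.
have pM : posop dot (tau idfun T) by apply: tau_pos => //; exact: posop_id.
have := tau_conj_le posop_id pTo pC x.
have := tau_le (posop_conj posop_id sC) (posop_conj pTo sC) posop_id pTo le1 leT x.
have [bM sM] := posop_selfadj pM.
move=> h1 h2; have {h1 h2} := le_trans h2 h1.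
have LM := posop_ge0 (L x) pM.
have -> : ip ((C \o tau idfun T \o C) x) x = ip (tau idfun T (C x)) (C x).
  by rewrite -sC'.
set M := tau idfun T in bM sM LM *; move=> h.
have e1 : ip (M (C x)) (C x) = ip (M x) x - 2 * (m^-1 * ip (M x) (L x)) +
    m^-1 * (m^-1 * ip (M (L x)) (L x)).
  rewrite /C /= (opB _ _ bM) (opZ _ _ bM) !ipE (sM (L x) x) (ipC (L x)); ring.
have h2 : 0 <= m^-1 * (m^-1 * ip (M (L x)) (L x)).
  by rewrite !mulr_ge0 // invr_ge0 ltW.
have im : 0 < m^-1 by rewrite invr_gt0.
by rewrite -(pmulr_rge0 _ im); lra.
Qed.

Lemma tau_id_commute T x : posinv T -> tau idfun T (T x) = T (tau idfun T x).
Proof.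
move=> pT; have [a [b [a0 ab oT]]] := pT; have [[bT _] _] := oT.
have sM : selfadj (tau idfun T).
  by apply/posop_selfadj/tau_pos; [exact: posop_id | exact: posinv_posop].
apply: (commute_of_positivity ab sM oT) => p p0 y.
apply: tau_id_positivity => // [|z].
  by apply/posopP; split=> //; exact: op_horner_selfadj oT.1.
by rewrite (op_horner_comm p z bT bT).
Qed.

Definition rank_one (y : H) : H -> H := fun z => dot z y *: y.
Lemma rank_one_form y z : ip (rank_one y z) z = ip z y ^+ 2 + ip z ('i *: y) ^+ 2.
Proof.
rewrite /rank_one /ip linearZl_LR /= (dotC y z) dotE /=.
simpc => /=; rewrite -/(ip z ('i *: y)); ring.
Qed.

Lemma rank_one_posop y : posop dot (rank_one y).
Proof.
apply/posopP; split; last first.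
  by move=> x; rewrite rank_one_form addr_ge0 ?sqr_ge0.
split; last first.
  move=> x z; rewrite /rank_one /ip linearZl_LR linearZr_LR /= (dotC y z).
  by rewrite mulrC.
apply/bounded_opP; split.
  by move=> c x z; rewrite /rank_one linearDl linearZl_LR /= scalerDl scalerA.
exists (2 * ip y y) => [|x]; first by rewrite mulr_ge0 ?ip_ge0.
have h1 := cauchy_schwarz x y; have h2 := cauchy_schwarz x ('i *: y).
have e1 : ip ('i *: y) ('i *: y) = ip y y.
  rewrite ip_scale normc_def /= expr0n expr1n add0r sqrtr1 expr1n mul1r //.
rewrite e1 in h2.
have e2 : ip (rank_one y x) (rank_one y x) =
    (ip x y ^+ 2 + ip x ('i *: y) ^+ 2) * ip y y.
  rewrite /rank_one ip_scale dotE normc_def /= sqr_sqrtr //.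
  by rewrite addr_ge0 ?sqr_ge0.
rewrite e2; have y0 := ip_ge0 y; have x0 := ip_ge0 x.
apply: le_trans (ler_wpM2r y0 (lerD h1 h2)) _.
have : 0 <= ip x x * (ip y y * ip y y) by rewrite !mulr_ge0.
lra.
Qed.

Lemma posinv_scalar (c : R) : 0 < c -> posinv (c%:C \*: (idfun : H -> H)).
Proof.
move=> c0; exists c, (c + 1); split=> //; first lra.
split=> [|x]; first exact: selfadj_scale selfadj_id.
by rewrite /= ipZl lexx /= ler_wpM2r ?ip_ge0 //; lra.
Qed.

(* I tau (x I) commutes with every rank-one operator, hence is scalar. *)
Lemma repfun_spec (x : R) : 0 < x ->
  tau idfun (x%:C \*: idfun) = (repfun tau x)%:C \*: idfun.
Proof.
move=> x0; have pX := posinv_scalar x0; have pXo := posinv_posop pX.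
set M := tau _ _.
have pM : posop dot M := tau_pos posop_id pXo.
have [bM sM] := posop_selfadj pM.
have comm y z : dot z y *: M y = dot (M z) y *: y.
  rewrite -(opZ _ _ bM).
  have [sE E0] := (posopP _).1 (rank_one_posop y).
  have [m m0 hm] := bounded_form sE.1.
  have oE : opint (- m) m (rank_one y).
    by split=> // u; rewrite mulNr; exact: hm.
  have mm : - m < m by lra.
  have := @commute_of_positivity _ _ M (rank_one y) mm (conj bM sM) oE _ z.
  apply=> p p0 u; apply: (tau_id_positivity u pX).
    by apply/posopP; split=> //; exact: op_horner_selfadj sE.
  by move=> v; rewrite /= (opZ _ _ (op_horner_selfadj p sE).1).
have [e e1] := exists_unit.
have ee : dot e e = 1 by rewrite dot_self e1 rmorph1.
pose l := ip (M e) e.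
have Me : M e = l%:C *: e.
  by have := comm e e; rewrite ee scale1r (selfadj_form_real _ (conj bM sM)).
have My y : dot e y != 0 -> M y = l%:C *: y.
  move=> ey; have := comm y e; rewrite Me linearZl_LR /= -scalerA.
  move/(congr1 (fun u => (dot e y)^-1 *: u)).
  by rewrite !scalerA mulVf // scale1r mulrCA mulVf // mulr1.
have Mall y : M y = l%:C *: y.
  have [ey|/My//] := eqVneq (dot e y) 0.
  have : M (y + e) = l%:C *: (y + e).
    by apply: My; rewrite linearDr /= ey ee add0r oner_eq0.
  by rewrite (opD _ _ bM) Me scalerDr => /addIr.
have ME : M = l%:C \*: idfun by apply/funext.
rewrite /repfun; case: xgetP => [v _ //|/(_ l)/(_ ME) //].
Qed.

Lemma repfun_form (x : R) y : 0 < x ->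
  ip (tau idfun (x%:C \*: idfun) y) y = repfun tau x * ip y y.
Proof. by move=> x0; rewrite repfun_spec //= ipZl. Qed.

Lemma repfun_le (u v c : R) : 0 < u -> 0 < v -> 1 <= c -> u <= c * v ->
  repfun tau u <= c * repfun tau v.
Proof.
move=> u0 v0 c1 ucv; have [e e1] := exists_unit; have c0 : 0 < c by lra.
have r0 : 0 < Num.sqrt c by rewrite sqrtr_gt0.
have r2 : Num.sqrt c * Num.sqrt c = c by rewrite -expr2 sqr_sqrtr // ltW.
pose C := (Num.sqrt c)%:C \*: (idfun : H -> H).
have pC : posinv C by exact: posinv_scalar.
have pV := posinv_posop (posinv_scalar v0).
have [bS sS] := posinv_selfadj pC.
have h := congr1 (fun F : H -> H => ip (F e) e) (tau_conj posop_id pV pC).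
have pU := posinv_posop (posinv_scalar u0).
have le1 : op_le idfun (C \o idfun \o C).
  by move=> y; rewrite /= ipZl ipZl mulrA r2 ler_peMl ?ip_ge0.
have le2 : op_le (u%:C \*: idfun) (C \o (v%:C \*: idfun) \o C).
  move=> y; rewrite /= !ipZl; have y0 := ip_ge0 y.
  have -> : Num.sqrt c * (v * (Num.sqrt c * ip y y)) = c * v * ip y y.
    by rewrite -[in RHS]r2; ring.
  by rewrite ler_wpM2r.
have := tau_le posop_id pU (posop_conj posop_id (conj bS sS))
  (posop_conj pV (conj bS sS)) le1 le2 e.
rewrite -h repfun_form // e1 mulr1 => h1; apply: le_trans h1 _.
by rewrite repfun_spec //= !ipZl e1 mulr1 mulrCA r2 mulrC.
Qed.

Lemma repfun1 : repfun tau 1 = 1.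
Proof.
have [e e1] := exists_unit; have := repfun_form e ltr01.
have -> : 1%:C \*: (idfun : H -> H) = idfun.
  by apply/funext => y /=; rewrite rmorph1 scale1r.
by rewrite (om_id tau_mean) /= e1 mulr1.
Qed.

Lemma repfun_gt0 (x : R) : 0 < x -> 0 < repfun tau x.
Proof.
move=> x0; have c1 : 1 <= Num.max 1 x^-1 by rewrite le_max lexx.
have := repfun_le ltr01 x0 c1; rewrite repfun1 => h.
have c0 : 0 < Num.max 1 x^-1 := lt_le_trans ltr01 c1.
rewrite -(pmulr_rgt0 _ c0); apply: lt_le_trans ltr01 _; apply: h.
by rewrite -ler_pdivrMr // div1r le_max lexx orbT.
Qed.

Lemma repfun_upper (a t : R) : 0 < a -> 0 < t ->
  repfun tau t <= repfun tau a * (1 + `|t / a - 1|).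
Proof.
move=> a0 t0; rewrite mulrC; apply: repfun_le => //.
  by rewrite lerDl.
rewrite -ler_pdivrMr //; have := ler_norm (t / a - 1); lra.
Qed.

Lemma repfun_lipschitz (l a t : R) : 0 < l -> l <= a -> l <= t -> a <= t ->
  0 <= repfun tau t - repfun tau a <= repfun tau a / l * (t - a).
Proof.
move=> l0 la lt at_; have a0 : 0 < a := lt_le_trans l0 la.
have t0 : 0 < t := lt_le_trans l0 lt.
rewrite subr_ge0; apply/andP; split.
  by rewrite (le_trans (repfun_le a0 t0 (lexx 1) _)) ?mul1r.
have h := repfun_upper a0 t0.
have e : t / a - 1 = (t - a) / a by rewrite mulrBl divff // gt_eqF.
rewrite e ger0_norm in h; last by rewrite divr_ge0 ?subr_ge0 // ltW.
have f0 := repfun_gt0 a0.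
have h2 : (t - a) / a <= (t - a) / l.
  by rewrite ler_wpM2l ?subr_ge0 // lef_pV2 ?posrE.
have h3 := ler_wpM2l (ltW f0) h2.
rewrite mulrAC -mulrA; move: h h3; move: (_ / a) (_ / l) => p q; lra.
Qed.

Lemma repfun_lipschitz_norm (l b a t : R) : 0 < l -> l <= a <= b -> l <= t <= b ->
  `|repfun tau t - repfun tau a| <= repfun tau b / l * `|t - a|.
Proof.
move=> l0; wlog at_ : a t / a <= t.
  move=> W la lt; have [at_|ta] := leP a t; first exact: W.
  by rewrite distrC [`|t - a|]distrC; apply: W => //; exact: ltW.
move=> /andP[la ab] /andP[lt tb]; have a0 : 0 < a := lt_le_trans l0 la.
have b0 : 0 < b := lt_le_trans a0 ab.
have /andP[h0 h1] := repfun_lipschitz l0 la lt at_.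
rewrite ger0_norm // ger0_norm ?subr_ge0 //; apply: le_trans h1 _.
rewrite ler_wpM2r ?subr_ge0 // ler_wpM2r ?invr_ge0 ?(ltW l0) //.
by rewrite (le_trans (repfun_le a0 b0 (lexx 1) _)) ?mul1r.
Qed.

Lemma cont_repfun : cont_pos (repfun tau).
Proof.
move=> t t0; apply/cvgrPdist_le => e e0.
have l0 : 0 < t / 2 by rewrite divr_gt0.
pose K := repfun tau (2 * t) / (t / 2).
have K0 : 0 < K by rewrite divr_gt0 // repfun_gt0 // mulr_gt0.
have d0 : 0 < Num.min (t / 2) (e / K) by rewrite lt_min l0 divr_gt0.
apply/nbhs_ballP; exists (Num.min (t / 2) (e / K)) => //= u.
rewrite /ball_ /= lt_min => /andP[h1 h2].
have ht : t / 2 <= t <= 2 * t by apply/andP; split; lra.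
have hu : t / 2 <= u <= 2 * t.
  by move: h1; rewrite ltr_norml => /andP[? ?]; apply/andP; split; lra.
apply: le_trans (repfun_lipschitz_norm l0 hu ht) _.
by rewrite -/K mulrC -ler_pdivlMr // ltW.
Qed.

Lemma tau_scaled S (c : R) : posinv S -> 0 < c ->
  tau S (c%:C \*: S) = (repfun tau c)%:C \*: S.
Proof.
move=> pS c0; have pSh := oppow_posinv pS 2^-1; have bSh := posinv_bounded pSh.
have := tau_conj posop_id (posinv_posop (posinv_scalar c0)) pSh.
rewrite repfun_spec // => h; transitivity
  (tau (oppow S 2^-1 \o idfun \o oppow S 2^-1)
       (oppow S 2^-1 \o (c%:C \*: idfun) \o oppow S 2^-1)).
  congr tau; apply/funext => x; rewrite /= ?(opZ _ _ bSh) oppow_half2 //.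
by rewrite -h; apply/funext => x; rewrite /= (opZ _ _ bSh) oppow_half2.
Qed.

Lemma cont_norm f : cont_pos f -> cont_pos (fun t => `|f t|).
Proof.
by move=> cf t t0; apply: continuous_comp; [exact: cf | exact: norm_continuous].
Qed.

Lemma op_horner_quadratic_form T x (e k c : R) : selfadj T ->
  ip (op_horner (e%:P + k *: ('X - c%:P) ^+ 2) T x) x =
  e * ip x x + k * ip (T x - c%:C *: x) (T x - c%:C *: x).
Proof.
move=> sT; have [bT _] := sT; have [_ sQ] := op_horner_selfadj ('X - c%:P) sT.
have -> : T x - c%:C *: x = op_horner ('X - c%:P) T x.
  by rewrite op_hornerB op_hornerX op_hornerC.
by rewrite op_hornerD op_hornerC op_hornerZ expr2 op_hornerM // !ipE sQ.
Qed.

Lemma norm_div_sub1 (t c l : R) : 0 < l -> l <= c -> `|t / c - 1| <= `|t - c| / l.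
Proof.
move=> l0 lc; have c0 : 0 < c := lt_le_trans l0 lc.
have -> : t / c - 1 = (t - c) / c by rewrite mulrBl divff // gt_eqF.
by rewrite normrM normfV (gtr0_norm c0) ler_wpM2l // lef_pV2 ?posrE.
Qed.

Lemma amgm_absorb (L u e : R) : 0 < e -> 2 * (L * u) <= e + L ^+ 2 / e * u ^+ 2.
Proof.
move=> e0; have h : L ^+ 2 / e * u ^+ 2 = (L * u) ^+ 2 / e by rewrite exprMn mulrAC.
rewrite h -subr_ge0.
have -> : e + (L * u) ^+ 2 / e - 2 * (L * u) = (e - L * u) ^+ 2 / e.
  by field; rewrite gt_eqF.
by rewrite divr_ge0 ?sqr_ge0 // ltW.
Qed.

Lemma tau_id_fcalc T : posinv T -> tau idfun T = fcalc (repfun tau) T.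
Proof.
move=> pT; have [a [b pT0]] := pT; have [a0 ab oT] := pT0.
have [sT _] := oT; have [bT _] := sT.
have pTo := posinv_posop pT; have b0 : 0 < b := lt_trans a0 ab.
set f := repfun tau; have cf : cont_pos f := cont_repfun.
have f_gt0 t : 0 < t -> 0 < f t by exact: repfun_gt0.
have pM : posop dot (tau idfun T) by apply: tau_pos => //; exact: posop_id.
have sM := posop_selfadj pM; have sF := pfcalc_selfadj pT cf.
have MT x : tau idfun T (T x) = T (tau idfun T x) by exact: tau_id_commute.
have FT x : fcalc f T (T x) = T (fcalc f T x) by apply: pfcalc_comm.
pose L := f b / a; have L0 : 0 < L by rewrite divr_gt0 // f_gt0.
have lip c t : a <= c <= b -> a <= t <= b -> `|f t - f c| <= L * `|t - c|.
  by move=> hc ht; exact: repfun_lipschitz_norm.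
have fcL c u : a <= c <= b -> 0 <= u -> f c * (u / a) <= L * u.
  move=> /andP[ac cb] u0; rewrite /L [leRHS]mulrAC -mulrA ler_wpM2r ?divr_ge0 ?(ltW a0) //.
  have c0 : 0 < c := lt_le_trans a0 ac.
  by rewrite (le_trans (repfun_le c0 b0 (lexx 1) _)) ?mul1r.
have upper c : 0 < c -> op_le (tau idfun T)
    (fcalc (fun t => f c * (1 + `|t / c - 1|)) T).
  move=> c0; pose g t : R := 1 + `|t / c - 1|.
  have cg : cont_pos g.
    apply: contD; first exact: cont_cst.
    by apply: cont_norm; apply: contD (contM cont_id (@cont_cst _)) (@cont_cst _).
  have g0 t : 0 < t -> 0 < g t by rewrite /g ltr_pwDl.
  have pS := pfcalc_posinv pT cg g0; have pcS := posinv_posop pS.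
  have pcS' : posop dot (c%:C \*: fcalc g T).
    apply/posopP; split=> [|y]; first exact: (selfadj_scale _ (posinv_selfadj pS)).
    by rewrite /= ipZl mulr_ge0 ?(ltW c0) // posop_ge0.
  move=> x; rewrite pfcalcZ //.
  have -> : (f c)%:C *: fcalc g T x = tau (fcalc g T) (c%:C \*: fcalc g T) x.
    by rewrite tau_scaled.
  apply: tau_le => //; first exact: posop_id.
    move=> y; have := pfcalc_le pT (@cont_cst 1) cg _ y.
    rewrite pfcalc_cst // rmorph1 scale1r; apply=> t t0.
    by rewrite lerDl.
  move=> y; have := pfcalc_le pT cont_id (contM (@cont_cst c) cg) _ y.
  rewrite pfcalc_id // pfcalcZ //; apply=> t t0.
  rewrite mulrC -ler_pdivrMr //; have := ler_norm (t / c - 1); rewrite /g; lra.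
have lower c : 0 < c -> op_le
    (fcalc (fun t => f c * (1 + `|c / t - 1|)^-1) T) (tau idfun T).
  move=> c0; pose g t : R := (1 + `|c / t - 1|)^-1.
  have cg : cont_pos g.
    apply: (cont_comp _ cont_inv) => [|t t0]; last by rewrite ltr_pwDl.
    apply: contD; first exact: cont_cst.
    by apply: cont_norm; apply: contD (contM (@cont_cst _) cont_inv) (@cont_cst _).
  have g0 t : 0 < t -> 0 < g t by rewrite /g invr_gt0 ltr_pwDl.
  have pS := pfcalc_posinv pT cg g0; have pcS := posinv_posop pS.
  have pcS' : posop dot (c%:C \*: fcalc g T).
    apply/posopP; split=> [|y]; first exact: (selfadj_scale _ (posinv_selfadj pS)).
    by rewrite /= ipZl mulr_ge0 ?(ltW c0) // posop_ge0.
  move=> x; rewrite pfcalcZ //.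
  have -> : (f c)%:C *: fcalc g T x = tau (fcalc g T) (c%:C \*: fcalc g T) x.
    by rewrite tau_scaled.
  apply: tau_le => //; first exact: posop_id.
    move=> y; have := pfcalc_le pT cg (@cont_cst 1) _ y.
    rewrite pfcalc_cst // rmorph1 scale1r; apply=> t t0.
    by rewrite /g invf_le1 ?ltr_pwDl // lerDl.
  move=> y; have := pfcalc_le pT (contM (@cont_cst c) cg) cont_id _ y.
  rewrite pfcalc_id // pfcalcZ //; apply=> t t0.
  rewrite /g ler_pdivrMr ?ltr_pwDl // mulrC -ler_pdivrMr //.
  have := ler_norm (c / t - 1); lra.
have bound (e : R) : 0 < e -> op_le (tau idfun T \- fcalc f T) (e%:C \*: idfun) /\
    op_le (fcalc f T \- tau idfun T) (e%:C \*: idfun).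
  move=> e0; have k0 : 0 <= L ^+ 2 / e by rewrite divr_ge0 ?sqr_ge0 // ltW.
  have cp c : cont_pos (fun t => f t + (e%:P + (L ^+ 2 / e) *: ('X - c%:P) ^+ 2).[t]).
    exact: contD cf (@cont_horner _).
  have pE (c t : R) : (e%:P + (L ^+ 2 / e) *: ('X - c%:P) ^+ 2).[t] =
      e + L ^+ 2 / e * (t - c) ^+ 2.
    by rewrite hornerD hornerC hornerZ horner_exp hornerD hornerN hornerX hornerC.
  have absorb c t : 2 * (L * `|t - c|) <= e + L ^+ 2 / e * (t - c) ^+ 2.
    by have := amgm_absorb L `|t - c| e0; rewrite real_normK ?num_real.
  split=> x; rewrite /= ipZl.
    apply: (form_le_of_quadratic (e := e) pT0 (selfadj_sub sM sF) _ k0).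
      by move=> y; rewrite /= MT FT (opB _ _ bT).
    move=> c y hc; have [ac cb] := andP hc; have c0 : 0 < c := lt_le_trans a0 ac.
    rewrite -op_horner_quadratic_form //= ipDl ipNl lerBlDl.
    apply: le_trans (upper c c0 y) _.
    rewrite -ipDl -(fcalc_poly pT0 (@cont_horner _) (fun t _ => erefl)).
    rewrite -(fcalcD pT0) //; last exact: cont_horner.
    apply: (fcalc_le pT0) => // [|t ht].
      apply: contM; first exact: cont_cst.
      apply: contD; first exact: cont_cst.
      by apply: cont_norm; apply: contD (contM cont_id (@cont_cst _)) (@cont_cst _).
    rewrite pE; have := lip c t hc ht; rewrite ler_norml => /andP[h1 _].
    have h2 := ler_wpM2l (ltW (f_gt0 c c0)) (norm_div_sub1 t a0 ac).
    have h3 := fcL c `|t - c| hc (normr_ge0 _).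
    have h4 := absorb c t; lra.
  apply: (form_le_of_quadratic (e := e) pT0 (selfadj_sub sF sM) _ k0).
    by move=> y; rewrite /= MT FT (opB _ _ bT).
  move=> c y hc; have [ac cb] := andP hc; have c0 : 0 < c := lt_le_trans a0 ac.
  rewrite -op_horner_quadratic_form //= ipDl ipNl lerBlDr addrC.
  have := lower c c0 y; rewrite -(lerD2r (ip (op_horner
    (e%:P + (L ^+ 2 / e) *: ('X - c%:P) ^+ 2) T y) y)); apply: le_trans.
  rewrite -ipDl -(fcalc_poly pT0 (@cont_horner _) (fun t _ => erefl)).
  have cg : cont_pos (fun t => f c * (1 + `|c / t - 1|)^-1).
    apply: contM; first exact: cont_cst.
    apply: (cont_comp _ cont_inv) => [|t t0]; last by rewrite ltr_pwDl.
    apply: contD; first exact: cont_cst.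
    by apply: cont_norm; apply: contD (contM (@cont_cst _) cont_inv) (@cont_cst _).
  rewrite -(fcalcD pT0) //; last exact: cont_horner.
  apply: (fcalc_le pT0) => // [|t ht]; first exact: contD cg (@cont_horner _).
  have [at_ tb] := andP ht.
  rewrite pE; have := lip c t hc ht; rewrite ler_norml => /andP[_ h1].
  have h2 := norm_div_sub1 c a0 at_; rewrite [`|c - t|]distrC in h2.
  have h3 := fcL c `|t - c| hc (normr_ge0 _).
  have h4 := absorb c t.
  have h5 : 1 - `|c / t - 1| <= (1 + `|c / t - 1|)^-1.
    set w := `|_|; have w0 : 0 <= w by exact: normr_ge0.
    by rewrite -div1r ler_pdivlMr ?ltr_pwDl //; nra.
  have h6 := ler_wpM2l (ltW (f_gt0 c c0)) h2.
  have h7 := ler_wpM2l (ltW (f_gt0 c c0)) h5.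
  lra.
apply: selfadj_eq => // x; apply/eqP; rewrite eq_le; apply/andP; split.
  apply/ler_addgt0Pr => e e0; pose d := e / (ip x x + 1).
  have x1 : 0 < ip x x + 1 by rewrite ltr_wpDl ?ip_ge0.
  have d0 : 0 < d by rewrite divr_gt0.
  have de : d * (ip x x + 1) = e by rewrite divfK // gt_eqF.
  have [h _] := bound d d0; have := h x; rewrite /= !ipE; lra.
apply/ler_addgt0Pr => e e0; pose d := e / (ip x x + 1).
have x1 : 0 < ip x x + 1 by rewrite ltr_wpDl ?ip_ge0.
have d0 : 0 < d by rewrite divr_gt0.
have de : d * (ip x x + 1) = e by rewrite divfK // gt_eqF.
have [_ h] := bound d d0; have := h x; rewrite /= !ipE; lra.
Qed.

Lemma sandwich_posinv A B (s : R) : posinv A -> posinv B -> posinv (sandwich A B s).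
Proof.
move=> pA pB; apply: posinv_conj; last exact: oppow_posinv.
by apply/oppow_posinv/posinv_conj => //; exact: oppow_posinv.
Qed.

Lemma cont_fbracket (r : R) : cont_pos (fbracket (repfun tau) r).
Proof.
apply: (@cont_comp (fun t => repfun tau (t `^ r)) (fun t => t `^ r^-1)).
- by apply: (cont_comp (@cont_powR r) cont_repfun) => t; exact: powR_gt0.
- exact: cont_powR.
- by move=> t t0; apply/repfun_gt0/powR_gt0.
Qed.

Lemma fbracket_gt0 (r t : R) : 0 < t -> 0 < fbracket (repfun tau) r t.
Proof. by move=> t0; apply/powR_gt0/repfun_gt0/powR_gt0. Qed.

Lemma fbracket_powR (r t : R) : 0 < r -> 0 < t ->
  fbracket (repfun tau) r t `^ r = repfun tau (t `^ r).
Proof.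
move=> r0 t0; rewrite /fbracket -powRrM mulVf ?gt_eqF // powRr1 //.
by apply/ltW/repfun_gt0/powR_gt0.
Qed.

Lemma pfcalcM3 A f g h k x : posinv A -> cont_pos f -> cont_pos g -> cont_pos h ->
  cont_pos k -> (forall t, 0 < t -> f t * g t * h t = k t) ->
  fcalc f A (fcalc g A (fcalc h A x)) = fcalc k A x.
Proof.
move=> pA cf cg ch ck e; have cfg := contM cf cg.
rewrite -(pfcalcM pA _ cf cg) -(pfcalcM pA _ cfg ch).
by rewrite (pfcalc_ext pA (contM cfg ch) ck e).
Qed.

Lemma tau_fcalc_value C (r c : R) (q := fbracket (repfun tau) r)
    (W := fcalc (fun t => c^-1 * q t) C) :
  posinv C -> 0 < r -> 0 < c ->
  tau (oppow W (1 - r)) (sandwich C W (1 - r)) = (c `^ (r - 1))%:C \*: fcalc q C.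
Proof.
move=> pC r0 c0.
have cq : cont_pos q by exact: cont_fbracket.
have q0 t : 0 < t -> 0 < q t by exact: fbracket_gt0.
have ccq : cont_pos (fun t => c^-1 * q t) by exact: contM (@cont_cst _) cq.
have cq0 t : 0 < t -> 0 < c^-1 * q t by move=> t0; rewrite mulr_gt0 ?invr_gt0 ?q0.
pose w t : R := (c^-1 * q t) `^ (1 - r).
have cw : cont_pos w by exact: cont_comp ccq (@cont_powR _) cq0.
have w0 t : 0 < t -> 0 < w t by move=> t0; exact/powR_gt0/cq0.
have WE : oppow W (1 - r) = fcalc w C.
  by apply/funext => x; rewrite /oppow pfcalc_fcalc //; exact: cont_powR.
pose S := fcalc (fun t => w t `^ 2^-1) C.
have cS : cont_pos (fun t => w t `^ 2^-1) by exact: cont_comp cw (@cont_powR _) w0.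
have pS : posinv S by apply: pfcalc_posinv => // t t0; exact/powR_gt0/w0.
have ww t : 0 < t -> w t `^ 2^-1 * w t `^ 2^-1 = w t.
  move=> t0; have wt := w0 t t0.
  by rewrite -powRD ?(gt_eqF wt) ?implybT // half_add powRr1 // ltW.
have SS x : S (S x) = fcalc w C x.
  by rewrite /S -pfcalcM //; congr (_ x); apply: pfcalc_ext => //; exact: contM.
have cr := @cont_powR r.
have GE : sandwich C W (1 - r) = S \o oppow C r \o S.
  have cm := @cont_powR (- 2^-1).
  pose v t : R := t `^ (- 2^-1) * (c^-1 * q t) * t `^ (- 2^-1).
  have cv : cont_pos v by exact: contM (contM cm ccq) cm.
  have v0 t : 0 < t -> 0 < v t.
    move=> t0; have tm := powR_gt0 (- 2^-1) t0.
    exact: mulr_gt0 (mulr_gt0 tm (cq0 t t0)) tm.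
  have inner : oppow C (- 2^-1) \o W \o oppow C (- 2^-1) = fcalc v C.
    by apply/funext => x; exact: (pfcalcM3 x pC cm ccq cm cv (fun t _ => erefl)).
  have ch := @cont_powR 2^-1.
  have cvs : cont_pos (fun t => v t `^ (1 - r)) by exact: cont_comp cv (@cont_powR _) v0.
  have ck : cont_pos (fun t => w t * t `^ r) by exact: contM cw cr.
  apply/funext => x; rewrite /sandwich inner /= /oppow /S.
  rewrite (pfcalc_fcalc pC _ cv (@cont_powR _) v0).
  rewrite (pfcalcM3 x pC ch cvs ch ck) => [|t t0].
    rewrite (pfcalcM3 x pC cS cr cS ck) // => t t0.
    by rewrite mulrAC ww.
  rewrite mulrAC -powRD ?(gt_eqF t0) ?implybT // half_add powRr1 ?(ltW t0) //.
  have -> : v t = (c^-1 * q t) * t `^ (- 1).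
    rewrite /v mulrAC mulrC -powRD ?(gt_eqF t0) ?implybT //; congr (_ * _ `^ _); lra.
  rewrite powRM ?powR_ge0 ?(ltW (cq0 t t0)) // -/(w t) mulrCA; congr (_ * _).
  rewrite -powRrM -{1}(powRr1 (ltW t0)) -powRD ?(gt_eqF t0) ?implybT //.
  by congr (_ `^ _); ring.
have WE2 : oppow W (1 - r) = S \o idfun \o S by apply/funext => x; rewrite WE /= SS.
have pCr := oppow_posinv pC r.
rewrite GE WE2 -(tau_conj posop_id (posinv_posop pCr) pS) (tau_id_fcalc pCr).
have cfr : cont_pos (fun t => repfun tau (t `^ r)).
  by apply: (cont_comp cr cont_repfun) => t; exact: powR_gt0.
have ck : cont_pos (fun t => c `^ (r - 1) * q t) by exact: contM (@cont_cst _) cq.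
apply/funext => x; rewrite /= /oppow -(pfcalcZ _ _ pC cq) /S.
rewrite (pfcalc_fcalc pC _ cr cont_repfun) => [|t]; last exact: powR_gt0.
apply: (pfcalcM3 x pC cS cfr cS ck) => t t0; rewrite mulrAC ww //.
have qt := q0 t t0.
rewrite -fbracket_powR // -/q /w powRM ?invr_ge0 ?(ltW c0) ?(ltW qt) //.
rewrite -mulrA -powRD ?(gt_eqF qt) ?implybT // subrK powRr1 ?(ltW qt) //.
by congr (_ * _); rewrite -powR_inv1 ?(ltW c0) // -powRrM; congr (_ `^ _); ring.
Qed.

(** * The bracket inequalities *)

Lemma tau_oppow_conj A B (r : R) (D := oppow A (- 1))
    (C := oppow A (- 2^-1) \o B \o oppow A (- 2^-1)) :
  posinv A -> posinv B ->
  tau (oppow A r) (oppow B r) = oppow A 2^-1 \o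
    tau (oppow D (1 - r)) (sandwich C D (1 - r)) \o oppow A 2^-1.
Proof.
move=> pA pB; have pAp u := oppow_posinv pA u.
have pD : posinv D by exact: oppow_posinv.
have pC : posinv C by exact: posinv_conj.
rewrite tau_conj //; try exact/posinv_posop/oppow_posinv; last first.
  exact/posinv_posop/sandwich_posinv.
congr tau; apply/funext => x /=.
  by rewrite oppowM // !oppowD //; congr (oppow A _ x); lra.
rewrite -sandwich_transpose // /sandwich /=.
have -> : oppow D (- 2^-1) \o C \o oppow D (- 2^-1) = B.
  apply/funext => y; rewrite /= !oppowM // /C /=.
  have -> : -1 * - 2^-1 = 2^-1 :> R by lra.
  by rewrite oppowNK // oppowK.
rewrite !oppowM //; have -> : -1 * 2^-1 = - 2^-1 :> R by lra.
by rewrite oppowNK // oppowK.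
Qed.

Section Bracket.
Variables (A B : H -> H) (r : R).
Hypotheses (pA : posinv A) (pB : posinv B) (r01 : 0 < r <= 1).

Let D := oppow A (- 1).
Let C := oppow A (- 2^-1) \o B \o oppow A (- 2^-1).
Let q := fbracket (repfun tau) r.
Let X := taubracket tau r A B.
Let W (c : R) := fcalc (fun t => c^-1 * q t) C.

Let pAp u : posinv (oppow A u). Proof. exact: oppow_posinv. Qed.
Let pD : posinv D. Proof. exact: oppow_posinv. Qed.
Let pC : posinv C. Proof. exact: posinv_conj. Qed.
Let cq : cont_pos q. Proof. exact: cont_fbracket. Qed.

Let ccq (c : R) : cont_pos (fun t => c^-1 * q t).
Proof. exact: contM (@cont_cst _) cq. Qed.

Let pW (c : R) : 0 < c -> posinv (W c).
Proof.
move=> c0; apply: pfcalc_posinv => // t t0.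
by rewrite mulr_gt0 ?invr_gt0 // fbracket_gt0.
Qed.

Let WE (c : R) : W c = c^-1%:C \*: (oppow A (- 2^-1) \o X \o oppow A (- 2^-1)).
Proof.
apply/funext => x; rewrite /W pfcalcZ // /X /taubracket /= -/C -/q.
by rewrite oppowNK // oppowK.
Qed.

Let DE : D = oppow A (- 2^-1) \o idfun \o oppow A (- 2^-1).
Proof. by apply/funext => x; rewrite /= oppowD // -opprD half_add. Qed.

Let scaled_bracket (c : R) : 0 < c -> (c `^ (r - 1))%:C \*: X =
  oppow A 2^-1 \o tau (oppow (W c) (1 - r)) (sandwich C (W c) (1 - r)) \o oppow A 2^-1.
Proof.
move=> c0; have [r0 _] := andP r01; rewrite tau_fcalc_value //; apply/funext => x /=.
by rewrite (opZ _ _ (posinv_bounded (pAp 2^-1))).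
Qed.

Let r1 : 0 <= 1 - r <= 1. Proof. by case/andP: r01 => ? ?; apply/andP; split; lra. Qed.

Lemma taubracket_le (c : R) : 0 < c -> op_le X (c%:C \*: idfun) ->
  op_le ((c `^ (r - 1))%:C \*: X) (tau (oppow A r) (oppow B r)).
Proof.
move=> c0 Xc; have sAp u := posinv_selfadj (pAp u); have pWc := pW c0.
rewrite (scaled_bracket c0) (tau_oppow_conj r pA pB); apply: (op_le_conj (sAp _)).
have WD : op_le (W c) D.
  rewrite (WE c) DE => x; rewrite /= ipZl ler_pdivrMl // !(sAp (- 2^-1)).2.
  by have := Xc (oppow A (- 2^-1) x); rewrite /= ipZl (sAp (- 2^-1)).2.
apply: tau_le.
- exact: (posinv_posop (oppow_posinv _ _)).
- exact: (posinv_posop (sandwich_posinv _ _ _)).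
- exact: (posinv_posop (oppow_posinv _ _)).
- exact: (posinv_posop (sandwich_posinv _ _ _)).
- exact: (lowner_heinz r1).
- exact: (sandwich_le (lowner_heinz r1)).
Qed.

Lemma taubracket_ge (c : R) : 0 < c -> op_le (c%:C \*: idfun) X ->
  op_le (tau (oppow A r) (oppow B r)) ((c `^ (r - 1))%:C \*: X).
Proof.
move=> c0 Xc; have sAp u := posinv_selfadj (pAp u); have pWc := pW c0.
rewrite (scaled_bracket c0) (tau_oppow_conj r pA pB); apply: (op_le_conj (sAp _)).
have DW : op_le D (W c).
  rewrite (WE c) DE => x; rewrite /= ipZl ler_pdivlMl // !(sAp (- 2^-1)).2.
  by have := Xc (oppow A (- 2^-1) x); rewrite /= ipZl (sAp (- 2^-1)).2.
apply: tau_le.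
- exact: (posinv_posop (oppow_posinv _ _)).
- exact: (posinv_posop (sandwich_posinv _ _ _)).
- exact: (posinv_posop (oppow_posinv _ _)).
- exact: (posinv_posop (sandwich_posinv _ _ _)).
- exact: (lowner_heinz r1).
- exact: (sandwich_le (lowner_heinz r1)).
Qed.

Lemma taubracket_posinv : posinv X.
Proof.
apply: posinv_conj => //; apply: pfcalc_posinv => // t; exact: fbracket_gt0.
Qed.

End Bracket.
Lemma op_le_opnorm A : bounded_op A -> op_le A ((opnorm A)%:C \*: idfun).
Proof.
move=> bA x; rewrite /= ipZl; have o0 := opnorm_ge0 bA.
apply: le_trans (ler_norm _) _.
rewrite -(ler_pXn2r (n := 2)) ?nnegrE ?mulr_ge0 ?ip_ge0 // real_normK ?num_real //.
apply: le_trans (cauchy_schwarz _ _) _.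
apply: le_trans (ler_wpM2r (ip_ge0 x) (opnorm_ub x bA)) _.
by rewrite exprMn -(mulrA (_ ^+ 2)) -expr2.
Qed.

Lemma opnorm_gt0 A : posinv A -> 0 < opnorm A.
Proof.
move=> pA; have [a [b [a0 _ [sA hA]]]] := pA; have [e e1] := exists_unit.
have := op_le_opnorm sA.1 e; have /andP[+ _] := hA e.
by rewrite /= ipZl e1 !mulr1 => h1 h2; exact: lt_le_trans a0 (le_trans h1 h2).
Qed.

Lemma lambda_min_spec A : posinv A ->
  0 < lambda_min A /\ op_le ((lambda_min A)%:C \*: idfun) A.
Proof.
move=> [a [b [a0 ab oA]]]; have [sA _] := oA.
have [s [lb glb]] := form_inf sA.
have sps := form_inf_spectrum sA lb glb.
have la : lbound (real_spectrum A) a.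
  by move=> t /(real_spectrum_opint oA) /andP[].
have ls : lambda_min A <= s by apply: ge_inf => //; exists a.
split.
  by apply: lt_le_trans a0 _; apply: lb_le_inf => //; exists s.
by move=> x; rewrite /= ipZl; apply: le_trans (lb x); rewrite ler_wpM2r ?ip_ge0.
Qed.

Lemma taubracket_self A (r : R) : posinv A -> 0 < r -> taubracket tau r A A = A.
Proof.
move=> pA r0; apply/funext => x; rewrite /taubracket /=.
have -> : oppow A (- 2^-1) \o A \o oppow A (- 2^-1) = 1%:C \*: idfun.
  apply/funext => y; rewrite /= oppow_op // oppowD // rmorph1 scale1r.
  by have -> : - 2^-1 + 1 + - 2^-1 = 0 :> R; [lra | rewrite oppow0].
have [a [b h]] := posinv_scalar (@ltr01 R).
have tab : a <= 1 <= b.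
  have [e e1] := exists_unit; have [_ _ [_ /(_ e)]] := h.
  by rewrite /= ipZl e1 !mulr1.
rewrite (fcalc_eigen h (@cont_fbracket r) tab) //.
by rewrite /fbracket !powR1 repfun1 powR1 rmorph1 scale1r oppow_half2.
Qed.

Lemma tau_self S : posinv S -> tau S S = S.
Proof.
move=> pS; have := tau_scaled pS ltr01; rewrite repfun1.
have -> : 1%:C \*: S = S by apply/funext => x; rewrite /= rmorph1 scale1r.
by [].
Qed.

(* The operator I + <., e> e has eigenvalues 2 on e and 1 on the orthogonal of e. *)
Lemma exists_two_eigenvalues : exists A e y,
  [/\ posint 1 3 A, ip e e = 1, 0 < ip y y, A e = 2%:C *: e & A y = 1%:C *: y].
Proof.
have [e e1] := exists_unit; have ee : dot e e = 1 by rewrite dot_self e1 rmorph1.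
have [x hx] : exists x : H, forall c : R[i], x <> c *: e.
  apply: contrapT => no; apply: (dimH (e := fun _ : 'I_1 => e)) => x.
  apply: contrapT => nx; apply: no; exists x => c xc; apply: nx.
  by exists (fun=> c); rewrite big_ord1.
pose y := x - dot x e *: e.
have ye : dot y e = 0 by rewrite linearBl linearZl_LR /= ee mulr1 subrr.
exists (idfun \+ rank_one e), e, y; split=> //.
- have [sE E0] := (posopP _).1 (rank_one_posop e).
  split; [by [] | lra | split=> [|z]; first exact: selfadj_add selfadj_id sE].
  rewrite /= ipDl rank_one_form; have h1 := cauchy_schwarz z e.
  have h2 := cauchy_schwarz z ('i *: e).
  rewrite ip_scale e1 normc_def /= expr0n expr1n add0r sqrtr1 expr1n !mulr1 in h1 h2.
  have := sqr_ge0 (ip z e); have := sqr_ge0 (ip z ('i *: e)).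
  by move=> h3 h4; apply/andP; split; lra.
- rewrite lt_def ip_ge0 andbT; apply/eqP => /(@ip_eq0) y0.
  by apply: (hx (dot x e)); apply/eqP; rewrite -subr_eq0 -/y y0.
- by rewrite /= /rank_one ee scale1r rmorphD rmorph1 scalerDl scale1r.
- by rewrite /= /rank_one ye scale0r addr0 rmorph1 scale1r.
Qed.

Lemma bracket_bounds_fail (r : R) : 1 < r -> exists2 A, posinv A &
  ~ op_le ((opnorm A `^ (r - 1))%:C \*: A) (oppow A r) /\
  ~ op_le (oppow A r) ((lambda_min A `^ (r - 1))%:C \*: A).
Proof.
move=> r1; have [A [e [y [p13 e1 y0 Ae Ay]]]] := exists_two_eigenvalues.
have pA : posinv A by exists 1, 3.
have [bA _] := posinv_selfadj pA; exists A => //.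
have Are : oppow A r e = (2 `^ r)%:C *: e.
  by apply: (fcalc_eigen p13 (@cont_powR r)) => //; apply/andP; split; lra.
have Ary : oppow A r y = (1 `^ r)%:C *: y.
  by apply: (fcalc_eigen p13 (@cont_powR r)) => //; apply/andP; split; lra.
have p1 : 1 `^ (r - 1) = 1 :> R by rewrite powR1.
have two : 1 < 2 `^ (r - 1) :> R.
  by rewrite -[ltLHS]p1; apply: gt0_ltr_powR; rewrite ?nnegrE; lra.
split=> h.
  have := h y; rewrite /= Ay Ary powR1 !ipZl mul1r ger_pMl // => h1.
  have o2 : 2 <= opnorm A.
    by have := op_le_opnorm bA e; rewrite /= Ae !ipZl e1 !mulr1.
  have : 2 `^ (r - 1) <= opnorm A `^ (r - 1).
    by apply: ge0_ler_powR; rewrite ?nnegrE; lra.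
  lra.
have [l0 l1] := lambda_min_spec pA.
have {}l1 : lambda_min A <= 1.
  by have := l1 y; rewrite /= Ay !ipZl mul1r ger_pMl.
have h1 : lambda_min A `^ (r - 1) <= 1.
  by rewrite -[leRHS]p1; apply: ge0_ler_powR; rewrite ?nnegrE; lra.
have := h e; rewrite /= Ae Are !ipZl e1 !mulr1 => h2.
have h3 : 2 `^ r = 2 `^ (r - 1) * 2 :> R.
  by rewrite -{3}(powRr1 (ler0n R 2)) -powRD ?subrK // pnatr_eq0 implybT.
lra.
Qed.

Lemma scale_posop (c : R) A : 0 <= c -> posinv A -> posop dot (c%:C \*: A).
Proof.
move=> c0 pA; apply/posopP; split; first exact: selfadj_scale (posinv_selfadj pA).
by move=> x; rewrite /= ipZl mulr_ge0 // posinv_ge0.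
Qed.

Lemma tau_oppow_posop A B (r : R) : posinv A -> posinv B ->
  posop dot (tau (oppow A r) (oppow B r)).
Proof. by move=> pA pB; apply: tau_pos; apply: posinv_posop; exact: oppow_posinv. Qed.

Lemma opnorm_bound_iff (r : R) : 0 < r ->
  (forall A B, posinvop dot A -> posinvop dot B ->
     leop dot ((opnorm (taubracket tau r A B) `^ (r - 1))%:C \*: taubracket tau r A B)
       (tau (oppow A r) (oppow B r))) <-> r <= 1.
Proof.
move=> r0; split=> [h|r1 A B /posinvopP pA /posinvopP pB].
  rewrite leNgt; apply/negP => r1; have [A pA [no _]] := bracket_bounds_fail r1.
  apply: no; have pA' : posinvop dot A by apply/posinvopP.
  have := leop_form (h A A pA' pA').
  by rewrite taubracket_self // (tau_self (oppow_posinv pA r)).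
have r01 : 0 < r <= 1 by rewrite r0.
have pX := taubracket_posinv r pA pB.
apply: leop_posop; first by apply: scale_posop pX; exact: powR_ge0.
  exact: tau_oppow_posop.
apply: (taubracket_le pA pB r01 (opnorm_gt0 pX)).
exact: (op_le_opnorm (posinv_bounded pX)).
Qed.

Lemma lambda_min_bound_iff (r : R) : 0 < r ->
  (forall A B, posinvop dot A -> posinvop dot B ->
     leop dot (tau (oppow A r) (oppow B r))
       ((lambda_min (taubracket tau r A B) `^ (r - 1))%:C \*: taubracket tau r A B))
  <-> r <= 1.
Proof.
move=> r0; split=> [h|r1 A B /posinvopP pA /posinvopP pB].
  rewrite leNgt; apply/negP => r1; have [A pA [_ no]] := bracket_bounds_fail r1.
  apply: no; have pA' : posinvop dot A by apply/posinvopP.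
  have := leop_form (h A A pA' pA').
  by rewrite taubracket_self // (tau_self (oppow_posinv pA r)).
have r01 : 0 < r <= 1 by rewrite r0.
have pX := taubracket_posinv r pA pB; have [l0 hl] := lambda_min_spec pX.
apply: leop_posop; first exact: tau_oppow_posop.
  by apply: scale_posop pX; exact: powR_ge0.
exact: (taubracket_ge pA pB r01 l0 hl).
Qed.

End Hilbert.

Theorem proposition6p1 (R : realType) (H : completeNormedModType R[i])
    (dot : {dot H for Num.conj})
    (dot_norm : induces_norm dot)
    (dimH : infinite_dimensional H)
    (tau : (H -> H) -> (H -> H) -> (H -> H))
    (tau_mean : operator_mean dot tau) :
  ([set` `]0, 1]] : set R) =
    [set r : R | 0 < r /\
      forall A B : H -> H, posinvop dot A -> posinvop dot B ->
        let X := taubracket tau r A B in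
        leop dot ((opnorm X `^ (r - 1))%:C \*: X)
                 (tau (oppow A r) (oppow B r))]
  /\
  ([set` `]0, 1]] : set R) =
    [set r : R | 0 < r /\
      forall A B : H -> H, posinvop dot A -> posinvop dot B ->
        let X := taubracket tau r A B in
        leop dot (tau (oppow A r) (oppow B r))
                 ((lambda_min X `^ (r - 1))%:C \*: X)].
Proof.
split; apply/seteqP; split=> r /=; rewrite in_itv /=.
- move=> /andP[r0 r1]; split=> //.
  exact/(opnorm_bound_iff dot_norm dimH tau_mean r0).
- by move=> [r0 /(opnorm_bound_iff dot_norm dimH tau_mean r0) ->]; rewrite r0.
- move=> /andP[r0 r1]; split=> //.
  exact/(lambda_min_bound_iff dot_norm dimH tau_mean r0).
- by move=> [r0 /(lambda_min_bound_iff dot_norm dimH tau_mean r0) ->]; rewrite r0.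
Qed.
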